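(* Let $1\le d\le N$ be integers, $t>0$, and $z=e^{-t/2}$. The microchiral partition function $Z_N^d$ of two-dimensional Yang--Mills theory with gauge group $\mathrm{U}_N$ on a cylinder of area $t$ admits the absolutely convergent series expansion $$Z_N^d=\frac{z^d}{d!}\sum_{\alpha,\beta\in\mathsf{Y}^d}P_{\alpha\beta}\sum_{r=0}^\infty\frac{(-t)^r}{r!\,N^r}\,\langle K_{\alpha\beta}K^r\rangle,$$ where $\langle K_{\alpha\beta}K^r\rangle=\langle K_\alpha|K^r|K_\beta\rangle$ is a double Hurwitz number, i.e. the number of $r$-step walks in the Hurwitz--Cayley graph $\mathrm{S}^d$ which begin at a point of $K_\alpha$ and end at a point of $K_\beta$.
   Context: $\mathsf{Y}^d$ is the set of Young diagrams with exactly $d$ cells and $\mathsf{Y}^d_N$ the subset of those with at most $N$ rows. For $\lambda\in\mathsf{Y}^d_N$, $s_\lambda$ is the character of the irreducible representation of the unitary group $\mathrm{U}_N$ with highest weight $\lambda$, and $\hat C(\lambda)=\sum_{i=1}^N\lambda_i(\lambda_i+N+1-2i)$ is the corresponding eigenvalue of the quadratic Casimir. The microchiral partition function of the cylinder (two holes, no handles) is the function on $\mathrm{U}_N\times\mathrm{U}_N$ defined by $$Z_N^d(U_1,U_2)=\sum_{\lambda\in\mathsf{Y}^d_N}s_\lambda(U_1)s_\lambda(U_2)e^{-\frac{t}{2N}\hat C(\lambda)}.$$ $p_\alpha(U)=\prod_{i=1}^{\ell(\alpha)}\mathrm{Tr}\,U^{\alpha_i}$ (with $\ell(\alpha)$ the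 number of rows of $\alpha$) and $P_{\alpha\beta}(U_1,U_2)=p_\alpha(U_1)p_\beta(U_2)$. For $\alpha\in\mathsf{Y}^d$, $K_\alpha$ denotes the conjugacy class of permutations of cycle type $\alpha$ in the symmetric group $\mathrm{S}^d$, and also the corresponding class sum in $\mathbb{C}\mathrm{S}^d$; $K$ is the class (and class sum) of all transpositions; $K_{\alpha\beta}=K_\alpha K_\beta$. For $A\in\mathbb{C}\mathrm{S}^d$, $\langle A\rangle$ denotes the coefficient of the identity permutation in $A$. The Hurwitz--Cayley graph has vertex set $\mathrm{S}^d$, with $\rho,\sigma$ adjacent if and only if $\sigma=\rho\tau$ for a transposition $\tau$. $\langle K_\alpha|K^r|K_\beta\rangle$ is the matrix element of $K^r$ acting by multiplication on $\mathbb{C}\mathrm{S}^d$, with the permutations as orthonormal basis. *)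

(* Defs.v *)
From mathcomp Require Export all_boot all_order all_algebra all_fingroup all_character.
From mathcomp Require Export all_classical all_reals all_analysis complex.

Set Implicit Arguments.
Unset Strict Implicit.
Unset Printing Implicit Defensive.

Export Order.TTheory GRing.Theory Num.Theory numFieldNormedType.Exports.

Local Open Scope classical_set_scope.
Local Open Scope ring_scope.
Local Open Scope complex_scope.

(* A Young diagram with d cells is encoded by its d first row lengths (the     *)
(* trailing ones may be 0), which are weakly decreasing with sum d.            *)
Definition young (d : nat) : {set d.-tuple 'I_d.+1} :=
  [set lam : d.-tuple 'I_d.+1 |
    sorted geq [seq val x | x <- lam] & (\sum_(x <- lam) val x == d)%N].

Definition rows (d : nat) (lam : d.-tuple 'I_d.+1) : seq nat :=
  [seq a <- [seq val x | x <- lam] | (0 < a)%N].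

Definition youngN (d N : nat) : {set d.-tuple 'I_d.+1} :=
  [set lam in young d | (size (rows lam) <= N)%N].

(* The i-th row, i being counted from 0; it is 0 beyond the last row. *)
Definition row_len (d : nat) (lam : d.-tuple 'I_d.+1) (i : nat) : nat :=
  nth 0%N (rows lam) i.

Section UnitaryRepresentations.
Variables (C : numClosedFieldType) (N : nat).

(* Continuous finite-dimensional complex representations of U_N. Only the      *)
(* values of rho on unitary matrices are meaningful.                           *)
Definition unitary_repr (n : nat) (rho : 'M[C]_N -> 'M[C]_n) : Prop :=
  [/\ rho 1%:M = 1%:M,
      {in unitarymx &, {morph rho : U V / U *m V}}
    & {within [set U | U \is unitarymx], continuous rho}].

(* As in mxrepresentation, rho U acts by v |-> v *m rho U on row vectors, and  *)
(* the subspaces of C^n are the row spaces of square matrices.                 *)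
Definition unitary_irreducible (n : nat) (rho : 'M[C]_N -> 'M[C]_n) : Prop :=
  (0 < n)%N /\
  forall W : 'M[C]_n, {in unitarymx, forall U, stablemx W (rho U)} ->
    W = 0 \/ row_full W.

Definition weight (n : nat) (rho : 'M[C]_N -> 'M[C]_n) (mu : 'I_N -> int) : Prop :=
  exists2 v : 'rV[C]_n, v != 0 &
    forall x : 'rV[C]_N, (forall i, `|x 0 i| = 1) ->
      v *m rho (diag_mx x) = (\prod_(i < N) x 0 i ^ mu i) *: v.

(* The usual order on weights: lam - mu is a combination with coefficients in  *)
(* the natural numbers of the simple roots e_k - e_(k+1), the coefficient of   *)
(* which is the difference of the partial sums below.                          *)
Definition weight_le (mu lam : 'I_N -> int) : Prop :=
  (forall k : nat, \sum_(i < N | (i < k)%N) mu i <= \sum_(i < N | (i < k)%N) lam i)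
  /\ \sum_(i < N) mu i = \sum_(i < N) lam i.

Definition highest_weight (n : nat) (rho : 'M[C]_N -> 'M[C]_n)
    (lam : 'I_N -> int) : Prop :=
  weight rho lam /\ forall mu, weight rho mu -> weight_le mu lam.

Definition irr_character (lam : 'I_N -> int) (chi : 'M[C]_N -> C) : Prop :=
  exists n (rho : 'M[C]_N -> 'M[C]_n),
    [/\ unitary_repr rho, unitary_irreducible rho, highest_weight rho lam
      & {in unitarymx, forall U, chi U = \tr (rho U)}].

(* The character of the irreducible representation of highest weight lam; its  *)
(* values outside U_N are irrelevant.                                          *)
Definition schur (d : nat) (lam : d.-tuple 'I_d.+1) : 'M[C]_N -> C :=
  xget (fun=> 0) [set chi | irr_character (fun i => (row_len lam i)%:Z) chi].

Definition psum (d : nat) (alpha : d.-tuple 'I_d.+1) (U : 'M[C]_N) : C :=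
  \prod_(a <- rows alpha) \tr (U ^+ a).

Definition psum2 (d : nat) (alpha beta : d.-tuple 'I_d.+1) (U1 U2 : 'M[C]_N) : C :=
  psum alpha U1 * psum beta U2.

End UnitaryRepresentations.

(* The summation index i : 'I_N starts from 0, hence i.+1. *)
Definition casimir (N d : nat) (lam : d.-tuple 'I_d.+1) : int :=
  \sum_(i < N) (row_len lam i)%:Z
     * ((row_len lam i)%:Z + N%:Z + 1 - 2 * (i.+1)%:Z).

Definition Zcyl (R : realType) (N d : nat) (t : R) (U1 U2 : 'M[R[i]]_N) : R[i] :=
  \sum_(lam in youngN d N)
     schur lam U1 * schur lam U2
       * (expR (- (t / (2 * N%:R)) * (casimir N lam)%:~R))%:C.

Definition cycle_class (d : nat) (alpha : d.-tuple 'I_d.+1) : {set 'S_d} :=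
  [set s : 'S_d | perm_eq [seq #|(c : {set 'I_d})| | c <- enum (porbits s)] (rows alpha)].

Definition transpositions (d : nat) : {set 'S_d} :=
  [set s : 'S_d | [exists i, exists j, (i != j) && (s == tperm i j)]].

(* The group algebra C[S_d] is represented, as in mxrepresentation, by the     *)
(* matrices of right multiplication in the basis of permutations; the element  *)
(* can be read off the row of the identity permutation.                        *)
Section GroupAlgebra.
Variables (C : numClosedFieldType) (d : nat).
Let G : {group 'S_d} := [set: 'S_d]%G.

Definition coef (A : 'M[C]_(gcard G)) (s : 'S_d) : C :=
  gring_row A 0 (gring_index G s).

Definition class_sum (alpha : d.-tuple 'I_d.+1) : 'M[C]_(gcard G) :=
  gset_mx C G (cycle_class alpha).

Definition transp_sum : 'M[C]_(gcard G) := gset_mx C G (transpositions d).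

Definition hurwitz (alpha beta : d.-tuple 'I_d.+1) (r : nat) : C :=
  coef (class_sum alpha *m class_sum beta *m transp_sum ^+ r) 1%g.

Definition matrix_element (A B D : 'M[C]_(gcard G)) : C :=
  \sum_(s : 'S_d) (coef A s)^* * coef (B *m D) s.

End GroupAlgebra.

Definition hurwitz_cayley (d : nat) : rel 'S_d :=
  fun rho sigma => [exists tau in transpositions d, sigma == (rho * tau)%g].

(* A walk is given by its starting point and the sequence of its next points. *)
Definition walks (d : nat) (alpha beta : d.-tuple 'I_d.+1) (r : nat) :
    {set 'S_d * r.-tuple 'S_d} :=
  [set w : 'S_d * r.-tuple 'S_d |
    [&& w.1 \in cycle_class alpha, path (@hurwitz_cayley d) w.1 w.2
      & last w.1 w.2 \in cycle_class beta]].

(* Main.v *)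
(** Let E be the d-th tensor power of C^N and let T be the sum of the
    transpositions acting on E. Schur-Weyl duality in trace form reads
      sum_lam s_lam(U1) s_lam(U2) kappa_lam^r
        = 1/d! sum_s tr_E(U1 s^-1) tr_E(s U2 T^r),
    where kappa_lam = (C(lam) - dN) / 2 is the scalar by which T acts on the
    U_N-module of highest weight lam. The right-hand side expands in power sums,
    because tr_E(U s) = p_alpha(U) for s of cycle type alpha, and T^r counts
    factorizations into r transpositions; summing over r against
    (-t/N)^r / r! gives the expansion, since exp(-t C(lam) / 2N) is
    z^d exp(-t kappa_lam / N).

    The module of highest weight lam is an irreducible submodule of the
    column-antisymmetrized part of E; the Casimir element, which is dN + 2T on E,
    is evaluated on a highest weight vector. The restriction of a representation
    to the torus is diagonal: elements of dyadic order are simultaneously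
    diagonalizable, and continuity does the rest. Every representation with
    nonnegative weights of degree d has a character in the span of the characters
    of these modules, by triangularity with respect to dominance; hence there is
    a single irreducible character of highest weight lam, and E contains no
    irreducible module outside this family. *)

Require Import Defs.
From mathcomp Require Import ring zify.

Set Implicit Arguments.
Unset Strict Implicit.
Unset Printing Implicit Defensive.

Local Open Scope ring_scope.

(** * The group algebra of the unitary group *)

(** A Schur function is specified only as the character of some irreducible continuous
    representation with a given highest weight, so that its value has to be shown independent of the
    representation, among all of them and not only inside the tensor power. Averages over the
    unitary group are replaced by algebra with finite formal combinations of unitary matrices.
    Burnside's theorem turns irreducibility into a full matrix algebra; a combination that acts as 0
    on one representation but not on an irreducible second one can then be normalized to act as 1 on
    the second, and finite Fourier sums over torsion points of the torus supply such combinations.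
    The span of the unitary tensors is the whole commutant of the permutations because membership in
    a subspace passes from finitely many points of a polynomial curve to all of it. This lets the
    trace identity be proved with matrix units of the commutant alone, without constructing the
    irreducible modules of the symmetric group. *)

Lemma subspace_mx (F : fieldType) (n : nat) (S : 'rV[F]_n -> Prop) :
    S 0 -> (forall u v, S u -> S v -> S (u + v)) ->
    (forall c u, S u -> S (c *: u)) ->
  exists W : 'M[F]_n, forall u, (u <= W)%MS <-> S u.
Proof.
move=> S0 SD SZ.
pose P r := `[< exists W : 'M[F]_n, \rank W = r /\ forall u, (u <= W)%MS -> S u >].
have exP : exists r, P r.
  exists 0%N; apply/asboolP; exists 0; split; first exact: mxrank0.
  by move=> u; rewrite submx0 => /eqP ->.
have ubP r : P r -> (r <= n)%N by move=> /asboolP[W [<- _]]; exact: rank_leq_row.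
case: (ex_maxnP exP ubP) => r /asboolP[W [rW WS]] maxr.
exists W => u; split=> [/WS//|Su]; apply: contraPT isT => uW _.
have: P (\rank (W + u)%MS).
  apply/asboolP; exists (W + u)%MS; split=> // v /sub_addsmxP[[a b] ->].
  apply: SD; first by apply: WS; rewrite submxMl.
  by rewrite [b]mx11_scalar mul_scalar_mx; apply: SZ.
move=> /maxr; rewrite -rW leqNgt => /negP; apply.
rewrite ltnNge; apply: contra uW => leW.
have := mxrank_leqif_sup (addsmxSl W u) => -[le1].
have -> : \rank W == \rank (W + u)%MS by rewrite eqn_leq le1 leW.
by move/esym/(submx_trans (addsmxSr W u)).
Qed.

Section UnitaryGroupAlgebra.
Variables (C : numClosedFieldType) (N : nat).
Implicit Types (a b : seq (C * 'M[C]_N)) (U V : 'M[C]_N).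

Definition unitary_hom (n : nat) (rho : 'M[C]_N -> 'M[C]_n) : Prop :=
  rho 1%:M = 1%:M /\ {in unitarymx &, {morph rho : U V / U *m V}}.

(* An element of the group algebra of U_N is a formal combination of unitary   *)
(* matrices, on which a representation acts through [ev].                      *)
Definition galg a := all (fun p => p.2 \is unitarymx) a.
Definition ev (n : nat) (rho : 'M[C]_N -> 'M[C]_n) a := \sum_(p <- a) p.1 *: rho p.2.
Definition gmul a b := [seq (p.1 * q.1, p.2 *m q.2) | p <- a, q <- b].
Definition gscale (c : C) a := [seq (c * p.1, p.2) | p <- a].

Lemma unitary1 : (1%:M : 'M[C]_N) \is unitarymx.
Proof. by apply/unitarymxP; rewrite trmx1 map_mx1 mulmx1. Qed.

Lemma galg_cat a b : galg (a ++ b) = galg a && galg b.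
Proof. exact: all_cat. Qed.

Lemma galg_scale c a : galg (gscale c a) = galg a.
Proof. by rewrite /galg all_map. Qed.

Lemma galg_mul a b : galg a -> galg b -> galg (gmul a b).
Proof.
move=> /allP ga /allP gb; apply/allP => _ /allpairsP[[p q] [/= pa qb ->]] /=.
by apply: mul_unitarymx; [exact: ga | exact: gb].
Qed.

Lemma galg1 U : U \is unitarymx -> galg [:: (1, U)].
Proof. by rewrite /galg /= andbT. Qed.

Section Evaluation.
Variables (n : nat) (rho : 'M[C]_N -> 'M[C]_n).

Lemma ev_nil : ev rho [::] = 0.
Proof. by rewrite /ev big_nil. Qed.

Lemma ev_cat a b : ev rho (a ++ b) = ev rho a + ev rho b.
Proof. by rewrite /ev big_cat. Qed.

Lemma ev_scale c a : ev rho (gscale c a) = c *: ev rho a.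
Proof.
rewrite /ev big_map scaler_sumr; apply: eq_bigr => p _ /=.
by rewrite scalerA.
Qed.

Lemma ev1 U : ev rho [:: (1, U)] = rho U.
Proof. by rewrite /ev big_seq1 scale1r. Qed.

Hypothesis rhoP : unitary_hom rho.

Lemma ev_mul a b : galg a -> galg b -> ev rho (gmul a b) = ev rho a *m ev rho b.
Proof.
move=> /allP ga /allP gb; rewrite /ev /gmul big_allpairs_dep /= mulmx_suml.
rewrite big_seq [RHS]big_seq; apply: eq_bigr => p pa; rewrite mulmx_sumr.
rewrite big_seq [RHS]big_seq; apply: eq_bigr => q qb /=.
by rewrite (rhoP.2 _ _ (ga _ pa) (gb _ qb)) -scalemxAl -scalemxAr scalerA.
Qed.

Lemma ev_sum (I : Type) (s : seq I) (f : I -> 'M[C]_n) :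
    (forall i, exists2 a, galg a & ev rho a = f i) ->
  exists2 a, galg a & ev rho a = \sum_(i <- s) f i.
Proof.
move=> fP; elim: s => [|i s [a ga ea]].
  by exists [::] => //; rewrite big_nil ev_nil.
have [b gb eb] := fP i; exists (b ++ a); first by rewrite galg_cat gb.
by rewrite big_cons ev_cat ea eb.
Qed.

Hypothesis rho_irr : unitary_irreducible rho.

(** The vectors reached from [v] by the group algebra form an invariant subspace, nonzero because it
    contains [v]. *)
Lemma irreducible_transitive (v w : 'rV[C]_n) :
  v != 0 -> exists2 a, galg a & w = v *m ev rho a.
Proof.
move=> v0.
have [||c u [a ga ->]|W WP] :=
    @subspace_mx C n (fun w => exists2 a, galg a & w = v *m ev rho a).
- by exists [::] => //; rewrite ev_nil mulmx0.
- move=> x y [a ga ->] [b gb ->]; exists (a ++ b); first by rewrite galg_cat ga.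
  by rewrite ev_cat mulmxDr.
- by exists (gscale c a); rewrite ?galg_scale // ev_scale scalemxAr.
have Wst : {in unitarymx, forall U, stablemx W (rho U)}.
  move=> U uU; apply/row_subP => i; rewrite row_mul.
  have [a ga ->] := (WP (row i W)).1 (row_sub i W).
  apply/WP; exists (gmul a [:: (1, U)]); first by rewrite galg_mul ?galg1.
  by rewrite ev_mul ?galg1 // ev1 mulmxA.
have [W0|Wfull] := rho_irr.2 W Wst; last by apply/WP; exact: submx_full.
have /WP : exists2 a, galg a & v = v *m ev rho a.
  by exists [:: (1, 1%:M)]; rewrite ?galg1 ?unitary1 // ev1 rhoP.1 mulmx1.
by rewrite W0 submx0 (negPf v0).
Qed.

Lemma rank1_factor (m k : nat) (T : 'M[C]_(m, k)) :
  \rank T = 1%N -> exists (p : 'cV[C]_m) (q : 'rV[C]_k), T = p *m q.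
Proof.
move=> r1; have := mulmx_base T; move: (col_base T) (row_base T).
by rewrite r1 => p q <-; exists p, q.
Qed.

(* As long as the rank of [T] exceeds 1, some [T b T - c T] is nonzero and has *)
(* smaller rank, [c] being an eigenvalue of [b T] on the row space of [T].     *)
Lemma irreducible_rank1 a :
  galg a -> ev rho a != 0 -> exists2 b, galg b & \rank (ev rho b) = 1%N.
Proof.
have [r] := ubnP (\rank (ev rho a)); elim: r a => // r IH a; rewrite ltnS => ler ga T0.
set T := ev rho a in T0 ler.
have rT : (0 < \rank T)%N by rewrite lt0n mxrank_eq0.
have [r1|r1] := eqVneq (\rank T) 1%N; first by exists a.
have [i Ti] : exists i, row i T != 0.
  apply/existsP; apply: contraNT T0; rewrite negb_exists => /forallP h.
  by apply/eqP/row_matrixP => i; rewrite row0; apply/eqP; move: (h i); rewrite negbK.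
have [j Tj] : exists j, ~~ (row j T <= row i T)%MS.
  apply/existsP; apply: contraNT r1; rewrite negb_exists => /forallP h.
  have: (T <= row i T)%MS by apply/row_subP => j; move: (h j); rewrite negbK.
  move=> /mxrankS; rewrite rank_rV Ti => le1.
  by rewrite eqn_leq le1 rT.
have [b gb eb] := irreducible_transitive (delta_mx 0 j) Ti.
have [|c /eigenvalueP[u]] :=
    @eigenvalue_closed C _ (row_base T *m ev rho b *m col_base T); first exact: rT.
move=> uc u0; set B := ev rho b in eb uc.
pose d := gmul (gmul a b) a ++ gscale (- c) a.
have gd : galg d by rewrite galg_cat galg_scale !galg_mul.
have ed : ev rho d = T *m (B *m T - c%:M).
  rewrite ev_cat ev_scale !ev_mul ?galg_mul // mulmxBr mulmxA scaleNr.
  by congr (_ - _); rewrite scalar_mxC mul_scalar_mx.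
have d0 : ev rho d != 0.
  apply: contraNneq Tj => d0; have: row i (ev rho d) = 0 by rewrite d0 row0.
  rewrite ed row_mul mulmxBr mulmxA -eb -rowE => /eqP; rewrite subr_eq0 => /eqP ->.
  by rewrite scalar_mxC mul_scalar_mx scalemx_sub.
apply: (IH d) => //; apply: leq_trans ler.
rewrite ed -(mxrank_mul_ker T (B *m T - c%:M)) -[X in (X < _)%N]addn0 ltn_add2l.
rewrite lt0n mxrank_eq0; apply/negP => /eqP ker0.
have: (u *m row_base T <= T :&: kermx (B *m T - c%:M))%MS.
  rewrite sub_capmx mulmx_sub ?eq_row_base //=; apply/sub_kermxP.
  rewrite mulmxBr scalar_mxC mul_scalar_mx -[X in B *m X](mulmx_base T).
  by rewrite scalemxAl -uc !mulmxA subrr.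
rewrite ker0 submx0 => /eqP uT0; move: u0.
have: u *m row_base T *m pinvmx (row_base T) = 0 by rewrite uT0 mul0mx.
by rewrite mulmxKp ?row_base_free // => ->; rewrite eqxx.
Qed.

(** Transitivity for columns, without passing to the dual representation: a nonzero [x] could be
    moved to a coordinate row that reads off a nonzero entry of [p]. *)
Lemma irreducible_col0 (x : 'rV[C]_n) (p : 'cV[C]_n) :
  p != 0 -> (forall a, galg a -> x *m ev rho a *m p = 0) -> x = 0.
Proof.
move=> p0 xp; apply/eqP; apply: contraT => x0.
have [i pi] : exists i, p i 0 != 0.
  apply/existsP; apply: contraNT p0; rewrite negb_exists => /forallP h.
  apply/eqP/matrixP => i j; rewrite (ord1 j) mxE.
  by apply/eqP; move: (h i); rewrite negbK.
have [a ga ea] := irreducible_transitive (delta_mx 0 i) x0.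
have := xp a ga; rewrite -ea -rowE => /matrixP/(_ 0 0); rewrite !mxE => pi0.
by rewrite pi0 eqxx in pi.
Qed.

(** Once [p *m q] is attained, so is every [b p q c]. Irreducibility lets [q c] be any row and makes
    the columns [b p] span. *)
Theorem burnside (M : 'M[C]_n) : exists2 a, galg a & ev rho a = M.
Proof.
have n0 : (0 < n)%N := rho_irr.1.
have [||a ga /[dup] rk1 /rank1_factor[p [q Tpq]]] := @irreducible_rank1 [:: (1, 1%:M)].
- by rewrite galg1 ?unitary1.
- by rewrite ev1 rhoP.1 -mxrank_eq0 mxrank1 -lt0n.
have p0 : p != 0 by apply: contra_eq_neq rk1 => p0; rewrite Tpq p0 mul0mx mxrank0.
have q0 : q != 0 by apply: contra_eq_neq rk1 => q0; rewrite Tpq q0 mulmx0 mxrank0.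
(* These are the transposed columns whose products with every row are attained; if they did not
   span, a nonzero row [x] would annihilate every [b p]. *)
pose S (w : 'rV[C]_n) := forall q', exists2 b, galg b & ev rho b = w^T *m q'.
have [||c u Su q'|W WP] := @subspace_mx C n S.
- by move=> q'; exists [::] => //; rewrite ev_nil trmx0 mul0mx.
- move=> u v Su Sv q'; have [b gb eb] := Su q'; have [b' gb' eb'] := Sv q'.
  by exists (b ++ b'); rewrite ?galg_cat ?gb // ev_cat eb eb' linearD mulmxDl.
- have [b gb eb] := Su q'; exists (gscale c b); rewrite ?galg_scale //.
  by rewrite ev_scale eb linearZ -scalemxAl.
have Wfull : row_full W.
  rewrite -col_leq_rank leqNgt; apply/negP => rW.
  have: kermx W^T != 0 by rewrite kermx_eq0 -row_leq_rank mxrank_tr -ltnNge.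
  move=> /rowV0Pn[x /sub_kermxP xW]; apply/negP; rewrite negbK; apply/eqP.
  apply: (irreducible_col0 p0) => b gb; apply: trmx_inj.
  have: ((ev rho b *m p)^T <= W)%MS.
    apply/WP => q'; have [c gc ec] := irreducible_transitive q' q0.
    exists (gmul (gmul b a) c); first by rewrite !galg_mul.
    by rewrite !ev_mul ?galg_mul // Tpq trmxK ec !mulmxA.
  by move=> /submxP[D eD]; rewrite -mulmxA trmx_mul eD trmx0 -mulmxA -[W]trmxK -trmx_mul xW trmx0 mulmx0.
have [a' ga' ea'] : exists2 b, galg b & ev rho b = \sum_i (delta_mx 0 i)^T *m row i M.
  by apply: ev_sum => i; exact: ((WP _).1 (submx_full _ Wfull)).
exists a' => //; rewrite ea'; apply/matrixP => i j; rewrite summxE (bigD1 i) //=.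
rewrite !mxE big_ord1 !mxE !eqxx mul1r big1 ?addr0 // => k ki.
by rewrite !mxE big_ord1 !mxE andbC eq_sym (negPf ki) mul0r.
Qed.

(** By [burnside] the vanishing extends from the matrices [rho U] to all matrices, and the trace
    form of the full matrix algebra is nondegenerate. *)
Lemma ev0_of_trace0 a :
    galg a -> {in unitarymx, forall U, \tr (rho U *m ev rho a) = 0} ->
  ev rho a = 0.
Proof.
move=> ga tr0; apply/matrixP => i j; rewrite mxE.
have [b gb eb] := burnside (delta_mx j i).
have: \tr (ev rho b *m ev rho a) = 0.
  rewrite /ev mulmx_suml raddf_sum big_seq big1 // => p pb /=.
  rewrite -scalemxAl mxtraceZ tr0 ?mulr0 //.
  by move/allP: gb => /(_ p pb).
rewrite eb /mxtrace (bigD1 j) //= big1 => [|k kj].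
  rewrite addr0 mxE (bigD1 i) //= big1 => [|k ki].
    by rewrite addr0 mxE !eqxx mul1r.
  by rewrite mxE (negPf ki) andbF mul0r.
by rewrite mxE big1 // => l _; rewrite mxE (negPf kj) mul0r.
Qed.

End Evaluation.

(** * Separating representations by elements of the group algebra *)

Section Separation.
Variables (n m : nat) (rho : 'M[C]_N -> 'M[C]_n) (sigma : 'M[C]_N -> 'M[C]_m).
Hypotheses (rhoP : unitary_hom rho) (sigmaP : unitary_hom sigma).
Hypothesis rho_irr : unitary_irreducible rho.

Definition separated := exists a, [/\ galg a, ev rho a = 1%:M & ev sigma a = 0].

(** The elements killed by [sigma] form a two-sided ideal, and its image under [rho] is a nonzero
    ideal of a full matrix algebra. Explicitly, a nonzero entry of [ev rho a] is moved to each
    diagonal position and normalized. *)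
Lemma separatedP a : galg a -> ev rho a != 0 -> ev sigma a = 0 -> separated.
Proof.
move=> ga a0 sa0.
have /existsP[i /existsP[j aij]] : [exists i, exists j, ev rho a i j != 0].
  apply: contraNT a0; rewrite negb_exists => /forallP h.
  apply/eqP/matrixP => i j; rewrite mxE; apply/eqP; move: (h i).
  by rewrite negb_exists => /forallP/(_ j); rewrite negbK.
have hE k : exists b, [/\ galg b, ev rho b = delta_mx k k & ev sigma b = 0].
  have [b gb eb] := burnside rhoP rho_irr (delta_mx k i).
  have [c gc ec] := burnside rhoP rho_irr (delta_mx j k).
  exists (gscale (ev rho a i j)^-1 (gmul (gmul b a) c)); split.
  - by rewrite galg_scale !galg_mul.
  - rewrite ev_scale !ev_mul ?galg_mul // eb ec.
    apply/matrixP => x y; rewrite !mxE (bigD1 j) //= big1 => [|l lj].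
      rewrite addr0 !mxE (bigD1 i) //= big1 => [|l li].
        rewrite !mxE !eqxx addr0 andbT /=.
        case: (x == k); case: (y == k); rewrite ?mul0r ?mulr0 // mul1r mulr1.
        by rewrite mulVf.
      by rewrite mxE (negPf li) andbF mul0r.
    by rewrite [X in _ * X]mxE (negPf lj) mulr0.
  - by rewrite ev_scale !ev_mul ?galg_mul // sa0 mulmx0 mul0mx scaler0.
suff [b [gb eb sb]] : exists b, [/\ galg b, ev rho b = \sum_k delta_mx k k & ev sigma b = 0].
  exists b; split=> //; rewrite eb; apply/matrixP => x y; rewrite summxE mxE.
  rewrite (bigD1 x) //= big1 => [|k kx]; first by rewrite mxE eqxx addr0 eq_sym.
  by rewrite mxE eq_sym (negPf kx).
elim: (index_enum _) => [|k s [b [gb eb sb]]].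
  by exists [::]; rewrite !ev_nil big_nil.
have [c [gc ec sc]] := hE k; exists (c ++ b).
by rewrite galg_cat gc !ev_cat ec eb sb sc addr0 big_cons.
Qed.

End Separation.

Lemma separated_sym (n m : nat) (rho : 'M[C]_N -> 'M[C]_n) (sigma : 'M[C]_N -> 'M[C]_m) :
  unitary_hom rho -> unitary_hom sigma -> separated rho sigma -> separated sigma rho.
Proof.
move=> rhoP sigmaP [a [ga ra sa]]; exists ([:: (1, 1%:M)] ++ gscale (-1) a).
rewrite galg_cat galg_scale galg1 ?unitary1 // !ev_cat !ev_scale !ev1 ra sa.
by rewrite rhoP.1 sigmaP.1 scaler0 addr0 scaleN1r subrr.
Qed.

Lemma separated_seq (n : nat) (rho : 'M[C]_N -> 'M[C]_n) (I : eqType) (m : I -> nat)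
    (sigma : forall i, 'M[C]_N -> 'M[C]_(m i)) (s : seq I) :
    unitary_hom rho -> (forall i, i \in s -> unitary_hom (sigma i)) ->
    (forall i, i \in s -> separated rho (sigma i)) ->
  exists a, [/\ galg a, ev rho a = 1%:M & forall i, i \in s -> ev (sigma i) a = 0].
Proof.
move=> rhoP; elim: s => [|i s IH] sigmaP sep.
  by exists [:: (1, 1%:M)]; rewrite galg1 ?unitary1 // ev1 rhoP.1.
have sub j : j \in s -> j \in i :: s by rewrite inE orbC => ->.
have [||a [ga ra sa]] := IH; [by move=> j /sub/sigmaP | by move=> j /sub/sep |].
have [b [gb rb sb]] := sep i (mem_head _ _).
exists (gmul a b); split; first exact: galg_mul.
  by rewrite ev_mul // ra rb mulmx1.
move=> j jis; rewrite ev_mul //; last exact: sigmaP.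
move: jis; rewrite inE; case/predU1P => [->|js]; first by rewrite sb mulmx0.
by rewrite sa // mul0mx.
Qed.

Lemma idempotent_trace (n : nat) (P : 'M[C]_n) : P *m P = P -> \tr P = (\rank P)%:R.
Proof.
move=> PP; move: (col_base P) (row_base P) (mulmx_base P) (row_base_free P) (col_base_full P).
move=> c r Pcr /row_freeP[B RB] /row_fullP[A AL].
rewrite -{1}Pcr mxtrace_mulC; suff -> : r *m c = 1%:M by rewrite mxtrace1.
have: c *m (r *m c) *m r = c *m r by rewrite !mulmxA Pcr -mulmxA Pcr PP.
move=> /(congr1 (mulmx A))/(congr1 (mulmx^~ B)) /=.
by rewrite !mulmxA AL !mul1mx -!mulmxA RB !mulmx1.
Qed.

(** An element acting through [rho] as an idempotent of rank 1 acts through [sigma] as an idempotent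
    of trace [c]; hence [c] is a rank, and it is nonzero. *)
Lemma proportional_characters_le (n m : nat) (rho : 'M[C]_N -> 'M[C]_n)
    (sigma : 'M[C]_N -> 'M[C]_m) (c : C) :
    unitary_hom rho -> unitary_hom sigma ->
    unitary_irreducible rho -> unitary_irreducible sigma ->
    {in unitarymx, forall U, \tr (sigma U) = c * \tr (rho U)} ->
  1 <= c.
Proof.
move=> rhoP sigmaP rhoI sigmaI tr_eq.
have trE a : galg a -> \tr (ev sigma a) = c * \tr (ev rho a).
  move=> /allP ga; rewrite /ev !raddf_sum mulr_sumr big_seq [RHS]big_seq.
  apply: eq_bigr => p /ga up /=; rewrite !mxtraceZ tr_eq //.
  by rewrite mulrCA.
(* If [rho] kills [a], the character of [sigma] vanishes at every [U a], so that [sigma] kills [a]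
   too. *)
have ker a : galg a -> ev rho a = 0 -> ev sigma a = 0.
  move=> ga a0; apply: ev0_of_trace0 => // U uU.
  rewrite -ev1 -ev_mul ?galg1 // trE ?galg_mul ?galg1 //.
  by rewrite ev_mul ?galg1 // a0 mulmx0 mxtrace0 mulr0.
have n0 := rhoI.1; pose i := Ordinal n0.
have [a ga ea] := burnside rhoP rhoI (delta_mx i i).
have ta : \tr (ev sigma a) = c.
  rewrite trE // ea /mxtrace (bigD1 i) //= big1 => [|k ki].
    by rewrite mxE !eqxx addr0 mulr1.
  by rewrite mxE (negPf ki).
have idem : ev sigma a *m ev sigma a = ev sigma a.
  have := ker (gmul a a ++ gscale (-1) a).
  rewrite galg_cat galg_scale galg_mul // !ev_cat !ev_scale !ev_mul // ea.
  rewrite mul_delta_mx scaleN1r subrr => /(_ ga erefl)/eqP.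
  by rewrite addr_eq0 scaleN1r opprK => /eqP.
have c0 : c != 0.
  apply/negP => /eqP c0; have := tr_eq _ unitary1.
  rewrite sigmaP.1 rhoP.1 c0 mul0r mxtrace1 => /eqP.
  by rewrite pnatr_eq0 -leqn0 leqNgt sigmaI.1.
move: c0; rewrite -ta idempotent_trace // pnatr_eq0 -lt0n.
by rewrite ler1n.
Qed.

Lemma proportional_characters (n m : nat) (rho : 'M[C]_N -> 'M[C]_n)
    (sigma : 'M[C]_N -> 'M[C]_m) (c : C) :
    unitary_hom rho -> unitary_hom sigma ->
    unitary_irreducible rho -> unitary_irreducible sigma ->
    {in unitarymx, forall U, \tr (sigma U) = c * \tr (rho U)} ->
  {in unitarymx, forall U, \tr (sigma U) = \tr (rho U)}.
Proof.
move=> rhoP sigmaP rhoI sigmaI tr_eq.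
have c1 := proportional_characters_le rhoP sigmaP rhoI sigmaI tr_eq.
have c0 : 0 < c := lt_le_trans ltr01 c1.
have: 1 <= c^-1.
  apply: (proportional_characters_le sigmaP rhoP sigmaI rhoI) => U uU.
  by rewrite tr_eq // mulKf // gt_eqF.
rewrite invf_ge1 // => c2 U uU; rewrite tr_eq //.
by have -> : c = 1 by [apply/eqP; rewrite eq_le c1 c2]; rewrite mul1r.
Qed.

End UnitaryGroupAlgebra.

(** * Continuous characters of the torus *)

Section UnitCircle.
Variable C : numClosedFieldType.
Implicit Types (r s u z : C).

Lemma normr_sqr_add1 s : `|s| = 1 -> `|s + 1| ^+ 2 = 2 + 2 * 'Re s.
Proof.
move=> s1; rewrite normCK rmorphD rmorph1 mulrDl !mulrDr mul1r !mulr1 -normCK s1.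
by rewrite expr1n ReE mulrCA mulfV ?pnatr_eq0 // mulr1; ring.
Qed.

(** In the factorization of [s ^+ 2 - 1], the factor [s + 1] has squared modulus at least 2 on the
    right half-plane. Successive square roots therefore tend to 1 geometrically. *)
Lemma sqr_dist1_half s : `|s| = 1 -> 0 <= 'Re s -> 2 * `|s - 1| ^+ 2 <= `|s ^+ 2 - 1| ^+ 2.
Proof.
move=> s1 s0; rewrite subr_sqr_1 normrM exprMn mulrC ler_wpM2l ?exprn_ge0 //.
by rewrite normr_sqr_add1 // lerDl mulr_ge0.
Qed.

Lemma sqrt_Re_ge0 u : exists2 s, s ^+ 2 = u & 0 <= 'Re s.
Proof.
have /orP[h|h] : (0 <= 'Re (sqrtC u)) || ('Re (sqrtC u) <= 0).
- by apply: real_leVge => //; exact: Creal_Re.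
- by exists (sqrtC u) => //; rewrite sqrtCK.
- by exists (- sqrtC u); rewrite ?sqrrN ?sqrtCK // raddfN oppr_ge0.
Qed.

(** This decides the sign of a square root known to be close to 1. *)
Lemma norm_oppr_sub1_lt1F s : `|s| = 1 -> 0 <= 'Re s -> `|- s - 1| < 1 -> False.
Proof.
move=> s1 s0; rewrite -opprD normrN => /ltW lt1.
have : `|s + 1| ^+ 2 <= 1 by rewrite exprn_ile1.
rewrite normr_sqr_add1 // => le1.
have : (2 : C) <= 1 by apply: le_trans le1; rewrite lerDl mulr_ge0.
by rewrite lern1.
Qed.

Lemma norm1_expn z n : (0 < n)%N -> `|z ^+ n| = 1 -> `|z| = 1.
Proof.
move=> n0; rewrite normrX => /eqP zn; apply/eqP.
by rewrite -(@pexpr_eq1 _ _ n).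
Qed.

(** Each square root with nonnegative real part at least halves the squared distance to 1, which is
    at most 4 at the start. *)
Lemma dyadic_root k u : `|u| = 1 ->
  exists r, [/\ `|r| = 1, r ^+ (2 ^ k) = u & `|r - 1| ^+ 2 * 2 ^+ k <= 4].
Proof.
move=> u1; elim: k => [|k [r [r1 ru rk]]].
  exists u; split=> //; rewrite expr0 mulr1.
  have -> : (4 : C) = (1 + 1) ^+ 2 by ring.
  rewrite ler_pXn2r ?nnegrE ?addr_ge0 //.
  by apply: le_trans (ler_normB _ _) _; rewrite u1 normr1.
have [s sr s0] := sqrt_Re_ge0 r.
have s1 : `|s| = 1 by apply: (@norm1_expn s 2) => //; rewrite sr.
exists s; split=> //; first by rewrite expnS exprM sr.
by apply: le_trans rk; rewrite [2 ^+ k.+1]exprS mulrA ler_wpM2r ?exprn_ge0 // mulrC -sr sqr_dist1_half.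
Qed.

(** Dividing [z] by a root of [z ^+ (2 ^ k)] near 1 leaves a root of unity: those of dyadic order
    are dense in the circle. *)
Lemma dyadic_approx k z : `|z| = 1 ->
  exists r, [/\ `|r| = 1, (z / r) ^+ (2 ^ k) = 1 & `|r - 1| ^+ 2 * 2 ^+ k <= 4].
Proof.
move=> z1; have [|r [r1 rz rk]] := @dyadic_root k (z ^+ (2 ^ k)).
  by rewrite normrX z1 expr1n.
exists r; split=> //; rewrite exprMn exprVn rz mulfV // expf_neq0 //.
by rewrite -normr_eq0 z1 oner_eq0.
Qed.

Lemma norm1_exprz (m : int) r : `|r| = 1 -> `|r ^ m| = 1.
Proof.
by move=> r1; case: m => n; rewrite ?NegzE -?exprnP -?exprnN ?normfV normrX r1 expr1n ?invr1.
Qed.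

Lemma norm_exprz_sub1 (m : int) r : `|r| = 1 -> `|r ^ m - 1| <= `|m|%N%:R * `|r - 1|.
Proof.
move=> r1.
have nat_case n : `|r ^+ n - 1| <= n%:R * `|r - 1|.
  elim: n => [|n IH]; first by rewrite expr0 subrr normr0 mul0r.
  have -> : r ^+ n.+1 - 1 = r ^+ n * (r - 1) + (r ^+ n - 1) by rewrite exprSr; ring.
  apply: le_trans (ler_normD _ _) _; rewrite normrM normrX r1 expr1n mul1r.
  by rewrite -natr1 mulrDl mul1r addrC lerD2r.
have r0 : r != 0 by rewrite -normr_eq0 r1 oner_eq0.
case: m => n; first exact: nat_case.
rewrite NegzE abszN /= -exprnN.
have -> : r ^- n.+1 - 1 = - (r ^- n.+1 * (r ^+ n.+1 - 1)).
  by rewrite mulrBr mulVf ?expf_neq0 // mulr1 opprB.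
rewrite normrN normrM normfV normrX r1 expr1n invr1 mul1r.
exact: nat_case.
Qed.

(** The inverse of a sum of inverses avoids choosing a minimum for the partial order of [C]; the
    added 1 covers an empty [I]. *)
Lemma finite_positive_lower_bound (I : finType) (D : I -> C) :
  (forall i, 0 < D i) -> exists2 d, 0 < d & forall i, d <= D i.
Proof.
move=> D0; have s0 : 0 < \sum_i (D i)^-1 + 1.
  by rewrite ltr_wpDl // sumr_ge0 // => i _; rewrite invr_ge0 ltW.
exists (\sum_i (D i)^-1 + 1)^-1; rewrite ?invr_gt0 // => i.
rewrite -[leRHS]invrK lef_pV2 ?posrE ?invr_gt0 // (bigD1 i) //= -addrA lerDl.
by rewrite addr_ge0 // sumr_ge0 // => j _; rewrite invr_ge0 ltW.
Qed.

(** Continuity of a homomorphism is exploited at the identity; the matrix topology is unfolded here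
    into estimates on entries. *)
Lemma unitary_repr_cts1 (N n : nat) (rho : 'M[C]_N -> 'M[C]_n) (e : C) :
    unitary_repr rho -> 0 < e ->
  exists2 delta, 0 < delta & forall U, U \is unitarymx ->
    (forall i j, `|U i j - (i == j)%:R| < delta) ->
    forall i j, `|rho U i j - (i == j)%:R| < e.
Proof.
move=> [rho1 _ rhoc] e0.
have /subspace_continuousP/(_ 1%:M (unitary1 _ _)) := rhoc.
rewrite /from_subspace rho1.
move=> /(_ [set M : 'M[C]_n | forall i j, `|M i j - (i == j)%:R| < e]%classic).
case.
  exists (fun i j => ball (1%:M i j : C) e); first by move=> i j; exact: nbhsx_ballx.
  by move=> M /= MP i j; have := MP i j; rewrite /ball /= distrC mxE.
move=> P P1 PU.
have /choice[D DP] : forall ij : 'I_N * 'I_N, exists d : C,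
    0 < d /\ forall y, `|y - (ij.1 == ij.2)%:R| < d -> P ij.1 ij.2 y.
  move=> [i j]; have /nbhs_ballP[d /= d0 dP] := P1 i j; exists d; split=> // y yd.
  by apply: dP; rewrite /ball /= distrC mxE.
have [d d0 dD] := finite_positive_lower_bound (fun ij => (DP ij).1).
exists d => // U uU Ud; apply: PU => // i j.
by apply: (DP (i, j)).2; exact: lt_le_trans (dD (i, j)).
Qed.

End UnitCircle.

Local Open Scope complex_scope.

(** * Continuous characters of the circle are powers *)

Section CircleCharacters.
Variable R : realType.
Local Notation C := R[i].

(** The Archimedean property of [R], reached through the real part of [delta], makes the distances
    in [dyadic_root] and [dist_zeta] arbitrarily small. *)
Lemma dyadic_small (delta : C) : 0 < delta ->
  exists K, forall k x, (K <= k)%N -> 0 <= x -> x ^+ 2 * 2 ^+ k <= 4 -> x < delta.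
Proof.
move=> d0.
have dE : delta = (complex.Re delta)%:C by apply/esym/RRe_real/ger0_real/ltW.
have rd0 : 0 < complex.Re delta by rewrite -ltcR -dE.
exists (Num.Def.archi_bound (4 / complex.Re delta ^+ 2)) => k x Kk x0 xk.
rewrite real_ltNge ?(ger0_real x0) ?(ger0_real (ltW d0)) //; apply/negP => dx.
have := upper_nthrootP Kk; rewrite ltr_pdivrMr ?exprn_gt0 // => lt4.
have lt4C : (4 : C) < 2 ^+ k * delta ^+ 2.
  have -> : 2 ^+ k * delta ^+ 2 = (2 ^+ k * complex.Re delta ^+ 2)%:C.
    by rewrite rmorphM !rmorphXn /= rmorph_nat -dE.
  by have -> : (4 : C) = 4%:R%:C by [rewrite rmorph_nat]; rewrite ltcR.
suff: 2 ^+ k * delta ^+ 2 <= 4 by move/(lt_le_trans lt4C); rewrite ltxx.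
apply: le_trans xk; rewrite mulrC ler_wpM2r ?exprn_ge0 //; apply: lerXn2r; rewrite ?nnegrE //; exact: ltW.
Qed.

Definition cis (x : R) : C := cos x +i* sin x.

Lemma cisD x y : cis (x + y) = cis x * cis y.
Proof. by rewrite /cis cosD sinD; simpc; rewrite addrC [X in _ +i* X]addrC. Qed.

Lemma cis0 : cis 0 = 1.
Proof. by rewrite /cis cos0 sin0. Qed.

Lemma norm_cis x : `|cis x| = 1.
Proof. by rewrite normc_def /= cos2Dsin2 sqrtr1. Qed.

Lemma cis_nat x n : cis (x *+ n) = cis x ^+ n.
Proof. by elim: n => [|n IH]; rewrite ?mulr0n ?cis0 // mulrS exprS cisD IH. Qed.

Lemma cisN x : cis (- x) = (cis x)^-1.
Proof.
have c0 : cis x != 0 by rewrite -normr_eq0 norm_cis oner_eq0.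
by apply: (mulfI c0); rewrite -cisD subrr cis0 mulfV.
Qed.

Lemma cis_int x (m : int) : cis (x *~ m) = cis x ^ m.
Proof. by case: m => n; rewrite ?cis_nat // NegzE mulrNz cisN cis_nat exprnN. Qed.

Definition zeta k : C := cis (2 * pi / 2 ^+ k).

Lemma zetaS k : zeta k.+1 ^+ 2 = zeta k.
Proof.
have k0 : (2 ^+ k : R) != 0 by rewrite expf_neq0 ?pnatr_eq0.
by rewrite /zeta -cis_nat; congr cis; rewrite exprS; field.
Qed.

Lemma cispi : cis pi = -1.
Proof. by rewrite /cis cospi sinpi; apply/eqP; rewrite eq_complex /= oppr0 !eqxx. Qed.

Lemma zeta0 : zeta 0 = 1.
Proof. by rewrite /zeta expr0 divr1 mulrC mulr_natr cis_nat cispi sqrrN expr1n. Qed.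

Lemma zeta1 : zeta 1 = -1.
Proof. by rewrite /zeta expr1 mulrAC mulfV ?pnatr_eq0 // mul1r cispi. Qed.

Lemma norm_zeta k : `|zeta k| = 1.
Proof. exact: norm_cis. Qed.

Lemma zeta_exp2 k : zeta k ^+ (2 ^ k) = 1.
Proof. by elim: k => [|k IH]; rewrite ?zeta0 ?expr1n // expnS exprM zetaS. Qed.

Lemma zeta_prim k : (2 ^ k).-primitive_root (zeta k).
Proof.
have [|m pm] := @prim_order_exists _ _ (zeta k) _ (zeta_exp2 k).
  by rewrite expn_gt0.
move=> /(dvdn_pfactor _ _ (isT : prime 2))[j jk mE].
have [{}jk|kj] := ltnP j k; last by move: pm; have -> : m = (2 ^ k)%N by rewrite mE; congr expn; lia.
have: zeta k ^+ (2 ^ k.-1) = 1.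
  have jk1 : (j <= k.-1)%N by lia.
  by rewrite -(subnKC jk1) expnD -mE exprM (prim_expr_order pm) // expr1n.
suff -> : zeta k ^+ (2 ^ k.-1) = -1 by move/eqP; rewrite eq_sym -addr_eq0 (@pnatr_eq0 _ 2).
have k0 : (0 < k)%N by lia.
rewrite -[k in zeta k](prednK k0); move: (k.-1) => {pm jk mE k0}k.
elim: k => [|k IH]; first by rewrite zeta1.
by rewrite expnS exprM zetaS.
Qed.

Lemma Re_cis_ge0 x : `|x| <= pi / 2 -> 0 <= 'Re (cis x).
Proof. by rewrite -complexRe ler0c /= ler_norml; exact: cos_ge0_pihalf. Qed.

Lemma dist_zeta k : `|zeta k.+1 - 1| ^+ 2 * 2 ^+ k <= 4.
Proof.
elim: k => [|k IH].
  rewrite zeta1 expr0 mulr1 -opprD normrN; have -> : (4 : C) = (1 + 1) ^+ 2 by ring.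
  by rewrite -[1 + 1]/(2%:R) normr_nat.
apply: le_trans IH; rewrite [2 ^+ k.+1]exprS mulrA ler_wpM2r ?exprn_ge0 // mulrC.
rewrite -(zetaS k.+1) sqr_dist1_half ?norm_zeta // Re_cis_ge0 //.
rewrite ger0_norm ?mulr_ge0 ?invr_ge0 ?exprn_ge0 ?pi_ge0 //.
rewrite 2!exprS !invfM -mulrA; have := pi_ge0 R.
have : (2 ^+ k)^-1 <= 1 :> R by rewrite invf_le1 ?exprn_gt0 // exprn_ege1 // ler1n.
set a := _^-1 => a1 p0.
have -> : 2 * (pi * (2^-1 * (2^-1 * a))) = pi / 2 * a by field.
by rewrite ler_piMr // divr_ge0.
Qed.

Section Character.
Variable f : C -> C.
Hypothesis f1 : f 1 = 1.
Hypothesis fM : forall z w, `|z| = 1 -> `|w| = 1 -> f (z * w) = f z * f w.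
Hypothesis fcts : forall e, 0 < e -> exists2 delta, 0 < delta &
  forall z, `|z| = 1 -> `|z - 1| < delta -> `|f z - 1| < e.

Lemma circle_charX z n : `|z| = 1 -> f (z ^+ n) = f z ^+ n.
Proof.
move=> z1; elim: n => [|n IH]; first by rewrite !expr0 f1.
by rewrite !exprS fM ?IH // normrX z1 expr1n.
Qed.

(** At one level the exponent is read off from a primitive root. Each further halving of the angle
    leaves only a sign undecided, and continuity at 1 selects the one that keeps the exponent. *)
Lemma circle_char_zeta : exists K m, forall k, (K <= k)%N -> f (zeta k) = zeta k ^ m.
Proof.
have [delta d0 dP] := fcts (ltr01 : 0 < 1 :> C).
have [K0 K0P] := dyadic_small d0; pose K := K0.+1.
have near1 k : (K <= k)%N -> `|f (zeta k) - 1| < 1.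
  case: k => // k Kk; apply: dP; first exact: norm_zeta.
  exact: K0P Kk (normr_ge0 _) (dist_zeta k).
(* The exponent modulo [2 ^ K] is represented by [m] of absolute value at most half of [2 ^ K]. At
   every later level [zeta k ^ m] then has angle at most [pi / 2], and its opposite is too far from
   1. *)
have [m mK fK] : exists2 m : int, `|m|%:~R <= 2 ^+ K0 :> R & f (zeta K) = zeta K ^ m.
  have: f (zeta K) ^+ (2 ^ K) = 1 by rewrite -circle_charX ?norm_zeta // zeta_exp2 f1.
  move=> /(prim_rootP (zeta_prim K))[j fj].
  have [jK|jK] := leqP j (2 ^ K0)%N.
    exists (j%:Z) => //; rewrite ger0_norm // -pmulrn -natrX ler_nat //.
  have eK : (2 ^ K = 2 ^ K0 + 2 ^ K0)%N by rewrite expnS mul2n addnn.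
  have leK : (j <= 2 ^ K)%N by rewrite ltnW.
  exists (j%:Z - (2 ^ K)%:Z).
    rewrite -normrN opprB subzn // ger0_norm // -pmulrn -natrX ler_nat.
    by move: jK; move: (nat_of_ord j) leK => l; rewrite eK; lia.
  have z0 : zeta K != 0 by rewrite -normr_eq0 norm_zeta oner_eq0.
  by rewrite expfzDr // -exprnP -exprnN zeta_exp2 invr1 mulr1.
exists K, m => k /subnKC <-; elim: (k - K)%N => [|i IH]; first by rewrite addn0.
rewrite addnS; set z := zeta (K + i).+1.
have: f z ^+ 2 = (z ^ m) ^+ 2.
  by rewrite -circle_charX ?norm_zeta // zetaS IH -zetaS !exprnP exprzAC.
move/eqP; rewrite eqf_sqr => /predU1P[//|/eqP fz].
have := near1 _ (leqW (leq_addr i K)).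
have z1 : `|z ^ m| = 1 by rewrite norm1_exprz ?norm_zeta.
rewrite -/z fz => /(norm_oppr_sub1_lt1F z1) h; exfalso; apply: h.
rewrite /z /zeta -cis_int Re_cis_ge0 // normrMz -mulrzr.
have a0 n : 0 < (2 ^+ n : R) by rewrite exprn_gt0.
have h n : 0 <= 2 * pi / 2 ^+ n :> R.
  by apply: divr_ge0; [rewrite mulr_ge0 ?pi_ge0 | exact: ltW].
rewrite ger0_norm //; apply: (@le_trans _ _ (2 * pi / 2 ^+ (K + i).+1 * 2 ^+ K0)).
  by apply: ler_wpM2l.
have -> : (K + i).+1 = (K0 + i).+2 by [].
rewrite !exprS exprD; have := a0 K0; have := a0 i.
have : 1 <= (2 ^+ i : R) by rewrite exprn_ege1 // ler1n.
move: (2 ^+ K0) (2 ^+ i) (pi_ge0 R) => a b p0 b1 b0' a0'.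
have -> : 2 * pi / (2 * (2 * (a * b))) * a = pi / 2 * b^-1.
  by field; rewrite !gt_eqF.
by rewrite ler_piMr ?divr_ge0 // invf_le1.
Qed.

Lemma circle_char : exists m : int, forall z, `|z| = 1 -> f z = z ^ m.
Proof.
have [K [m Km]] := circle_char_zeta; exists m => z z1.
have root_case k w : (K <= k)%N -> w ^+ (2 ^ k) = 1 -> f w = w ^ m.
  move=> Kk /(prim_rootP (zeta_prim k))[j ->].
  by rewrite circle_charX ?norm_zeta // Km // !exprnP exprzAC.
apply/eqP; rewrite -subr_eq0 -normr_eq0; apply/negPn/negP => d0.
(* The two maps agree at the root of unity [z / r], so that the gap [e] at [z] equals the gap at
   [r], where both values lie within [e / 2] of 1. *)
set e := `|f z - z ^ m| in d0.
have {d0} e0 : 0 < e by rewrite lt_def d0 /e normr_ge0.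
have e20 : 0 < e / 2 by rewrite divr_gt0.
have [delta delta0 deltaP] := fcts e20.
have [K1 K1P] := dyadic_small delta0.
have [|K2 K2P] := @dyadic_small (e / 2 / (`|m|%N%:R + 1)).
  by rewrite divr_gt0 // ltr_wpDl.
pose k := maxn K (maxn K1 K2).
have [r [r1 wk rk]] := dyadic_approx k z1.
have r0 : r != 0 by rewrite -normr_eq0 r1 oner_eq0.
have w1 : `|z / r| = 1 by rewrite normrM normfV z1 r1 divr1.
have fr : `|f r - 1| < e / 2.
  apply: deltaP => //; apply: K1P rk => //.
  by rewrite /k; lia.
have rm : `|r ^ m - 1| < e / 2.
  apply: le_lt_trans (norm_exprz_sub1 _ r1) _.
  have /K2P/(_ (normr_ge0 _) rk) : (K2 <= k)%N by rewrite /k; lia.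
  rewrite ltr_pdivlMr ?ltr_wpDl // => h; apply: le_lt_trans h.
  by rewrite mulrC ler_wpM2l // lerDl.
have: e < e.
  rewrite {1}/e -[z in f z](divfK r0) -[z in z ^ m](divfK r0) fM // exprzMl ?unitfE //; last first.
    by rewrite mulf_neq0 ?invr_eq0 // -normr_eq0 z1 oner_eq0.
  rewrite (root_case k) //; last by rewrite /k; lia.
  rewrite -mulrBr normrM norm1_exprz // mul1r.
  have -> : f r - r ^ m = (f r - 1) - (r ^ m - 1) by ring.
  by apply: le_lt_trans (ler_normB _ _) _; rewrite [ltRHS](splitr e) ltrD.
by rewrite ltxx.
Qed.

End Character.
End CircleCharacters.

(** * Simultaneous diagonalization and weights on the torus *)

Lemma finite_span (F : fieldType) (n : nat) (I : eqType) (v : I -> 'rV[F]_n) (D : I -> Prop) :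
  exists s : seq I, (forall i, i \in s -> D i) /\
    forall i, D i -> (v i <= \sum_(j <- s) <<v j>>)%MS.
Proof.
pose P r := `[< exists2 s : seq I, forall i, i \in s -> D i &
  \rank (\sum_(j <- s) <<v j>>)%MS = r >].
have exP : exists r, P r by exists (\rank (\sum_(j <- [::]) <<v j>>)%MS); apply/asboolP; exists [::].
have ubP r : P r -> (r <= n)%N by move=> /asboolP[s _ <-]; exact: rank_leq_row.
case: (ex_maxnP exP ubP) => r /asboolP[s sD rs] maxr.
exists s; split=> // i Di; apply: contraPT isT => iW _.
have: P (\rank (\sum_(j <- i :: s) <<v j>>)%MS).
  apply/asboolP; exists (i :: s) => // j; rewrite inE => /predU1P[->//|].
  exact: sD.
move=> /maxr; rewrite -rs leqNgt => /negP; apply.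
rewrite ltnNge; apply: contra iW; rewrite big_cons => leW.
set W := (\sum_(j <- s) _)%MS in leW *.
have := mxrank_leqif_sup (addsmxSr <<v i>>%MS W) => -[le1].
have -> : \rank W == \rank (<<v i>> + W)%MS by rewrite eqn_leq le1 leW.
move/esym => h; apply: submx_trans h.
by apply: submx_trans (addsmxSl _ _); rewrite genmxE.
Qed.

Lemma sum_span_ind (F : fieldType) (n : nat) (I : eqType) (v : I -> 'rV[F]_n)
    (Q : 'rV[F]_n -> Prop) (s : seq I) (u : 'rV[F]_n) :
    Q 0 -> (forall x y, Q x -> Q y -> Q (x + y)) -> (forall c x, Q x -> Q (c *: x)) ->
    (forall j, j \in s -> Q (v j)) -> (u <= \sum_(j <- s) <<v j>>)%MS -> Q u.
Proof.
move=> Q0 QD QZ; elim: s u => [|j s IH] u Qs.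
  by rewrite big_nil submx0 => /eqP ->.
rewrite big_cons => /sub_addsmxP[[a b] /= ->]; apply: QD; last first.
  by apply: IH; [move=> k ks; apply: Qs; rewrite inE ks orbT | rewrite submxMl].
have /submxP[c ->] : (a *m <<v j>> <= v j)%MS by rewrite mulmx_sub ?genmxE.
by rewrite [c]mx11_scalar mul_scalar_mx; apply: QZ; apply: Qs; rewrite mem_head.
Qed.

(** The primitive root splits [X^m - 1] into distinct linear factors, and the minimal polynomial
    divides it. *)
Lemma finite_order_diagonalizable (F : fieldType) (n m : nat) (z : F) (A : 'M[F]_n) :
  m.-primitive_root z -> A ^+ m = 1 -> diagonalizable A.
Proof.
case: n A => [|n] A zm Am.
  by exists 1%:M; rewrite ?unitmx1 //; apply/is_diag_mxP => -[].
apply/diagonalizableP; exists [seq z ^+ i | i <- index_iota 0 m].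
  rewrite map_inj_in_uniq ?iota_uniq // => i j.
  rewrite !mem_index_iota /= => im jm /eqP; rewrite (eq_prim_root_expr zm).
  by rewrite !modn_small // => /eqP.
rewrite big_map factor_Xn_sub_1 //; apply: mxminpoly_min.
by rewrite rmorphB rmorph1 rmorphXn /= horner_mx_X Am subrr.
Qed.

(** Being diagonal in a given basis is a linear condition, so a finite spanning part of an infinite
    family decides. *)
Lemma codiagonalizable_family (F : fieldType) (n : nat) (I : eqType) (D : I -> Prop)
    (g : I -> 'M[F]_n) :
    (forall i, D i -> diagonalizable (g i)) ->
    (forall i j, D i -> D j -> comm_mx (g i) (g j)) ->
  exists2 P, P \in unitmx & forall i, D i -> is_diag_mx (P *m g i *m invmx P).
Proof.
move=> gdiag gcomm.
have [s [sD sspan]] := finite_span (fun i => mxvec (g i)) D.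
have [|P Pu /allP PD] := (codiagonalizableP [seq g i | i <- s]).1.
  split=> [_ _ /mapP[i iin ->] /mapP[j jin ->]|_ /mapP[i iin ->]].
    by apply: gcomm; exact: sD.
  by apply: gdiag; exact: sD.
exists P => // i Di; rewrite -[g i]mxvecK.
apply: (sum_span_ind (Q := fun w => is_diag_mx (P *m vec_mx w *m invmx P))) (sspan i Di).
- by rewrite linear0 mulmx0 mul0mx; apply/is_diag_mxP => j k _; rewrite mxE.
- move=> x y /is_diag_mxP xD /is_diag_mxP yD; apply/is_diag_mxP => j k jk.
  by rewrite linearD mulmxDr mulmxDl mxE xD // yD // addr0.
- move=> c x /is_diag_mxP xD; apply/is_diag_mxP => j k jk.
  by rewrite linearZ -scalemxAr -scalemxAl mxE xD // mulr0.
move=> j js; rewrite mxvecK -conjumx //.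
by apply: PD; apply: map_f.
Qed.

Section TorusMatrices.
Variables (C : numClosedFieldType) (N : nat).
Implicit Types x : 'rV[C]_N.

Definition torus x := forall i, `|x 0 i| = 1.

Lemma diag_unitary x : torus x -> diag_mx x \is unitarymx.
Proof.
move=> x1; apply/unitarymxP/matrixP => i j; rewrite tr_diag_mx map_diag_mx mulmx_diag.
rewrite !mxE; have [->|//] := eqVneq i j.
by rewrite !mulr1n -normCK x1 expr1n.
Qed.

End TorusMatrices.

Section Torus.
Variables (R : realType) (N n : nat).
Local Notation C := R[i].
Variable rho : 'M[C]_N -> 'M[C]_n.
Hypothesis rhoP : unitary_repr rho.
Implicit Types x y : 'rV[C]_N.

Lemma rho_diagM x y : torus x -> torus y ->
  rho (diag_mx (\row_i (x 0 i * y 0 i))) = rho (diag_mx x) *m rho (diag_mx y).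
Proof.
move=> x1 y1; case: rhoP => _ rM _; rewrite -rM ?diag_unitary //; congr rho.
by rewrite mulmx_diag; congr diag_mx; apply/rowP => i; rewrite !mxE.
Qed.

(* These elements have finite order, so that [rho] diagonalizes them; they are *)
(* dense in the torus.                                                         *)
Definition dyadic x := torus x /\ exists k, forall i, x 0 i ^+ (2 ^ k) = 1.

Lemma diag1 : diag_mx (\row_i 1) = 1%:M :> 'M[C]_N.
Proof. by apply/matrixP => i j; rewrite !mxE. Qed.

Lemma rho_diagX x m : torus x ->
  rho (diag_mx (\row_i (x 0 i ^+ m))) = rho (diag_mx x) ^+ m.
Proof.
move=> x1; elim: m => [|m IH].
  rewrite expr0 -[RHS](_ : rho 1%:M = 1); last by case: rhoP.
  by rewrite -diag1; congr (rho (diag_mx _)); apply/rowP => i; rewrite !mxE.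
rewrite exprS -[RHS]/(rho (diag_mx x) *m rho (diag_mx x) ^+ m) -IH -rho_diagM //.
  by congr (rho (diag_mx _)); apply/rowP => i; rewrite !mxE exprS.
by move=> i; rewrite mxE normrX x1 expr1n.
Qed.

Lemma dyadic_codiagonalizable :
  exists2 P, P \in unitmx & forall x, dyadic x -> is_diag_mx (P *m rho (diag_mx x) *m invmx P).
Proof.
apply: (codiagonalizable_family (D := dyadic) (g := fun x => rho (diag_mx x))).
  move=> x [x1 [k xk]]; apply: finite_order_diagonalizable (zeta_prim R k) _.
  rewrite -rho_diagX //; case: rhoP => [r1 _ _]; rewrite -[RHS]r1 -diag1.
  by congr (rho (diag_mx _)); apply/rowP => i; rewrite !mxE.
move=> x y [x1 _] [y1 _]; rewrite /comm_mx -!rho_diagM //.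
by congr (rho (diag_mx _)); apply/rowP => i; rewrite !mxE mulrC.
Qed.

Lemma torus_approx x delta : torus x -> 0 < delta ->
  exists w r, [/\ dyadic w, torus r, forall i, `|r 0 i - 1| < delta
    & x = \row_i (w 0 i * r 0 i)].
Proof.
move=> x1 d0; have [k kP] := dyadic_small d0.
have /choice[r rP] := fun i => dyadic_approx k (x1 i).
exists (\row_i (x 0 i / r i)), (\row_i r i).
have r1 i : `|r i| = 1 by case: (rP i).
split.
- split; first by move=> i; rewrite mxE normrM normfV x1 r1 divr1.
  by exists k => i; rewrite mxE; case: (rP i).
- by move=> i; rewrite mxE.
- by move=> i; rewrite mxE; case: (rP i) => _ _; exact: kP.
apply/rowP => i; rewrite !mxE divfK // -normr_eq0 r1 oner_eq0 //.
Qed.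

Section Diagonalization.
Variable P : 'M[C]_n.
Hypothesis Pu : P \in unitmx.
Hypothesis PD : forall x, dyadic x -> is_diag_mx (P *m rho (diag_mx x) *m invmx P).

Let D x := P *m rho (diag_mx x) *m invmx P.

Lemma conj_diagM x y : torus x -> torus y -> D (\row_i (x 0 i * y 0 i)) = D x *m D y.
Proof. by move=> x1 y1; rewrite /D rho_diagM // !mulmxA mulmxKV. Qed.

Lemma conj_cts e : 0 < e -> exists2 delta, 0 < delta & forall x, torus x ->
  (forall i, `|x 0 i - 1| < delta) -> forall k l, `|D x k l - (k == l)%:R| < e.
Proof.
move=> e0.
(* [M k l] bounds an entry of a conjugate by [P] in terms of a bound on the entries conjugated; the
   1 later added to [S] keeps the denominator positive. *)
pose M k l := \sum_a \sum_b `|P k a| * `|invmx P b l|.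
have M0 k l : 0 <= M k l by rewrite !sumr_ge0 // => a _; rewrite sumr_ge0 // => b _; rewrite mulr_ge0.
pose S := \sum_k \sum_l M k l.
have S0 : 0 <= S by rewrite !sumr_ge0 // => a _; rewrite sumr_ge0.
have MS k l : M k l <= S.
  rewrite /S (bigD1 k) //= (bigD1 l) //= -addrA lerDl addr_ge0 // ?sumr_ge0 // => i _.
  by rewrite sumr_ge0.
have e'0 : 0 < e / (S + 1) by rewrite divr_gt0 // ltr_wpDl.
have [delta delta0 dP] := unitary_repr_cts1 rhoP e'0.
exists delta => // x x1 xd k l.
have {}dP i j : `|rho (diag_mx x) i j - (i == j)%:R| <= e / (S + 1).
  apply/ltW/dP; first exact: diag_unitary.
  move=> {}i {}j; rewrite mxE; have [->|_] := eqVneq i j; first by rewrite mulr1n.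
  by rewrite mulr0n subrr normr0.
have -> : D x k l - (k == l)%:R = (P *m (rho (diag_mx x) - 1%:M) *m invmx P) k l.
  by rewrite mulmxBr mulmxBl mulmx1 mulmxV // [RHS]mxE [X in _ = _ + X]mxE [X in _ = _ - X]mxE.
apply: (@le_lt_trans _ _ (M k l * (e / (S + 1)))).
  rewrite mxE /M exchange_big mulr_suml; apply: le_trans (ler_norm_sum _ _ _) _.
  apply: ler_sum => b _; rewrite normrM -mulr_suml mulrAC ler_wpM2r // mxE mulr_suml.
  apply: le_trans (ler_norm_sum _ _ _) _.
  apply: ler_sum => a _; rewrite normrM ler_wpM2l //.
  by have := dP a b; rewrite [X in _ -> `|X| <= _]mxE [X in _ -> `|_ + X| <= _]mxE [X in _ -> `|_ - X| <= _]mxE.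
rewrite mulrA ltr_pdivrMr ?ltr_wpDl // mulrC ltr_pM2l //.
by apply: le_lt_trans (MS k l) _; rewrite ltrDl.
Qed.

Lemma dyadic_entryX w m k : dyadic w -> (D w k k) ^+ m = D (\row_i (w 0 i ^+ m)) k k.
Proof.
move=> [w1 [K wK]].
have dX j : dyadic (\row_i (w 0 i ^+ j)).
  split; first by move=> i; rewrite mxE normrX w1 expr1n.
  by exists K => i; rewrite mxE exprAC wK expr1n.
elim: m => [|m IH].
  rewrite expr0 (_ : \row_i _ = \row_i 1); last by apply/rowP => i; rewrite !mxE.
  by rewrite /D diag1; case: rhoP => -> _ _; rewrite mulmx1 mulmxV // mxE eqxx.
rewrite exprS IH.
have -> : \row_i (w 0 i ^+ m.+1) = \row_i (w 0 i * (\row_i (w 0 i ^+ m)) 0 i).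
  by apply/rowP => i; rewrite !mxE exprS.
rewrite (conj_diagM w1 (dX m).1) [RHS]mxE (bigD1 k) //= big1 ?addr0 // => l lk.
have /is_diag_mxP h := PD (conj w1 (ex_intro _ K wK)).
by rewrite -/(D w) in h; rewrite h ?mul0r // eq_sym.
Qed.

Lemma dyadic_entry_norm w k : dyadic w -> `|D w k k| = 1.
Proof.
move=> wD; have [w1 [K wK]] := wD; apply: (@norm1_expn _ _ (2 ^ K)).
  by rewrite expn_gt0.
rewrite dyadic_entryX //.
have -> : \row_i (w 0 i ^+ (2 ^ K)) = \row_i 1 by apply/rowP => i; rewrite !mxE.
by rewrite /D diag1; case: rhoP => -> _ _; rewrite mulmx1 mulmxV // mxE eqxx normr1.
Qed.

(** Factor [x] into a dyadic element and some [r]. The dyadic factor is diagonal with entries of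
    modulus 1, so off-diagonal entries at [x] and at [r] have equal modulus; but [r] can be taken so
    near 1 that its entry is smaller. *)
Lemma conj_torus_diag x : torus x -> is_diag_mx (D x).
Proof.
move=> x1; apply/is_diag_mxP => k l kl.
apply/eqP; rewrite -normr_eq0; apply/negPn/negP => d0.
have {}d0 : 0 < `|D x k l| by rewrite lt_def d0 normr_ge0.
have [delta delta0 dP] := conj_cts d0.
have [w [r [wD r1 rd xE]]] := torus_approx x1 delta0.
have := dP r r1 rd k l; rewrite (_ : (k == l) = false); last by apply/negbTE/eqP => e; rewrite e eqxx in kl.
have -> : D x k l = D w k k * D r k l.
  rewrite [in LHS]xE (conj_diagM wD.1 r1) [LHS]mxE (bigD1 k) //= big1 ?addr0 // => j jk.
  have /is_diag_mxP h := PD wD; rewrite -/(D w) in h.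
  by rewrite h ?mul0r // eq_sym.
by rewrite subr0 normrM dyadic_entry_norm // mul1r ltxx.
Qed.

Lemma torus_entryM x y k : torus x -> torus y ->
  D (\row_i (x 0 i * y 0 i)) k k = D x k k * D y k k.
Proof.
move=> x1 y1; rewrite (conj_diagM x1 y1) [LHS]mxE (bigD1 k) //= big1 ?addr0 // => j jk.
have /is_diag_mxP h := conj_torus_diag x1.
by rewrite h ?mul0r // eq_sym.
Qed.

(** Each coordinate circle gives one exponent, and multiplicativity assembles them over a
    duplicate-free list of coordinates. *)
Lemma torus_entry k : exists mu : 'I_N -> int, forall x, torus x ->
  D x k k = \prod_i x 0 i ^ mu i.
Proof.
pose unit_at i (z : C) : 'rV[C]_N := \row_j (if j == i then z else 1).
have uT i z : `|z| = 1 -> torus (unit_at i z).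
  by move=> z1 j; rewrite mxE; case: ifP; rewrite ?normr1.
have D1 : D (\row_i 1) k k = 1.
  by rewrite /D diag1; case: rhoP => -> _ _; rewrite mulmx1 mulmxV // mxE eqxx.
have /choice[mu muP] : forall i, exists m : int, forall z, `|z| = 1 ->
    D (unit_at i z) k k = z ^ m.
  move=> i; apply: circle_char.
  - by rewrite -[RHS]D1; congr (D _ k k); apply/rowP => j; rewrite !mxE if_same.
  - move=> z w z1 w1; rewrite -(torus_entryM _ (uT _ _ z1) (uT _ _ w1)); congr (D _ k k).
    by apply/rowP => j; rewrite !mxE; case: ifP; rewrite ?mulr1.
  move=> e e0; have [delta delta0 dP] := conj_cts e0; exists delta => // z z1 zd.
  have := dP (unit_at i z) (uT _ _ z1) _ k k; rewrite eqxx; apply.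
  by move=> j; rewrite mxE; case: ifP; rewrite ?subrr ?normr0.
exists mu => x x1.
have hs (s : seq 'I_N) : uniq s ->
    D (\row_i (if i \in s then x 0 i else 1)) k k = \prod_(i <- s) x 0 i ^ mu i.
  elim: s => [|j s IH] /=; first by rewrite big_nil -[RHS]D1.
  move=> /andP[js us]; rewrite big_cons -IH // -muP //.
    have sT : torus (\row_i (if i \in s then x 0 i else 1)).
      by move=> i; rewrite mxE; case: ifP; rewrite ?normr1.
    rewrite -(torus_entryM _ (uT j _ (x1 j)) sT).
  congr (D _ k k); apply/rowP => i; rewrite !mxE inE.
  by have [->|_] := eqVneq i j; rewrite ?(negPf js) ?mulr1 ?mul1r.
have := hs (index_enum 'I_N) (index_enum_uniq _).
by move=> <-; congr (D _ k k); apply/rowP => i; rewrite !mxE mem_index_enum.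
Qed.

End Diagonalization.

Theorem torus_weights : exists (P : 'M[C]_n) (mu : 'I_n -> 'I_N -> int),
  P \in unitmx /\ forall x, torus x ->
    P *m rho (diag_mx x) = diag_mx (\row_k \prod_i x 0 i ^ mu k i) *m P.
Proof.
have [P Pu PD] := dyadic_codiagonalizable.
have /choice[mu muP] := torus_entry Pu PD.
exists P, mu; split=> // x x1.
rewrite -[LHS](mulmxKV Pu); congr (_ *m P).
apply/matrixP => k l; rewrite [RHS]mxE; have [<-|kl] := eqVneq k l.
  by rewrite muP // mxE mulr1n.
have /is_diag_mxP h := conj_torus_diag Pu PD x1.
by rewrite mulr0n h.
Qed.

End Torus.

Local Close Scope complex_scope.

(** * The tensor power *)

(** Expanded over maps, the right-hand side weighs each map by an alternating sum over the sets
    containing its image. This sum is 1 for a surjective map and 0 otherwise. *)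
Lemma ryser (F : comNzRingType) (d : nat) (M : 'I_d -> 'I_d -> F) :
  \sum_(s : 'S_d) \prod_a M a (s a) =
  \sum_(J : {set 'I_d}) (-1) ^+ #|~: J| * \prod_a \sum_(b in J) M a b.
Proof.
have inner (f : {ffun 'I_d -> 'I_d}) :
    \sum_(J : {set 'I_d} | f \in ffun_on (mem J)) (-1) ^+ #|~: J| = (injectiveb f)%:R :> F.
  pose T := [set f a | a : 'I_d].
  transitivity (\sum_(J : {set 'I_d}) \prod_b (if b \in J then 1 else - (b \notin T)%:R) : F).
    rewrite big_mkcond; apply: eq_bigr => J _; rewrite (bigID (mem J)) /=.
    rewrite big1 ?mul1r => [|b ->//].
    rewrite (eq_bigr (fun b => - (b \notin T)%:R)) => [|b /negPf->//].
    rewrite (eq_bigl (fun b => b \in ~: J)) => [|b]; last by rewrite inE.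
    rewrite prodrN; case: ifP => [/ffun_onP fJ|fJ].
      rewrite big1 ?mulr1 // => b; rewrite inE => bJ; suff -> : b \notin T by [].
      by apply: contra bJ => /imsetP[a _ ->]; exact: fJ.
    have /forallPn[a] : ~~ [forall a, f a \in J].
      by apply: contraFN fJ => /forallP fJ; apply/ffun_onP.
    move=> faJ; rewrite (bigD1 (f a)) ?inE //= imset_f // mul0r mulr0 //.
  rewrite -(@bigA_distr _ _ _ _ _ _ (fun _ => 1) (fun b => - (b \notin T)%:R)).
  have [finj|fninj] := boolP (injectiveb f).
    rewrite big1 // => b _; have bT : b \in T.
      by have /codomP[a ->] := injF_onto (injectiveP f finj) b; rewrite imset_f.
    by rewrite bT /= oppr0 addr0.
  have /existsP[b bT] : [exists b, b \notin T].
    rewrite -negb_forall; apply: contra fninj => /forallP h.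
    have : {in [set: 'I_d] &, injective f}.
      apply/imset_injP; rewrite (_ : f @: _ = [set: 'I_d]) //; apply/setP => b.
      rewrite inE; have := h b => /imsetP[a _ ->].
      by rewrite imset_f.
    by move=> finj; apply/injectiveP => a b; apply: finj; rewrite inE.
  by rewrite (bigD1 b) //= bT mulr1n subrr mul0r.
transitivity (\sum_(f : {ffun 'I_d -> 'I_d}) \prod_a M a (f a) * (injectiveb f)%:R).
  rewrite [RHS](bigID (fun f : {ffun 'I_d -> 'I_d} => injectiveb f)) /=.
  rewrite [X in _ = _ + X]big1 ?addr0 => [|f /negPf->]; last by rewrite mulr0.
  rewrite (reindex (fun s : 'S_d => pval s)) /=; last first.
    pose perm_of (f : {ffun 'I_d -> 'I_d}) : 'S_d := insubd (perm_one 'I_d) f.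
    exists perm_of => f; rewrite inE => fi; last by rewrite /perm_of insubdK.
    by rewrite /perm_of valKd.
  rewrite (eq_bigl xpredT) => [|s]; last by rewrite (valP s).
  apply: eq_bigr => s _; rewrite (valP s : injectiveb (pval s)) mulr1.
  by apply: eq_bigr => a _; rewrite -pvalE.
under [RHS]eq_bigr do rewrite bigA_distr_big mulr_sumr.
rewrite (exchange_big_dep xpredT) //=; apply: eq_bigr => f _.
by rewrite -mulr_suml inner mulrC.
Qed.

Section Tensors.
Variables (C : numClosedFieldType) (N d : nat).
Notation word := {ffun 'I_d -> 'I_N}.
Notation dimE := #|{: {ffun 'I_d -> 'I_N}}|.
Implicit Types (F G : word -> word -> C) (I K : word) (s t : 'S_d).

(* The words ['I_d -> 'I_N] index the standard basis of the tensor power. *)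
Definition mxw F : 'M[C]_dimE := \matrix_(i, j) F (enum_val i) (enum_val j).

Lemma eq_mxw F G : F =2 G -> mxw F = mxw G.
Proof. by move=> FG; apply/matrixP => i j; rewrite !mxE FG. Qed.

Lemma mxwK (A : 'M[C]_dimE) : A = mxw (fun I J => A (enum_rank I) (enum_rank J)).
Proof. by apply/matrixP => i j; rewrite mxE !enum_valK. Qed.

Lemma sum_words (f : word -> C) : \sum_(i < dimE) f (enum_val i) = \sum_I f I.
Proof.
rewrite [RHS](reindex (fun i : 'I_dimE => enum_val i)) //.
by exists enum_rank => x _; rewrite ?enum_valK ?enum_rankK.
Qed.

Lemma mulmxw F G : mxw F *m mxw G = mxw (fun I J => \sum_K F I K * G K J).
Proof.
apply/matrixP => i j; rewrite !mxE -(sum_words (fun K => F _ K * G K _)).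
by apply: eq_bigr => k _; rewrite !mxE.
Qed.

Lemma mxtrace_mxw F : \tr (mxw F) = \sum_I F I I.
Proof. by rewrite -(sum_words (fun I => F I I)); apply: eq_bigr => i _; rewrite mxE. Qed.

Lemma mxw1 : mxw (fun I J => (I == J)%:R) = 1%:M.
Proof. by apply/matrixP => i j; rewrite !mxE (inj_eq enum_val_inj). Qed.

Lemma sum_mxw (T : Type) (r : seq T) (P : pred T) (F : T -> word -> word -> C) :
  \sum_(x <- r | P x) mxw (F x) = mxw (fun I J => \sum_(x <- r | P x) F x I J).
Proof. by apply/matrixP => i j; rewrite summxE mxE; apply: eq_bigr => x _; rewrite mxE. Qed.

Lemma scale_mxw c F : c *: mxw F = mxw (fun I J => c * F I J).
Proof. by apply/matrixP => i j; rewrite !mxE. Qed.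

Definition tensf (X : 'I_d -> 'M[C]_N) := mxw (fun I J => \prod_a X a (I a) (J a)).
Definition tens (X : 'M[C]_N) := tensf (fun _ => X).

Lemma eq_tensf X Y : X =1 Y -> tensf X = tensf Y.
Proof. by move=> XY; apply: eq_mxw => I J; apply: eq_bigr => a _; rewrite XY. Qed.

Lemma tensfM X Y : tensf X *m tensf Y = tensf (fun a => X a *m Y a).
Proof.
rewrite mulmxw; apply: eq_mxw => I J; under [RHS]eq_bigr do rewrite mxE.
by rewrite bigA_distr_bigA /=; apply: eq_bigr => K _; rewrite big_split.
Qed.

Lemma tensf1 : tensf (fun _ => 1%:M) = 1%:M.
Proof.
rewrite -mxw1; apply: eq_mxw => I J; have [->|IJ] := eqVneq I J.
  by rewrite big1 // => a _; rewrite mxE eqxx.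
have /existsP[a Ia] : [exists a, I a != J a].
  rewrite -negb_forall; apply: contra IJ => /forallP h.
  by apply/eqP/ffunP => a; apply/eqP.
by rewrite (bigD1 a) //= mxE (negPf Ia) mul0r.
Qed.

Lemma tensM X Y : tens (X *m Y) = tens X *m tens Y.
Proof. by rewrite /tens tensfM. Qed.

Lemma tens1 : tens 1%:M = 1%:M.
Proof. exact: tensf1. Qed.

Lemma tens_hom : unitary_hom tens.
Proof. by split; [exact: tens1 | move=> X Y _ _; exact: tensM]. Qed.

Lemma tensC X : ((tens X)^t* = tens (X^t*))%sesqui.
Proof.
apply/matrixP => i j; rewrite !mxE rmorph_prod; apply: eq_bigr => a _.
by rewrite !mxE.
Qed.

(** Permutations compose from left to right, so precomposition is a left action and [permw] is
    multiplicative. *)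
Definition permword s I : word := [ffun a => I (s a)].
Definition permw s := mxw (fun I J => (I == permword s J)%:R).

Lemma permwordM s t I : permword (s * t)%g I = permword s (permword t I).
Proof. by apply/ffunP => a; rewrite !ffunE permM. Qed.

Lemma permword1 I : permword 1%g I = I.
Proof. by apply/ffunP => a; rewrite !ffunE perm1. Qed.

Lemma permwordK s : cancel (permword s) (permword s^-1%g).
Proof. by move=> I; rewrite -permwordM mulVg permword1. Qed.

Lemma permwordKV s : cancel (permword s^-1%g) (permword s).
Proof. by move=> I; rewrite -permwordM mulgV permword1. Qed.

Lemma mulmx_permw F s : mxw F *m permw s = mxw (fun I J => F I (permword s J)).
Proof.
rewrite mulmxw; apply: eq_mxw => I J; rewrite (bigD1 (permword s J)) //= eqxx mulr1.
by rewrite big1 ?addr0 // => K /negPf->; rewrite mulr0.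
Qed.

Lemma permw_mulmx F s : permw s *m mxw F = mxw (fun I J => F (permword s^-1 I) J).
Proof.
rewrite mulmxw; apply: eq_mxw => I J; rewrite (bigD1 (permword s^-1 I)) //=.
rewrite permwordKV eqxx mul1r big1 ?addr0 // => K Ks.
have -> : (I == permword s K) = false by apply: contraNF Ks => /eqP->; rewrite permwordK.
by rewrite mul0r.
Qed.

Lemma permwM s t : permw (s * t)%g = permw s *m permw t.
Proof. by rewrite mulmx_permw; apply: eq_mxw => I J; rewrite permwordM. Qed.

Lemma permw1 : permw 1%g = 1%:M.
Proof. by rewrite -mxw1; apply: eq_mxw => I J; rewrite permword1. Qed.

Lemma permwV s : permw s *m permw s^-1%g = 1%:M.
Proof. by rewrite -permwM mulgV permw1. Qed.

Lemma conj_tensf s X : permw s^-1%g *m tensf X *m permw s = tensf (fun a => X (s^-1%g a)).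
Proof.
rewrite permw_mulmx mulmx_permw invgK; apply: eq_mxw => I J.
rewrite [RHS](reindex_inj (@perm_inj _ s)); apply: eq_bigr => a _ /=.
by rewrite !ffunE permK.
Qed.

Lemma tens_permC s X : tens X *m permw s = permw s *m tens X.
Proof.
rewrite -[in LHS](invgK s) -[LHS]mul1mx -(permwV s) invgK -!mulmxA; congr (_ *m _).
by rewrite mulmxA conj_tensf.
Qed.

(** The image of the group algebra of the unitary group in the endomorphisms of the tensor power; it
    turns out to be the commutant of the permutations. *)
Definition inA (Y : 'M[C]_dimE) := exists2 a, galg a & ev tens a = Y.

Lemma inA_tens U : U \is unitarymx -> inA (tens U).
Proof. by move=> uU; exists [:: (1, U)]; rewrite ?galg1 ?ev1. Qed.

Lemma inAD Y Z : inA Y -> inA Z -> inA (Y + Z).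
Proof. by move=> [a ga <-] [b gb <-]; exists (a ++ b); rewrite ?galg_cat ?ga ?ev_cat. Qed.

Lemma inAZ c Y : inA Y -> inA (c *: Y).
Proof. by move=> [a ga <-]; exists (gscale c a); rewrite ?galg_scale ?ev_scale. Qed.

Lemma inAM Y Z : inA Y -> inA Z -> inA (Y *m Z).
Proof.
move=> [a ga <-] [b gb <-]; exists (gmul a b); first exact: galg_mul.
by rewrite (ev_mul tens_hom).
Qed.

Lemma inA0 : inA 0.
Proof. by exists [::]; rewrite ?ev_nil. Qed.

Lemma inA1 : inA 1%:M.
Proof. by rewrite -tens1; apply: inA_tens; exact: unitary1. Qed.

Lemma inA_sum (T : Type) (r : seq T) (P : pred T) (Y : T -> 'M[C]_dimE) :
  (forall x, P x -> inA (Y x)) -> inA (\sum_(x <- r | P x) Y x).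
Proof. by move=> h; apply: big_ind => //; [exact: inA0 | exact: inAD]. Qed.

Lemma inA_adj Y : inA Y -> inA (Y^t*)%sesqui.
Proof.
move=> [a /allP ga <-]; exists [seq (p.1^*, (p.2^t*)%sesqui) | p <- a].
  by apply/allP => _ /mapP[p pa ->] /=; rewrite trmxC_unitary ga.
rewrite /ev big_map linear_sum /= map_mx_sum; apply: eq_bigr => p _ /=.
by rewrite linearZ /= map_mxZ tensC.
Qed.

Lemma inA_perm s Y : inA Y -> Y *m permw s = permw s *m Y.
Proof.
move=> [a _ <-]; rewrite /ev mulmx_suml mulmx_sumr; apply: eq_bigr => p _.
by rewrite -scalemxAl -scalemxAr tens_permC.
Qed.

(** Inverting the Vandermonde matrix expresses the coefficients of a polynomial curve through
    finitely many of its points. *)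
Lemma inA_interpolation m (c : 'I_m -> C) (M : 'I_m -> 'M[C]_dimE) :
    injective c -> (forall j, inA (\sum_(k < m) c j ^+ k *: M k)) ->
  forall k, inA (M k).
Proof.
move=> cinj MA k; pose V := Vandermonde m (\row_j c j).
have Vu : V \in unitmx.
  rewrite unitmxE det_Vandermonde unitfE; apply/prodf_neq0 => i _.
  apply/prodf_neq0 => j ij; rewrite !mxE subr_eq0 (inj_eq cinj).
  by apply: contraTneq ij => ->; rewrite ltnn.
have -> : M k = \sum_j invmx V j k *: \sum_(i < m) c j ^+ i *: M i.
  under eq_bigr do rewrite scaler_sumr; rewrite exchange_big /=.
  transitivity (\sum_i (V *m invmx V) i k *: M i).
    rewrite mulmxV // (bigD1 k) //= mxE eqxx scale1r big1 ?addr0 // => i ik.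
    by rewrite mxE (negPf ik) scale0r.
  apply: eq_bigr => i _; rewrite mxE scaler_suml; apply: eq_bigr => j _.
  by rewrite !mxE scalerA mulrC.
by apply: inA_sum => j _; apply: inAZ.
Qed.

Definition tens_coef (X Y : 'M[C]_N) k :=
  \sum_(J : {set 'I_d} | #|J| == k) tensf (fun a => if a \in J then Y else X).

Lemma tens_line X Y c :
  tens (X + c *: Y) = \sum_(k < d.+1) c ^+ k *: tens_coef X Y k.
Proof.
transitivity (\sum_(J : {set 'I_d}) c ^+ #|J| *: tensf (fun a => if a \in J then Y else X)).
  rewrite /tens /tensf; under [RHS]eq_bigr do rewrite scale_mxw.
  rewrite sum_mxw; apply: eq_mxw => I K.
  under eq_bigr do rewrite !mxE addrC.
  rewrite bigA_distr; apply: eq_bigr => J _; rewrite -prodr_const [X in _ = X * _]big_mkcond -big_split.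
  by apply: eq_bigr => a _ /=; case: ifP => // _; rewrite mul1r.
have cardJ (J : {set 'I_d}) : (#|J| < d.+1)%N by rewrite ltnS -[d in X in (_ <= X)%N]card_ord max_card.
rewrite (partition_big (fun J : {set _} => Ordinal (cardJ J)) xpredT) //=.
apply: eq_bigr => k _; rewrite scaler_sumr; apply: eq_big => J; first by rewrite -val_eqE.
by rewrite -val_eqE /= => /eqP->.
Qed.

(** [tens (X + c *: Y)] is polynomial in [c], of degree at most [d]: enough points of the line in
    the algebra bring in the coefficients, and these all other points. *)
Lemma inA_line (X Y : 'M[C]_N) (c : nat -> C) :
    injective c -> (forall n, inA (tens (X + c n *: Y))) ->
  (forall k, inA (tens_coef X Y k)) /\ forall z, inA (tens (X + z *: Y)).
Proof.
move=> cinj XYA; have coefA (k : 'I_d.+1) : inA (tens_coef X Y k).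
  apply: (@inA_interpolation _ (fun j : 'I_d.+1 => c j) (fun k => tens_coef X Y k)).
    by move=> i j /cinj/val_inj.
  by move=> j; rewrite -tens_line.
split=> [k|z]; last by rewrite tens_line; apply: inA_sum => k _; apply: inAZ.
have [kd|dk] := ltnP k d.+1; first exact: (coefA (Ordinal kd)).
rewrite /tens_coef big1 => [|J /eqP Jk]; first exact: inA0.
have := max_card (mem J); rewrite card_ord Jk => /(leq_trans dk).
by rewrite ltnn.
Qed.

End Tensors.

(** * The commutant of the permutations is spanned by unitary tensors *)

Section Density.
Variables (C : numClosedFieldType) (N d : nat).
Local Notation word := {ffun 'I_d -> 'I_N}.
Local Notation dimE := #|{: {ffun 'I_d -> 'I_N}}|.
Local Notation inA := (@inA C N d).

(* The Cayley transform sends real numbers to the unit circle. *)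
Definition circle_pt (n : nat) : C := (1 + 'i * n%:R) / (1 - 'i * n%:R).

Lemma circle_pt_denom n : 1 - 'i * n%:R != 0 :> C.
Proof.
rewrite subr_eq0; apply/eqP => /(congr1 (fun z => z ^+ 2)).
rewrite expr1n exprMn sqrCi mulN1r => /eqP; rewrite -addr_eq0.
by rewrite -natrX -(natrD _ 1) pnatr_eq0.
Qed.

Lemma norm_circle_pt n : `|circle_pt n| = 1.
Proof.
have conjd : (1 - 'i * n%:R : C)^* = 1 + 'i * n%:R.
  by rewrite rmorphB rmorphM rmorph1 /= conjCi conjC_nat mulNr opprK.
by rewrite /circle_pt -conjd normrM normfV norm_conjC mulfV // normr_eq0 circle_pt_denom.
Qed.

Lemma circle_pt_inj : injective circle_pt.
Proof.
move=> m n /(congr1 (fun z => z + 1)).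
have ptE k : circle_pt k + 1 = 2 / (1 - 'i * k%:R).
  by rewrite /circle_pt; field; exact: circle_pt_denom.
rewrite !ptE => /(mulfI (_ : (2 : C) != 0)); rewrite pnatr_eq0 => /(_ isT)/invr_inj.
move/addrI/oppr_inj/(mulfI (neq0Ci C))/eqP.
by rewrite eqr_nat => /eqP.
Qed.

(** Unitary matrices only provide eigenvalues on the unit circle. Interpolation at the points
    [circle_pt n] frees one eigenvalue at a time; in the induction those of index below [k] are
    free. *)
Lemma inA_tens_diag (P : 'M[C]_N) (x : 'rV[C]_N) :
  P \is unitarymx -> inA (tens d (invmx P *m diag_mx x *m P)).
Proof.
move=> uP.
suff h k (y : 'rV[C]_N) : (forall i : 'I_N, (k <= i)%N -> `|y 0 i| = 1) ->
    inA (tens d (invmx P *m diag_mx y *m P)).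
  by apply: (h N) => i; rewrite leqNgt ltn_ord.
elim: k y => [|k IH] y y1.
  apply: inA_tens; rewrite invmx_unitary // !mul_unitarymx ?trmxC_unitary //.
  by apply/unitarymxP/matrixP => i j; rewrite tr_diag_mx map_diag_mx mulmx_diag;
    rewrite !mxE; have [->|//] := eqVneq i j; rewrite !mulr1n -normCK y1 ?expr1n.
have [kN|Nk] := ltnP k N; last first.
  by apply: IH => i ki; have := ltn_ord i; rewrite ltnNge (leq_trans Nk ki).
pose k' := Ordinal kN.
pose X := invmx P *m diag_mx (\row_i (if i == k' then 0 else y 0 i)) *m P.
pose Y := invmx P *m diag_mx (delta_mx 0 k') *m P.
have lineE z : X + z *: Y = invmx P *m diag_mx (\row_i (if i == k' then z else y 0 i)) *m P.
  rewrite /X /Y scalemxAl scalemxAr -mulmxDl -mulmxDr; congr (_ *m _ *m _).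
  apply/matrixP => i j; rewrite !mxE; have [->|_] := eqVneq i j; rewrite ?mulr1n ?mulr0n ?mulr0 ?addr0 //=.
  by case: eqP; rewrite ?mulr1 ?mulr0 ?add0r ?addr0.
have [|_ /(_ (y 0 k'))] := @inA_line C N d X Y _ circle_pt_inj; last first.
  by rewrite lineE (_ : \row_i _ = y) //; apply/rowP => i; rewrite mxE; case: eqP => // ->.
move=> n; rewrite lineE; apply: IH => i ki; rewrite mxE.
have [_|ik] := eqVneq i k'; first exact: norm_circle_pt.
apply: y1; rewrite ltn_neqAle ki andbT; apply: contra ik => /eqP ik.
by apply/eqP/val_inj.
Qed.

(** Hermitian matrices are unitarily diagonalizable. With [H1] and [H2] Hermitian, so are the points
    of the line [H1 + n H2] for natural [n], and interpolation reaches the parameter ['i]. *)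
Lemma inA_tens_all (X : 'M[C]_N) : inA (tens d X).
Proof.
have herm (H : 'M[C]_N) : (H^t* = H)%sesqui -> inA (tens d H).
  move=> HH; have /orthomx_spectralP -> : H \is normalmx by apply/normalmxP; rewrite HH.
  by apply: inA_tens_diag; exact: spectral_unitarymx.
pose H1 := 2^-1 *: (X + (X^t*)%sesqui); pose H2 := (2^-1 * - 'i) *: (X - (X^t*)%sesqui).
have conj2 : (2^-1 : C)^* = 2^-1 by rewrite fmorphV /= conjC_nat.
have H1h : (H1^t* = H1)%sesqui.
  by rewrite /H1 linearZ /= map_mxZ linearD /= map_mxD trmxCK conj2 addrC.
have H2h : (H2^t* = H2)%sesqui.
  rewrite /H2 linearZ /= map_mxZ linearB /= map_mxB trmxCK rmorphM rmorphN /= conj2 conjCi.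
  by rewrite opprK mulrN scaleNr -scalerN opprB.
have XE : X = H1 + 'i *: H2.
  rewrite /H1 /H2 scalerA mulrCA mulrN -expr2 sqrCi opprK mulr1 -scalerDr.
  have X2 : X + X = (2 : C) *: X by rewrite scaler_nat mulr2n.
  rewrite addrACA subrr addr0 X2.
  by rewrite scalerA mulVf ?scale1r ?pnatr_eq0.
have natinj : injective (fun n => n%:R : C) by move=> m n /eqP; rewrite eqr_nat => /eqP.
have [|_ /(_ 'i)] := @inA_line C N d H1 H2 _ natinj; last by rewrite -XE.
move=> n; apply: herm; rewrite -[in RHS]H1h -[in RHS]H2h.
by apply/matrixP => i j; rewrite !mxE rmorphD rmorphM /= conjC_nat.
Qed.

(* Polarization: by Ryser's formula the symmetrization is a combination of     *)
(* tensor powers.                                                              *)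
Lemma inA_symmetrized (X : 'I_d -> 'M[C]_N) : inA (\sum_(s : 'S_d) tensf (fun a => X (s a))).
Proof.
suff -> : \sum_(s : 'S_d) tensf (fun a => X (s a)) =
    \sum_(J : {set 'I_d}) (-1) ^+ #|~: J| *: tens d (\sum_(b in J) X b).
  by apply: inA_sum => J _; apply: inAZ; exact: inA_tens_all.
rewrite sum_mxw; under [RHS]eq_bigr do rewrite scale_mxw; rewrite sum_mxw.
apply: eq_mxw => I K; rewrite (ryser (fun a b => X b (I a) (K a))); apply: eq_bigr => J _; congr (_ * _).
by apply: eq_bigr => a _; rewrite summxE.
Qed.

(** The projection of all endomorphisms onto the commutant of the permutations. *)
Definition symmetrize (Y : 'M[C]_dimE) : 'M[C]_dimE :=
  d`!%:R^-1 *: \sum_(s : 'S_d) permw C N s^-1 *m Y *m permw C N s.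

Lemma symmetrizeE (Y : 'M[C]_dimE) : inA Y -> symmetrize Y = Y.
Proof.
move=> AY; rewrite /symmetrize (eq_bigr (fun _ => Y)) => [|s _].
  by rewrite sumr_const (card_Sn d) -[Y *+ _]scaler_nat scalerA mulVf ?scale1r //.
by rewrite -mulmxA inA_perm // mulmxA -permwM mulVg permw1 mul1mx.
Qed.

Lemma symmetrize_sum (I : Type) (r : seq I) (c : I -> C) (Y : I -> 'M[C]_dimE) :
  symmetrize (\sum_(i <- r) c i *: Y i) = \sum_(i <- r) c i *: symmetrize (Y i).
Proof.
rewrite /symmetrize; under [RHS]eq_bigr do rewrite scalerA mulrC -scalerA scaler_sumr.
rewrite -scaler_sumr exchange_big /=; congr (_ *: _); apply: eq_bigr => s _.
rewrite mulmx_sumr mulmx_suml; apply: eq_bigr => i _.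
by rewrite -scalemxAr -scalemxAl.
Qed.

Lemma matrix_unit_tensf (I J : word) :
  delta_mx (enum_rank I) (enum_rank J) = tensf (fun a => delta_mx (I a) (J a)) :> 'M[C]_dimE.
Proof.
rewrite [LHS]mxwK; apply: eq_mxw => K L; rewrite mxE !(inj_eq enum_rank_inj).
have [/andP[/eqP-> /eqP->]|KL] := boolP ((K == I) && (L == J)).
  by rewrite big1 // => a _; rewrite mxE !eqxx.
have /existsP[a aP] : [exists a, ~~ ((K a == I a) && (L a == J a))].
  rewrite -negb_forall; apply: contra KL => /forallP h.
  by apply/andP; split; apply/eqP/ffunP => a; have /andP[/eqP Ka /eqP La] := h a; rewrite ?Ka ?La.
by rewrite (bigD1 a) //= mxE (negPf aP) mul0r.
Qed.

(** Matrix units are pure tensors, to which polarization applies. A matrix commuting with the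
    permutations is its own symmetrization, so this is the substantial half of the commutant
    theorem. *)
Lemma inA_symmetrize (Y : 'M[C]_dimE) : inA (symmetrize Y).
Proof.
have unitA i j : inA (symmetrize (delta_mx i j)).
  rewrite -(enum_valK i) -(enum_valK j) matrix_unit_tensf; apply: inAZ.
  under eq_bigr do rewrite conj_tensf.
  rewrite (reindex_inj invg_inj) /=; under eq_bigr do rewrite invgK.
  exact: (inA_symmetrized (fun a => delta_mx (enum_val i a) (enum_val j a))).
have -> : Y = \sum_ij Y ij.1 ij.2 *: delta_mx ij.1 ij.2.
  by rewrite {1}[Y]matrix_sum_delta pair_big.
rewrite symmetrize_sum; apply: inA_sum => ij _; apply: inAZ.
exact: unitA.
Qed.

End Density.

(** * Power sums as traces on the tensor power *)

Section TraceFormula.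
Variables (C : numClosedFieldType) (N d : nat).
Local Notation word := {ffun 'I_d -> 'I_N}.

Lemma diag_mxX (x : 'rV[C]_N) k : diag_mx x ^+ k = diag_mx (\row_i x 0 i ^+ k).
Proof.
elim: k => [|k IH].
  by apply/matrixP => i j; rewrite expr0 !mxE; case: eqP => // ->.
rewrite exprS IH -[LHS]/(_ *m _) mulmx_diag; congr diag_mx.
by apply/rowP => i; rewrite !mxE exprS.
Qed.

Lemma conj_mxX (P A : 'M[C]_N) k :
  P \in unitmx -> (invmx P *m A *m P) ^+ k = invmx P *m A ^+ k *m P.
Proof.
move=> Pu; elim: k => [|k IH].
  by rewrite !expr0 -[1 in RHS]/(1%:M) mulmx1 mulVmx.
by rewrite !exprS IH -[LHS]/(_ *m _) -[A * _]/(A *m _) !mulmxA mulmxK.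
Qed.

Lemma trace_unitaryX (x : 'rV[C]_N) (P : 'M[C]_N) k :
  P \in unitmx -> \tr ((invmx P *m diag_mx x *m P) ^+ k) = \sum_i x 0 i ^+ k.
Proof.
move=> Pu; rewrite conj_mxX // mxtrace_mulC mulmxA mulmxV // mul1mx diag_mxX.
by apply: eq_bigr => i _; rewrite !mxE eqxx.
Qed.

(** Once [U] is diagonalized, only the words constant on the cycles of [s] contribute; choosing one
    letter per cycle expands the product of power sums of eigenvalues. *)
Lemma trace_tens_perm (i0 : 'I_N) (U : 'M[C]_N) (s : 'S_d) : U \is unitarymx ->
  \tr (tens d U *m permw C N s) = \prod_(c in porbits s) \tr (U ^+ #|c|).
Proof.
move=> uU.
have /orthomx_spectralP : U \is normalmx.
  apply/normalmxP; rewrite (unitarymxP uU) -invmx_unitary // mulVmx //.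
  exact: unitarymx_unit.
set P := spectralmx U; set x := spectral_diag U => UE.
have Pu : P \in unitmx by exact: spectral_unit.
rewrite [RHS](eq_bigr (fun c : {set 'I_d} => \sum_i x 0 i ^+ #|c|)) => [|c _]; last by rewrite UE trace_unitaryX.
transitivity (\sum_(I : word | [forall a, I (s a) == I a]) \prod_a x 0 (I a)).
  rewrite UE !tensM -mulmxA tens_permC mulmxA mxtrace_mulC !mulmxA -tensM mulmxV // tens1 mul1mx.
  rewrite mulmx_permw mxtrace_mxw [RHS]big_mkcond; apply: eq_bigr => I _.
  case: ifP => [/forallP Is|/negbT].
    by apply: eq_bigr => a _; rewrite ffunE (eqP (Is a)) mxE eqxx.
  rewrite negb_forall => /existsP[a Ia]; rewrite (bigD1 a) //= ffunE mxE.
  by rewrite eq_sym (negPf Ia) mul0r.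
rewrite (big_distr_big i0) /=.
pose h (f : {ffun {set 'I_d} -> 'I_N}) : word := [ffun a => f (porbit s a)].
(* The default [i0] fills the values off the cycles, since [big_distr_big] ranges over functions
   supported on them. *)
pose h' (I : word) : {ffun {set 'I_d} -> 'I_N} :=
  [ffun c : {set 'I_d} => if [pick a in c] is Some a then (if c \in porbits s then I a else i0) else i0].
have inv_orbit (I : word) a b : [forall a, I (s a) == I a] -> b \in porbit s a -> I b = I a.
  move=> /forallP Is /porbitP[k ->]; elim: k => [|k IH]; first by rewrite expg0 perm1.
  by rewrite expgSr permM (eqP (Is _)).
have hK (I : word) : [forall a, I (s a) == I a] -> h (h' I) = I.
  move=> Is; apply/ffunP => a; rewrite !ffunE; case: pickP => [b ba|/(_ a)].
    by rewrite imset_f // (inv_orbit I a b).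
  by rewrite porbit_id.
have porbit_eq (c : {set 'I_d}) x0 a : x0 \in c -> c \in porbits s -> (porbit s a == c) = (a \in c).
  by move=> + /imsetP[y _ cE]; rewrite cE => _; rewrite eq_porbit_mem.
rewrite (reindex_onto h h') //; apply: eq_big => f.
  apply/andP/pffun_onP => [[_ /eqP fE]|[fsupp _]].
    split; last by move=> ? _.
    apply/supportP => c cs; rewrite -fE ffunE; case: pickP => // a _.
    by rewrite (negPf cs).
  split.
    apply/forallP => a; rewrite !ffunE; apply/eqP; congr (f _); apply/eqP.
    by rewrite eq_porbit_mem -[s a]/((s ^+ 1)%g a) mem_porbit.
  apply/eqP/ffunP => c; rewrite ffunE; have [cs|cs] := boolP (c \in porbits s); last first.
    by rewrite (supportP fsupp c cs); case: pickP.
  case: pickP => [a ac|c0].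
    by rewrite ffunE; congr (f _); apply/eqP; rewrite (porbit_eq c a).
  by case/imsetP: cs => y _ cE; have := c0 y; rewrite cE porbit_id.
move=> _; rewrite (partition_big (porbit s) (mem (porbits s))) /=; last first.
  by move=> a _; rewrite imset_f.
apply: eq_bigr => c cs; rewrite (eq_bigr (fun _ => x 0 (f c))) => [|a /eqP<-]; last by rewrite ffunE.
rewrite prodr_const; congr (_ ^+ _); apply: eq_card => a; rewrite [LHS]unfold_in /=.
have /imsetP[y _ cE] := cs.
by apply: (porbit_eq c y) => //; rewrite cE porbit_id.
Qed.

End TraceFormula.

(** * The Lie algebra action and the Casimir element *)

Section Derivations.
Variables (C : numClosedFieldType) (N d : nat).
Local Notation word := {ffun 'I_d -> 'I_N}.
Local Notation dimE := #|{: {ffun 'I_d -> 'I_N}}|.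
Implicit Types (X Y : 'M[C]_N) (a b : 'I_d).

Definition slot a X : 'M[C]_dimE := tensf (fun b => if b == a then X else 1%:M).
Definition der X : 'M[C]_dimE := \sum_a slot a X.

Lemma slotM a X Y : slot a X *m slot a Y = slot a (X *m Y).
Proof. by rewrite tensfM; apply: eq_tensf => b; case: ifP; rewrite ?mulmx1. Qed.

Lemma slotC a b X Y : a != b -> slot a X *m slot b Y = slot b Y *m slot a X.
Proof.
move=> ab; rewrite !tensfM; apply: eq_tensf => c.
have [->|_] := eqVneq c a; first by rewrite (negPf ab) mul1mx mulmx1.
by case: ifP; rewrite mul1mx ?mulmx1.
Qed.

Lemma slotE a X (I J : word) :
  (\prod_b (if b == a then X else 1%:M) (I b) (J b)) =
  X (I a) (J a) * \prod_(b | b != a) (I b == J b)%:R.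
Proof.
rewrite (bigD1 a) //= eqxx; congr (_ * _); apply: eq_bigr => b /negPf->.
by rewrite mxE.
Qed.

Lemma slot_lin a c X Y : slot a (X + c *: Y) = slot a X + c *: slot a Y.
Proof. by apply/matrixP => i j; rewrite !mxE !slotE !mxE mulrDl mulrA. Qed.

Lemma slotB a X Y : slot a (X - Y) = slot a X - slot a Y.
Proof. by rewrite -scaleN1r slot_lin scaleN1r. Qed.

Lemma slot_sum a (T : Type) (r : seq T) (X : T -> 'M[C]_N) :
  slot a (\sum_(x <- r) X x) = \sum_(x <- r) slot a (X x).
Proof.
elim: r => [|x r IH].
  by rewrite !big_nil -[0 in LHS](subrr (0 : 'M[C]_N)) slotB subrr.
by rewrite !big_cons -IH -[X in slot a (_ + X)]scale1r slot_lin scale1r.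
Qed.

Lemma slot1 a : slot a 1%:M = 1%:M.
Proof. by rewrite -tensf1; apply: eq_tensf => b; case: ifP. Qed.

Lemma derB X Y : der (X - Y) = der X - der Y.
Proof. by rewrite /der -sumrB; apply: eq_bigr => a _; rewrite slotB. Qed.

(** [der X] is the linear coefficient of [tens (1%:M + c *: X)], that is, the derivative of the
    group action. *)
Lemma inA_der X : inA (der X).
Proof.
have [|h _] := @inA_line C N d 1%:M X _ (@circle_pt_inj C).
  by move=> n; exact: inA_tens_all.
have := h 1%N; rewrite /tens_coef (_ : \sum_(J | _) _ = der X) //.
rewrite /der [RHS](eq_bigr (fun a => tensf (fun b => if b \in [set a] then X else 1%:M))) => [|a _]; last first.
  by apply: eq_tensf => b; rewrite inE.
pose pt (J : {set 'I_d}) := [pick a in J].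
rewrite -(big_imset (h := fun a => [set a]) (A := 'I_d)
  (fun J : {set 'I_d} => tensf (fun b => if b \in J then X else 1%:M))) /=; last first.
  by move=> a b _ _ /set1_inj.
apply: eq_bigl => J; apply/cards1P/imsetP => [[a ->]|[a _ ->]]; exists a => //.
Qed.

Lemma der_comm X Y : der X *m der Y - der Y *m der X = der (X *m Y - Y *m X).
Proof.
have mulE Z T : der Z *m der T = \sum_a \sum_(b | b != a) slot a Z *m slot b T + der (Z *m T).
  rewrite /der mulmx_suml -big_split; apply: eq_bigr => a _ /=.
  by rewrite mulmx_sumr (bigD1 a) //= slotM addrC.
rewrite !mulE derB opprD addrACA [X in X + _](_ : _ = 0) ?add0r //.
apply/eqP; rewrite subr_eq0; apply/eqP.
rewrite (exchange_big_dep xpredT) //=; apply: eq_bigr => a _.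
by apply: eq_big => [b|b ba]; [rewrite eq_sym | rewrite slotC // eq_sym].
Qed.

Definition transp_mx : 'M[C]_dimE := \sum_(tau in transpositions d) permw C N tau.
Definition casimir_mx : 'M[C]_dimE :=
  \sum_i \sum_j der (delta_mx i j) *m der (delta_mx j i).

Lemma inA_casimir : inA casimir_mx.
Proof. by do 2!(apply: inA_sum => ? _); apply: inAM; exact: inA_der. Qed.

Lemma tpermE (a b c : 'I_d) : tperm a b c = if c == a then b else if c == b then a else c.
Proof. by case: tpermP => [->|->|/eqP/negPf-> /eqP/negPf->] //; rewrite eqxx //; case: eqP => [->|]. Qed.

Lemma sum_slot_swap a b : a != b ->
  \sum_i \sum_j slot a (delta_mx i j) *m slot b (delta_mx j i) = permw C N (tperm a b).
Proof.
move=> ab; under eq_bigr do under eq_bigr do rewrite tensfM.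
under eq_bigr do rewrite sum_mxw; rewrite sum_mxw; apply: eq_mxw => I J.
have entryE i j : (\prod_c ((if c == a then delta_mx i j else 1%:M) *m
      (if c == b then delta_mx j i else 1%:M)) (I c) (J c)) =
   ((I a == i) && (J a == j))%:R * ((I b == j) && (J b == i))%:R
     * \prod_(c | (c != a) && (c != b)) (I c == J c)%:R :> C.
  rewrite (bigD1 a) //= eqxx (negPf ab) mulmx1 mxE -mulrA; congr (_ * _).
  rewrite (bigD1 b) /=; last by rewrite eq_sym.
  rewrite eq_sym (negPf ab) eqxx mul1mx mxE; congr (_ * _).
  apply: eq_big => c; first by rewrite andbC.
  by case/andP => /negPf-> /negPf->; rewrite mul1mx mxE.
under eq_bigr do under eq_bigr do rewrite entryE.
rewrite (bigD1 (I a)) //= [X in _ + X]big1 ?addr0; last first.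
  by move=> i /negPf ia; rewrite big1 // => j _; rewrite eq_sym ia !mul0r.
rewrite (bigD1 (J a)) //= [X in _ + X]big1 ?addr0; last first.
  by move=> i /negPf ia; rewrite [J a == i]eq_sym ia andbF !mul0r.
rewrite !eqxx mul1r.
have [IJ|IJ] := eqVneq I (permword (tperm a b) J).
  rewrite IJ !ffunE tpermL tpermR !eqxx mul1r big1 // => c /andP[ca cb].
  by rewrite ffunE tpermD ?eqxx // eq_sym.
have /existsP[c] : [exists c, I c != permword (tperm a b) J c].
  rewrite -negb_forall; apply: contra IJ => /forallP h.
  by apply/eqP/ffunP => c; apply/eqP.
rewrite ffunE tpermE; have [->|ca] := eqVneq c a.
  by rewrite eq_sym => /negPf->; rewrite andbF mul0r.
have [->|cb] := eqVneq c b => /negPf Ic; first by rewrite Ic mul0r.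
by rewrite [X in _ * X](bigD1 c) ?ca //= Ic mul0r mulr0.
Qed.

Lemma sum_tperm : \sum_a \sum_(b | b != a) permw C N (tperm a b) = 2 *: transp_mx :> 'M[C]_dimE.
Proof.
rewrite pair_big_dep /= (partition_big (fun ab : 'I_d * 'I_d => tperm ab.1 ab.2)
  (mem (transpositions d))) /=; last first.
  move=> [a b] /= ba; rewrite inE; apply/existsP; exists a; apply/existsP; exists b.
  by rewrite eq_sym ba eqxx.
rewrite scaler_sumr; apply: eq_bigr => tau; rewrite inE => /existsP[i /existsP[j /andP[ij /eqP->]]].
rewrite (eq_bigr (fun _ => permw C N (tperm i j))) => [|[a b] /= /andP[_ /eqP->]] //.
rewrite sumr_const (_ : #|_| = 2%N) ?scaler_nat //.
rewrite (_ : 2%N = #|[set (i, j); (j, i)]|); last first.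
  by rewrite cards2 xpair_eqE (negPf ij).
apply: eq_card => -[a b]; rewrite !inE !xpair_eqE [LHS]unfold_in /=.
apply/andP/orP => [[ba /eqP tE]|[/andP[/eqP-> /eqP->]|/andP[/eqP-> /eqP->]]].
- have bE : tperm i j a = b by rewrite -tE tpermL.
  move: bE ba; case: tpermP => [->|->|_ _] <-; rewrite ?eqxx //; first by left.
  by right.
- by rewrite eq_sym.
by rewrite tpermC.
Qed.

(** Two elementary matrices in the same slot add up to [N] times the identity, for each of the [d]
    slots. In distinct slots they add up to the exchange of the slots, and a transposition comes
    from two ordered pairs. *)
Lemma casimir_mxE : casimir_mx = (d * N)%:R%:M + 2 *: transp_mx.
Proof.
have mulE Z T : der Z *m der T = \sum_a \sum_(b | b != a) slot a Z *m slot b T + der (Z *m T).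
  rewrite /der mulmx_suml -big_split; apply: eq_bigr => a _ /=.
  by rewrite mulmx_sumr (bigD1 a) //= slotM addrC.
rewrite /casimir_mx; under eq_bigr do under eq_bigr do rewrite mulE.
under eq_bigr do rewrite big_split /=; rewrite big_split /= addrC; congr (_ + _).
  transitivity (N%:R *: \sum_i der (delta_mx i i)).
    rewrite scaler_sumr; apply: eq_bigr => i _.
    under eq_bigr do rewrite mul_delta_mx.
    by rewrite sumr_const card_ord scaler_nat.
  rewrite exchange_big /= (eq_bigr (fun _ => 1%:M)) => [|a _]; last first.
    by rewrite -slot_sum -(slot1 a) -mx1_sum_delta.
  by rewrite sumr_const card_ord -[_ *+ d]scaler_nat scalerA -natrM mulnC scalemx1.
rewrite -sum_tperm; under eq_bigr do rewrite exchange_big /=.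
rewrite exchange_big /=; apply: eq_bigr => a _.
under eq_bigr do rewrite exchange_big /=.
rewrite exchange_big /=; apply: eq_bigr => b ba.
by rewrite sum_slot_swap // eq_sym.
Qed.

End Derivations.

(** * Submodules of the tensor power *)

Section Continuity.
Variable C : numClosedFieldType.

Lemma mx_continuous (T : topologicalType) m n (f : T -> 'M[C]_(m, n)) :
  (forall i j, continuous (fun x => f x i j)) -> continuous f.
Proof.
move=> fc x A [P Px PA]; apply: filterS PA _.
apply: filter_forall => i; apply: filter_forall => j.
exact: fc (Px i j).
Qed.

Lemma mul_continuous (T : topologicalType) (f g : T -> C) :
  continuous f -> continuous g -> continuous (fun x => f x * g x).
Proof. by move=> fc gc x; apply: cvgM; [exact: fc | exact: gc]. Qed.

Lemma prod_continuous (T : topologicalType) (I : finType) (f : I -> T -> C) :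
  (forall i, continuous (f i)) -> continuous (fun x => \prod_i f i x).
Proof.
move=> fc; elim: (index_enum I) => [|i s IH].
  by under eq_fun do rewrite big_nil; move=> x; exact: cvg_cst.
by under eq_fun do rewrite big_cons; move=> x; apply: cvgM; [exact: fc | exact: IH].
Qed.

Lemma sum_continuous (T : topologicalType) (I : finType) (f : I -> T -> C) :
  (forall i, continuous (f i)) -> continuous (fun x => \sum_i f i x).
Proof.
move=> fc; elim: (index_enum I) => [|i s IH].
  by under eq_fun do rewrite big_nil; move=> x; exact: cvg_cst.
by under eq_fun do rewrite big_cons; move=> x; apply: cvgD; [exact: fc | exact: IH].
Qed.

Lemma tens_mul_continuous N d m n (A : 'M[C]_(m, #|{: {ffun 'I_d -> 'I_N}}|))
    (B : 'M[C]_(#|{: {ffun 'I_d -> 'I_N}}|, n)) :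
  continuous (fun U : 'M[C]_N => A *m tens d U *m B).
Proof.
apply: mx_continuous => i j.
have -> : (fun U : 'M[C]_N => (A *m tens d U *m B) i j) =
    fun U => \sum_k (\sum_l A i l * \prod_a U ((enum_val l : {ffun 'I_d -> 'I_N}) a) ((enum_val k : {ffun 'I_d -> 'I_N}) a)) * B k j.
  apply/funext => U; rewrite mxE; apply: eq_bigr => k _; rewrite mxE; congr (_ * _).
  by apply: eq_bigr => l _; rewrite mxE.
apply: sum_continuous => k; apply: mul_continuous; last exact: cst_continuous.
apply: sum_continuous => l; apply: mul_continuous; first exact: cst_continuous.
by apply: prod_continuous => a U; exact: coord_continuous.
Qed.

End Continuity.

Section Submodules.
Variables (C : numClosedFieldType) (N d : nat).
Local Notation dimE := #|{: {ffun 'I_d -> 'I_N}}|.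
Local Notation inA := (@inA C N d).

Definition submodule m (W : 'M[C]_(m, dimE)) :=
  {in unitarymx, forall U, (W *m tens d U <= W)%MS}.

Lemma submodule_inA m (W : 'M[C]_(m, dimE)) Y : submodule W -> inA Y -> (W *m Y <= W)%MS.
Proof.
move=> Wst [a /allP ga <-]; rewrite /ev mulmx_sumr big_seq; apply: summx_sub => p pa.
by rewrite -scalemxAr scalemx_sub // Wst // ga.
Qed.

Lemma submodule_eqmx m1 m2 (V : 'M[C]_(m1, dimE)) (W : 'M[C]_(m2, dimE)) :
  (V :=: W)%MS -> submodule V -> submodule W.
Proof.
move=> VW Vst U uU; rewrite -VW; apply: submx_trans (Vst U uU).
by rewrite submxMr // VW.
Qed.

Local Notation perp V := (orthomx Num.conj (mx_of_hermitian (hermitian1mx dimE)) V).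

(** The adjoint of a unitary tensor is a unitary tensor, so the standard Hermitian form already
    provides invariant complements. *)
Lemma submodule_perp m (V : 'M[C]_(m, dimE)) : submodule V -> submodule (perp V).
Proof.
move=> Vst U uU; apply/orthomx1P.
have uUC : (U^t*)%sesqui \is unitarymx by rewrite trmxC_unitary.
have /submxP[D eD] := Vst _ uUC.
have -> : perp V *m tens d U *m (V^t*)%sesqui = perp V *m ((V *m tens d (U^t*))^t*)%sesqui.
  rewrite trmx_mul map_mxM -mulmxA; congr (_ *m (_ *m _)).
  by rewrite tensC trmxCK.
have V0 : perp V *m (V^t*)%sesqui = 0 by apply/orthomx1P.
by rewrite eD trmx_mul map_mxM mulmxA V0 mul0mx.
Qed.

Lemma submodule_cap m1 m2 (V : 'M[C]_(m1, dimE)) (W : 'M[C]_(m2, dimE)) :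
  submodule V -> submodule W -> submodule (V :&: W)%MS.
Proof.
move=> Vst Wst U uU; rewrite sub_capmx.
apply/andP; split; [apply: submx_trans (Vst U uU)|apply: submx_trans (Wst U uU)];
  by rewrite submxMr // ?capmxSl ?capmxSr.
Qed.

Lemma submodule_complement m (V W : 'M[C]_(m, dimE)) :
  (V <= W)%MS -> (V + (W :&: perp V) :=: W)%MS.
Proof.
move=> VW; apply/eqmxP; rewrite addsmx_sub VW capmxSl /=.
rewrite capmxC (matrix_modl _ VW) sub_capmx submx_refl andbT addsmx_ortho.
exact: submx1.
Qed.

Definition irreducible_submodule m (W : 'M[C]_(m, dimE)) :=
  [/\ W != 0, submodule W & forall V : 'M[C]_dimE, submodule V -> (V <= W)%MS ->
      V = 0 \/ (W <= V)%MS].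

(** Minimize the rank among the submodules of [E0] not killed by [Y]. For [V] inside [W], [Y] cannot
    kill both [V] and its complement in [W], and the survivor is all of [W]. When [Y] projects onto
    a weight space, the irreducible piece keeps a vector of that weight. *)
Lemma minimal_submodule (E0 Y : 'M[C]_dimE) :
    submodule E0 -> E0 *m Y != 0 ->
  exists W : 'M[C]_dimE, [/\ irreducible_submodule W, (W <= E0)%MS & W *m Y != 0].
Proof.
move=> E0st E0Y.
pose P r := `[< exists W : 'M[C]_dimE,
  [/\ \rank W = r, submodule W, (W <= E0)%MS & W *m Y != 0] >].
have exP : exists r, P r by exists (\rank E0); apply/asboolP; exists E0.
case: (ex_minnP exP) => r /asboolP[W [rW Wst WE WY]] minr.
have ltW (V : 'M[C]_dimE) : submodule V -> (V <= W)%MS -> V *m Y != 0 -> (W <= V)%MS.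
  move=> Vst VW VY; have [leVW <-] := mxrank_leqif_sup VW.
  rewrite eqn_leq leVW rW /=; apply: minr; apply/asboolP; exists V; split=> //.
  exact: submx_trans VW WE.
exists W; split=> //; split=> [|//|V Vst VW].
  by apply: contraNneq WY => ->; rewrite mul0mx.
have [VY|VY] := eqVneq (V *m Y) 0; last by right; exact: ltW.
have [V'Y|V'Y] := eqVneq ((W :&: perp V)%MS *m Y) 0.
  have /submxP[D WD] : (W <= col_mx V (W :&: perp V))%MS.
    by rewrite -addsmxE submodule_complement.
  by move: WY; rewrite WD -mulmxA mul_col_mx VY V'Y col_mx0 mulmx0 eqxx.
left; have WV' : (W <= W :&: perp V)%MS.
  by apply: ltW => //; [apply: submodule_cap => //; exact: submodule_perp | exact: capmxSl].
apply/eqP; rewrite -submx0 -(orthomx_ortho_disj V) sub_capmx submx_refl /=.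
exact: submx_trans VW (submx_trans WV' (capmxSr _ _)).
Qed.

Section SubRepresentation.
Variables (r : nat) (R : 'M[C]_(r, dimE)).
Hypotheses (Rfree : row_free R) (Rst : submodule R).

(** The action on the row space of [R] in the basis of its rows, [pinvmx R] reading off the
    coordinates. *)
Definition restr (Y : 'M[C]_dimE) : 'M[C]_r := R *m Y *m pinvmx R.
Definition subrep (U : 'M[C]_N) : 'M[C]_r := restr (tens d U).

Lemma restrP Y : inA Y -> R *m Y = restr Y *m R.
Proof. by move=> AY; rewrite mulmxKpV // submodule_inA. Qed.

Lemma restr1 : restr 1%:M = 1%:M.
Proof.
have /row_freeP[B RB] := Rfree.
by rewrite -[LHS]mulmx1 -RB mulmxA -restrP ?mulmx1 //; exact: inA1.
Qed.

Lemma restrM Y Z : inA Y -> inA Z -> restr (Y *m Z) = restr Y *m restr Z.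
Proof.
move=> AY AZ; rewrite {1}/restr [R *m _]mulmxA (restrP AY) -!mulmxA [R *m (Z *m _)]mulmxA.
by [].
Qed.

Lemma restr_lin c Y Z : restr (c *: Y + Z) = c *: restr Y + restr Z.
Proof. by rewrite /restr mulmxDr mulmxDl -scalemxAr -scalemxAl. Qed.

Lemma restr_sum (I : Type) (s : seq I) (c : I -> C) (Y : I -> 'M[C]_dimE) :
  restr (\sum_(i <- s) c i *: Y i) = \sum_(i <- s) c i *: restr (Y i).
Proof.
rewrite /restr mulmx_sumr mulmx_suml; apply: eq_bigr => i _.
by rewrite -scalemxAr -scalemxAl.
Qed.

Lemma ev_subrep a : ev subrep a = restr (ev (tens d) a).
Proof. by rewrite /ev restr_sum. Qed.

Lemma subrep_hom : unitary_hom subrep.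
Proof.
split; first by rewrite /subrep tens1 restr1.
by move=> U V uU uV; rewrite /subrep tensM restrM //; exact: inA_tens.
Qed.

Lemma subrep_repr : unitary_repr subrep.
Proof.
have [s1 sM] := subrep_hom; split=> //.
by apply: continuous_subspaceT => U; exact: tens_mul_continuous.
Qed.

Lemma subrep_irreducible : irreducible_submodule R -> unitary_irreducible subrep.
Proof.
move=> [R0 _ Rirr]; split.
  by rewrite lt0n; apply: contraNneq R0 => r0; apply/eqP/matrixP => i; have := ltn_ord i; rewrite {2}r0.
move=> V Vst; pose V' := <<V *m R>>%MS.
have V'R : (V' <= R)%MS by rewrite genmxE submxMl.
have V'st : submodule V'.
  apply: (submodule_eqmx (eqmx_sym (genmxE (V *m R)))) => U uU.
  rewrite -mulmxA restrP; last exact: inA_tens.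
  by rewrite mulmxA submxMr //; exact: Vst.
have [V'0|RV'] := Rirr V' V'st V'R; [left|right].
  apply/eqP; rewrite -submx0 -(row_free_inj Rfree (_ : V *m R = 0 *m R)) ?submx_refl //.
  by rewrite mul0mx; apply/eqP; rewrite -submx0 -V'0 genmxE.
rewrite -sub1mx; have /row_freeP[B RB] := Rfree.
rewrite -[1%:M]RB -[V]mulmx1 -RB mulmxA submxMr //.
by apply: submx_trans RV' _; rewrite genmxE.
Qed.

End SubRepresentation.
End Submodules.

(** * The module attached to a Young diagram *)

Lemma card_le_of_inj (T : finType) (A : {set T}) (f : T -> nat) k :
  {in A &, injective f} -> (forall a, a \in A -> (f a < k)%N) -> (#|A| <= k)%N.
Proof.
case: k => [|k] finj fk.
  by rewrite leqn0 cards_eq0; apply/set0Pn => -[a /fk].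
rewrite -(card_in_imset (f := fun a => inord (f a) : 'I_k.+1)).
  by rewrite -[leqRHS]card_ord max_card.
move=> a b aA bA /(congr1 val) /=; rewrite !inordK ?fk //; exact: finj.
Qed.

Section Cells.
Variables (d : nat) (lam : d.-tuple 'I_d.+1).
Hypothesis lamP : lam \in young d.
Local Notation sh := (rows lam).

Lemma sumn_rows : sumn sh = d.
Proof.
move: lamP; rewrite inE => /andP[_ /eqP sumd].
transitivity (\sum_(x <- lam) val x)%N => //; rewrite /rows -(big_map val xpredT id) /=.
by elim: [seq val x | x <- lam] => [|[|n] s IH] /=; rewrite ?big_nil ?big_cons ?IH.
Qed.

Lemma sorted_rows : sorted geq sh.
Proof.
move: lamP; rewrite inE => /andP[h _]; apply: sorted_filter h.
by move=> a b c ba cb; exact: leq_trans cb ba.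
Qed.

Lemma row_len_noninc i j : (i <= j)%N -> (row_len lam j <= row_len lam i)%N.
Proof.
move=> ij; rewrite /row_len; have [jS|Sj] := ltnP j (size sh); last by rewrite nth_default.
have := sorted_leq_nth (leT := geq) _ _ 0%N sorted_rows.
apply => //; [by move=> a b c ba cb; exact: leq_trans cb ba|exact: leqnn|].
by rewrite inE (leq_ltn_trans ij).
Qed.

Lemma size_rows_le : (size sh <= d)%N.
Proof. by rewrite /rows size_filter -[leqRHS](size_tuple lam) -(size_map val) count_size. Qed.

(** Numbering the cells row by row attaches a cell of the diagram to each slot of the tensor
    power. *)
Definition cell_row (a : 'I_d) := reshape_index sh a.
Definition cell_col (a : 'I_d) := reshape_offset sh a.

Lemma cell_lt (a : 'I_d) : (a < sumn sh)%N.
Proof. by rewrite sumn_rows. Qed.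

Lemma cell_row_lt a : (cell_row a < d)%N.
Proof. exact: leq_trans (reshape_indexP (cell_lt a)) size_rows_le. Qed.

Lemma cell_col_lt a : (cell_col a < row_len lam (cell_row a))%N.
Proof. exact: reshape_offsetP (cell_lt a). Qed.

Lemma cell_inj a b : cell_row a = cell_row b -> cell_col a = cell_col b -> a = b.
Proof.
move=> rab cab; apply: val_inj; rewrite /= -(reshape_indexK sh a) -(reshape_indexK sh b).
by rewrite -/(cell_row a) -/(cell_col a) rab cab.
Qed.

Lemma cellP r c : (c < row_len lam r)%N -> exists a, cell_row a = r /\ cell_col a = c.
Proof.
move=> cr; have := flatten_indexP cr; rewrite sumn_rows => ad.
by exists (Ordinal ad); rewrite /cell_row /cell_col /= flatten_indexKl ?flatten_indexKr.
Qed.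

Lemma card_row r : #|[set a | cell_row a == r]| = row_len lam r.
Proof.
pose f (c : 'I_(row_len lam r)) : 'I_d := sval (cid (cellP (ltn_ord c))).
have fr c : cell_row (f c) = r by rewrite /f; case: cid => a [].
have fc c : cell_col (f c) = c by rewrite /f; case: cid => a [].
rewrite (_ : [set a | _] = [set f c | c : 'I__]) ?card_imset ?card_ord //.
  by move=> c c' ff; apply: val_inj; rewrite /= -fc -[RHS]fc ff.
apply/setP => a; rewrite inE; apply/eqP/imsetP => [ar|[c _ ->]]; last exact: fr.
have ca : (cell_col a < row_len lam r)%N by rewrite -ar cell_col_lt.
exists (Ordinal ca) => //; apply: cell_inj; by rewrite ?fr ?fc.
Qed.

(* In each column the rows of a diagram are 0, 1, 2, ..., so that a filling    *)
(* with distinct entries in each column has at most as many entries below [k]  *)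
(* as the filling of each cell by its row.                                     *)
Lemma card_column_filling (J : 'I_d -> nat) k :
    (forall a b, cell_col a = cell_col b -> J a = J b -> a = b) ->
  (#|[set a | (J a < k)%N]| <= #|[set a | (cell_row a < k)%N]|)%N.
Proof.
move=> Jinj.
have split_col (Q : pred 'I_d) : #|[set a | Q a]| =
    (\sum_(c < d) #|[set a | Q a & cell_col a == c]|)%N.
  rewrite -sum1_card.
  have colP (a : 'I_d) : (cell_col a < d)%N.
    apply: leq_trans (cell_col_lt a) _; rewrite -card_row.
    by apply: leq_trans (max_card _) _; rewrite card_ord.
  rewrite (partition_big (fun a => Ordinal (colP a)) xpredT) //=.
  apply: eq_bigr => c _; rewrite -sum1_card; apply: eq_bigl => a.
  by rewrite !inE -val_eqE.
rewrite [leqLHS]split_col [leqRHS]split_col; apply: leq_sum => c _.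
have [/existsP[a0 /andP[/eqP a0c ka0]]|/existsPn h] :=
    boolP [exists a, (cell_col a == c) && (k <= cell_row a)%N].
  apply: (@leq_trans k).
    apply: (card_le_of_inj (f := J)) => [a b|a]; rewrite !inE; last by case/andP.
    by move=> /andP[_ /eqP ac] /andP[_ /eqP bc]; apply: Jinj; rewrite ac bc.
  have cell (r : 'I_k) : exists a, cell_row a = r /\ cell_col a = c.
    apply: cellP; rewrite -a0c; apply: leq_trans (cell_col_lt a0) _.
    by apply: row_len_noninc; apply: leq_trans (ltnW (ltn_ord r)) ka0.
  pose f r := sval (cid (cell r)).
  have fr r : cell_row (f r) = r by rewrite /f; case: cid => a [].
  have fc r : cell_col (f r) = c by rewrite /f; case: cid => a [].
  have kE : #|[set f r | r : 'I_k]| = k.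
    by rewrite card_imset ?card_ord // => r r' ff; apply: val_inj; rewrite /= -fr -[RHS]fr ff.
  rewrite -[leqLHS]kE; apply/subset_leq_card/fintype.subsetP => _ /imsetP[r _ ->].
  by rewrite inE fc eqxx andbT fr ltn_ord.
apply/subset_leq_card/fintype.subsetP => a; rewrite !inE => /andP[_ ac].
by rewrite ac andbT; have := h a; rewrite ac /= -ltnNge.
Qed.

End Cells.

(** * Weights of words and the column antisymmetrizer *)

Section Contents.
Variables (C : numClosedFieldType) (N d : nat).
Local Notation word := {ffun 'I_d -> 'I_N}.
Local Notation dimE := #|{: {ffun 'I_d -> 'I_N}}|.
Implicit Types (I J : word) (i j : 'I_N).

Definition content I i : nat := #|[set a | I a == i]|.
Definition below I k : nat := #|[set a | (I a < k)%N]|.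

Lemma belowE I k : below I k = (\sum_(i < N | (i < k)%N) content I i)%N.
Proof.
rewrite /below -sum1_card (partition_big I (fun i : 'I_N => (i < k)%N)) /=; last by move=> a; rewrite inE.
apply: eq_bigr => i ik; rewrite /content -sum1_card; apply: eq_bigl => a.
by rewrite !inE; have [->|] := eqVneq (I a) i; rewrite ?ik ?andbF.
Qed.

Lemma sum_content I : (\sum_i content I i)%N = d.
Proof.
rewrite -[RHS](card_ord d) -sum1_card (partition_big I xpredT) //=.
by apply: eq_bigr => i _; rewrite /content -sum1_card; apply: eq_bigl => a; rewrite inE.
Qed.

Lemma content_perm s I i : content (permword s I) i = content I i.
Proof.
rewrite /content -(card_imset _ (@perm_inj _ s)); apply: eq_card => a.
rewrite [RHS]inE; apply/imsetP/eqP => [[b + ->]|Ia]; first by rewrite inE ffunE => /eqP.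
by exists (s^-1%g a); rewrite ?inE ?ffunE permKV ?Ia.
Qed.

Lemma tens_diag_row (v : 'rV[C]_dimE) (x : 'rV[C]_N) I :
  (v *m tens d (diag_mx x)) 0 (enum_rank I) = v 0 (enum_rank I) * \prod_i x 0 i ^+ content I i.
Proof.
rewrite mxE (bigD1 (enum_rank I)) //= big1 ?addr0 => [|j jI]; last first.
  rewrite mxE enum_rankK; have /existsP[a aP] : [exists a, (enum_val j : word) a != I a].
    rewrite -negb_forall; apply: contra jI => /forallP h.
    by apply/eqP; rewrite -(enum_valK j); congr enum_rank; apply/ffunP => a; apply/eqP.
  by rewrite (bigD1 a) //= mxE (negPf aP) mulr0n mul0r mulr0.
congr (_ * _); rewrite mxE enum_rankK (partition_big I xpredT) //=.
apply: eq_bigr => i _; rewrite (eq_bigr (fun _ => x 0 i)) => [|a /eqP <-]; last first.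
  by rewrite mxE eqxx mulr1n.
by rewrite prodr_const; congr (_ ^+ _); apply: eq_card => a; rewrite inE.
Qed.

Definition upd J (a : 'I_d) i : word := [ffun b => if b == a then i else J b].

(** The action is on rows from the right, so [delta_mx i j] turns a letter [i] into [j]; the
    coefficient at [J] collects the words with one [j] put back to [i]. Hence the raising operators
    are those with [j < i]. *)
Lemma der_row (v : 'rV[C]_dimE) i j J :
  (v *m der d (delta_mx i j)) 0 (enum_rank J) =
  \sum_(a | J a == j) v 0 (enum_rank (upd J a i)).
Proof.
rewrite /der mulmx_sumr summxE [RHS]big_mkcond; apply: eq_bigr => a _.
pose K (k : 'I_dimE) : word := enum_val k.
have slot_entry k : slot a (delta_mx i j) k (enum_rank J) =
    ((K k a == i) && (J a == j))%:R * \prod_(b | b != a) (K k b == J b)%:R :> C.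
  by rewrite mxE enum_rankK slotE mxE.
rewrite mxE; under eq_bigr do rewrite slot_entry.
have [Ja|Ja] := ifPn; last by rewrite big1 // => k _; rewrite andbF mul0r mulr0.
rewrite (bigD1 (enum_rank (upd J a i))) //= [X in _ + X]big1 ?addr0 => [|k kJ].
  rewrite /K enum_rankK ffunE !eqxx mul1r big1 ?mulr1 // => b /negPf ba.
  by rewrite ffunE ba eqxx.
have /existsP[b bP] : [exists b, K k b != upd J a i b].
  rewrite -negb_forall; apply: contra kJ => /forallP h.
  by apply/eqP; rewrite -(enum_valK k); congr enum_rank; apply/ffunP => b; apply/eqP.
move: bP; rewrite ffunE; have [->|ba] := eqVneq b a => /negPf Kb.
  by rewrite Kb mul0r mulr0.
by rewrite [X in _ * (_ * X)](bigD1 b) //= Kb mul0r !mulr0.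
Qed.

Lemma below_upd J a i k : (J a < k)%N -> (k <= i)%N -> below J k = (below (upd J a i) k).+1.
Proof.
move=> Jk ki; rewrite /below (cardsD1 a) inE Jk add1n; congr _.+1.
apply: eq_card => b; rewrite !inE ffunE; have [->|//] := eqVneq b a.
by rewrite /= [RHS]ltnNge ki.
Qed.

End Contents.

Section Antisymmetrizer.
Variables (C : numClosedFieldType) (N d : nat) (lam : d.-tuple 'I_d.+1).
Hypotheses (lamP : lam \in young d) (dN : (d <= N)%N).
Local Notation word := {ffun 'I_d -> 'I_N}.
Local Notation dimE := #|{: {ffun 'I_d -> 'I_N}}|.
Implicit Types (I J : word) (s t : 'S_d).

(** The filling of highest weight, in which every cell carries the index of its row; [d <= N]
    provides the letters. *)
Definition row_word : word := [ffun a => Ordinal (leq_trans (cell_row_lt lamP a) dN)].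

Lemma content_row_word i : content row_word i = row_len lam i.
Proof.
rewrite -(card_row lamP); apply: eq_card => a; rewrite !inE ffunE.
by rewrite -val_eqE.
Qed.

Lemma below_row_word k : below row_word k = (\sum_(i < N | (i < k)%N) row_len lam i)%N.
Proof. by rewrite belowE; apply: eq_bigr => i _; rewrite content_row_word. Qed.

Definition column_perm s := [forall a, cell_col lam (s a) == cell_col lam a].

Definition antisym : 'M[C]_dimE := \sum_(s | column_perm s) (-1) ^+ s *: permw C N s.

Lemma antisym_perm t : column_perm t -> antisym *m permw C N t = (-1) ^+ t *: antisym.
Proof.
move=> /forallP tP; rewrite /antisym mulmx_suml scaler_sumr.
rewrite [RHS](reindex_inj (mulIg t)) /=; apply: eq_big => s.
  by apply: eq_forallb => a; rewrite permM (eqP (tP _)).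
by move=> _; rewrite -scalemxAl -permwM scalerA odd_permM signr_addb mulrCA -expr2 sqrr_sign mulr1.
Qed.

Lemma antisym_submodule : submodule antisym.
Proof.
move=> U _; rewrite /antisym mulmx_suml.
suff -> : \sum_(s | column_perm s) (-1) ^+ s *: permw C N s *m tens d U = tens d U *m antisym.
  exact: submxMl.
rewrite mulmx_sumr; apply: eq_bigr => s _.
by rewrite -scalemxAl -scalemxAr tens_permC.
Qed.

(** Exchanging the two slots changes the sign of [u] but fixes the word [J]. *)
Lemma antisym_coord0 (u : 'rV[C]_dimE) J a b :
    (u <= antisym)%MS -> a != b -> cell_col lam a = cell_col lam b -> J a = J b ->
  u 0 (enum_rank J) = 0.
Proof.
move=> /submxP[y uE] ab cab Jab.
have tP : column_perm (tperm a b) by apply/forallP => c; case: tpermP => [->|->|] //; rewrite cab.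
have : (u *m permw C N (tperm a b)) 0 (enum_rank J) = - u 0 (enum_rank J).
  by rewrite uE -mulmxA antisym_perm // odd_tperm ab expr1 scaleN1r mulmxN mxE.
have JJ : permword (tperm a b) J = J.
  by apply/ffunP => c; rewrite ffunE; case: tpermP => [->|->|].
rewrite mxE (bigD1 (enum_rank J)) //= big1 ?addr0 => [|k kJ]; last first.
  rewrite mxE enum_rankK JJ; have -> : (enum_val k == J) = false; last by rewrite mulr0.
  by apply: contraNF kJ => /eqP <-; rewrite enum_valK.
rewrite mxE enum_rankK JJ eqxx mulr1 => /eqP; rewrite -addr_eq0 -mulr2n mulrn_eq0 /=.
by move/eqP.
Qed.

Lemma antisym_below (u : 'rV[C]_dimE) J k :
  (u <= antisym)%MS -> u 0 (enum_rank J) != 0 -> (below J k <= below row_word k)%N.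
Proof.
move=> uA uJ; rewrite /below.
rewrite [leqRHS](_ : _ = #|[set a | (cell_row lam a < k)%N]|); last first.
  by apply: eq_card => a; rewrite !inE ffunE.
apply: (card_column_filling lamP (J := fun a => J a)) => a b cab /val_inj Jab.
apply/eqP; apply: contraNT uJ => ab; apply/eqP; exact: antisym_coord0 uA ab cab Jab.
Qed.

Definition has_weight I := [forall i, content I i == row_len lam i].
Definition wproj : 'M[C]_dimE := mxw (fun I J => ((I == J) && has_weight I)%:R).

Lemma has_weight_perm s I : has_weight (permword s I) = has_weight I.
Proof. by apply: eq_forallb => i; rewrite content_perm. Qed.

(** Permuting the slots preserves contents, so this projection onto a weight space is its own
    symmetrization. *)
Lemma inA_wproj : inA wproj.
Proof.
suff <- : symmetrize wproj = wproj by exact: inA_symmetrize.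
rewrite /symmetrize (eq_bigr (fun _ => wproj)) => [|s _].
  by rewrite sumr_const (card_Sn d) -[wproj *+ _]scaler_nat scalerA mulVf ?scale1r.
rewrite permw_mulmx mulmx_permw invgK; apply: eq_mxw => I J.
by rewrite has_weight_perm (can_eq (permwordK s)).
Qed.

Lemma wproj_row (v : 'rV[C]_dimE) I :
  (v *m wproj) 0 (enum_rank I) = if has_weight I then v 0 (enum_rank I) else 0.
Proof.
rewrite mxE (bigD1 (enum_rank I)) //= big1 ?addr0 => [|k kI]; last first.
  rewrite mxE enum_rankK; have -> : (enum_val k == I) = false; last by rewrite mulr0.
  by apply: contraNF kI => /eqP <-; rewrite enum_valK.
by rewrite mxE !enum_rankK eqxx /=; case: ifP; rewrite ?mulr1 ?mulr0.
Qed.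

(** In the diagonal entry at [row_word] only the identity contributes: a column permutation fixing
    that word preserves both the row and the column of every cell. *)
Lemma antisym_wproj : antisym *m wproj != 0.
Proof.
apply/negP => /eqP/(congr1 (row (enum_rank row_word)))/rowP/(_ (enum_rank row_word)).
rewrite row_mul wproj_row (_ : has_weight row_word); last first.
  by apply/forallP => i; rewrite content_row_word.
rewrite row0 !mxE summxE (bigD1 1%g) /=; last first.
  by apply/forallP => a; rewrite perm1.
rewrite big1 ?addr0 => [|s /andP[/forallP sP s1]].
  by rewrite odd_perm1 expr0 scale1r permw1 mxE eqxx => /eqP; rewrite oner_eq0.
rewrite !mxE !enum_rankK; have [E|_] := eqVneq row_word (permword s row_word); last by rewrite mulr0.
case/eqP: s1; apply/permP => a; rewrite perm1.
apply: (cell_inj (lam := lam)); last exact/eqP.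
by have /(congr1 (fun f : word => val (f a))) := E; rewrite !ffunE /= => ->.
Qed.

Lemma schur_submodule : exists W : 'M[C]_dimE,
  [/\ irreducible_submodule W, (W <= antisym)%MS & W *m wproj != 0].
Proof. exact: minimal_submodule antisym_submodule antisym_wproj. Qed.

End Antisymmetrizer.

Lemma sum_ord_lt (N i : nat) : (i <= N)%N -> (\sum_(j < N | (j < i)%N) 1)%N = i.
Proof. by move=> iN; rewrite (big_ord_narrow iN) sum1_card card_ord. Qed.

(** The left-hand side is the eigenvalue as a highest weight vector yields it: squares from [i = j],
    and differences from the commutators for [i < j]. With indices from 0, [L i] occurs [N - 1 - i]
    times positively and [i] times negatively. *)
Lemma casimir_sum (F : comNzRingType) (N : nat) (L : nat -> nat) :
  \sum_(i < N) \sum_(j < N)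
     (if i == j then (L i)%:R ^+ 2 else if (i < j)%N then (L i)%:R - (L j)%:R else 0) =
  (\sum_(i < N) (L i)%:Z * ((L i)%:Z + N%:Z + 1 - 2 * (i.+1)%:Z))%:~R :> F.
Proof.
have count_lt (i : 'I_N) : \sum_(j < N) (j < i)%:R = (i : nat)%:R :> F.
  rewrite -[in RHS](sum_ord_lt (ltnW (ltn_ord i))) natr_sum big_mkcond.
  by rewrite [RHS]big_mkcond; apply: eq_bigr => j _; case: ifP.
have count_gt (i : 'I_N) : \sum_(j < N) (i < j)%:R = N%:R - 1 - (i : nat)%:R :> F.
  have : \sum_(j < N) ((j < i)%:R + (j == i)%:R + (i < j)%:R) = N%:R :> F.
    rewrite (eq_bigr (fun _ => 1)) ?sumr_const ?card_ord // => j _.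
    by case: (ltngtP j i) => [ji|ij|/val_inj->]; rewrite ?eqxx ?(gtn_eqF, ltn_eqF) -?val_eqE /=
      ?(ltn_eqF ji) ?(gtn_eqF ij) ?addr0 ?add0r.
  rewrite !big_split /= count_lt (bigD1 i) //= eqxx big1 ?addr0 => [|j /negPf->//].
  by move: (\sum_(j < N) (i < j)%:R : F) => S <-; rewrite -[true%:R]/(1 : F); ring.
transitivity (\sum_(i < N) (L i)%:R ^+ 2 + \sum_(i < N) \sum_(j < N) (i < j)%:R * ((L i)%:R - (L j)%:R) : F).
  rewrite -big_split; apply: eq_bigr => i _ /=; rewrite (bigD1 i) //= eqxx; congr (_ + _).
  rewrite [RHS](bigD1 i) //= subrr mulr0 add0r; apply: eq_bigr => j ji.
  by rewrite eq_sym (negPf ji); case: ifP; rewrite ?mul1r ?mul0r.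
have -> : \sum_(i < N) \sum_(j < N) (i < j)%:R * ((L i)%:R - (L j)%:R) =
    \sum_(i < N) (L i)%:R * (N%:R - 1 - (i : nat)%:R) - \sum_(i < N) (L i)%:R * (i : nat)%:R :> F.
  under eq_bigr do (under eq_bigr do rewrite mulrBr; rewrite sumrB).
  rewrite sumrB; congr (_ - _).
    by apply: eq_bigr => i _; rewrite -mulr_suml count_gt mulrC.
  rewrite exchange_big /=; apply: eq_bigr => j _.
  by rewrite -mulr_suml count_lt mulrC.
rewrite -sumrB -big_split rmorph_sum; apply: eq_bigr => i _ /=.
by rewrite !(rmorphM, rmorphD, rmorphB, rmorphN, rmorph1, rmorph_nat) /= -?pmulrn; ring.
Qed.

(** For distinct exponents, the infinitely many points [circle_pt n] would all be roots of one
    polynomial [X^k - 1] with [k > 0]. *)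
Lemma circle_exponents_inj (C : numClosedFieldType) (m n : int) :
  (forall z : C, `|z| = 1 -> z ^ m = z ^ n) -> m = n.
Proof.
move=> mn; wlog le_nm : m n mn / n <= m.
  by case: (lerP n m) => [|/ltW] h; [apply | move/(_ n m (fun z z1 => esym (mn z z1)) h)].
apply/eqP; rewrite -subr_eq0; have : 0 <= m - n by rewrite subr_ge0.
case E: (m - n) => [[|k]|k] // _.
pose rs : seq C := [seq circle_pt C i | i <- iota 0 k.+2].
have : (size rs <= k.+1)%N.
  apply: max_unity_roots => //; last by rewrite map_inj_uniq ?iota_uniq //; exact: circle_pt_inj.
  apply/allP => _ /mapP[i _ ->]; apply/unity_rootP.
  have z1 := norm_circle_pt C i; have z0 : circle_pt C i != 0 by rewrite -normr_eq0 z1 oner_eq0.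
  by rewrite exprnP -E expfzDr // -invr_expz mn // mulfV // expfz_neq0.
by rewrite size_map size_iota ltnn.
Qed.

(** * Highest weight vectors and the Casimir eigenvalue *)

Section SchurModule.
Variables (C : numClosedFieldType) (N d : nat) (lam : d.-tuple 'I_d.+1).
Hypotheses (lamP : lam \in young d) (dN : (d <= N)%N).
Local Notation word := {ffun 'I_d -> 'I_N}.
Local Notation dimE := #|{: {ffun 'I_d -> 'I_N}}|.
Implicit Types (I J : word).
Local Notation row_word := (row_word lamP dN).
Local Notation wproj := (wproj C N lam).

Variable W : 'M[C]_dimE.
Hypotheses (Wirr : irreducible_submodule W) (WA : (W <= antisym C N lam)%MS).

Section HighestVector.
Variable v : 'rV[C]_dimE.
Hypotheses (vW : (v <= W)%MS) (vE : v *m wproj = v).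

Lemma highest_vector_support I : v 0 (enum_rank I) != 0 -> has_weight lam I.
Proof. by rewrite -vE wproj_row; case: ifP => // _; rewrite eqxx. Qed.

Lemma has_weight_below I k : has_weight lam I -> below I k = below row_word k.
Proof. by move=> /forallP hI; rewrite !belowE; apply: eq_bigr => i _; rewrite (eqP (hI i)) content_row_word. Qed.

Lemma highest_vector_der_diag i : v *m der d (delta_mx i i) = (row_len lam i)%:R *: v.
Proof.
apply/rowP => j; rewrite -(enum_valK j); move: (enum_val j) => J; rewrite der_row mxE.
rewrite (eq_bigr (fun _ => v 0 (enum_rank J))) => [|a /eqP Ja]; last first.
  congr (v 0 (enum_rank _)); apply/ffunP => b; rewrite ffunE.
  by case: eqP => // ->.
rewrite sumr_const -[LHS]mulr_natl; have [->|vJ] := eqVneq (v 0 (enum_rank J)) 0; first by rewrite !mulr0.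
have /forallP/(_ i)/eqP <- := highest_vector_support vJ.
by congr (_%:R * _); apply: eq_card => a; rewrite inE.
Qed.

(** Turning a letter [i] into the smaller [j] yields a word with more letters below [j.+1] than
    [row_word] has, which antisymmetry in the columns excludes. *)
Lemma highest_vector_raise (i j : 'I_N) : (j < i)%N -> v *m der d (delta_mx i j) = 0.
Proof.
move=> ji; apply/rowP => k; rewrite -(enum_valK k); move: (enum_val k) => J.
rewrite [RHS]mxE; apply/eqP; apply: contraT => uJ.
have uA : (v *m der d (delta_mx i j) <= antisym C N lam)%MS.
  have [_ Wst _] := Wirr.
  apply: submx_trans WA; apply: submx_trans (submodule_inA Wst (inA_der d (delta_mx i j))).
  exact: submxMr.
have := antisym_below lamP dN j.+1 uA uJ; move: uJ; rewrite der_row => uJ.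
have [a /andP[/eqP Ja va]] : exists a, (J a == j) && (v 0 (enum_rank (upd J a i)) != 0).
  apply/existsP; apply: contraNT uJ; rewrite negb_exists => /forallP h.
  rewrite big1 // => a Ja; apply/eqP; have := h a; rewrite Ja /=.
  by rewrite negbK.
rewrite (below_upd (a := a) (i := i)) ?Ja // (has_weight_below _ (highest_vector_support va)).
by rewrite ltnn.
Qed.

(** In a product acting from the right the first factor acts first. For [j < i] it kills [v]; for
    [i < j] the commutator brings the other factor, which kills [v], to the front. *)
Lemma highest_vector_casimir : v *m casimir_mx C N d = (casimir N lam)%:~R *: v.
Proof.
rewrite /casimir -casimir_sum /casimir_mx mulmx_sumr scaler_suml; apply: eq_bigr => i _.
rewrite mulmx_sumr scaler_suml; apply: eq_bigr => j _.
have [<-|ij] := eqVneq i j.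
  by rewrite mulmxA !highest_vector_der_diag // -scalemxAl highest_vector_der_diag scalerA expr2.
case: ltngtP ij => [ij _|ji _|/val_inj->]; last by rewrite eqxx.
  have /eqP := der_comm d (delta_mx i j) (delta_mx j i : 'M[C]_N).
  rewrite subr_eq => /eqP->; rewrite mulmxDr mulmxA highest_vector_raise // mul0mx addr0.
  rewrite !mul_delta_mx derB mulmxBr !highest_vector_der_diag.
  by rewrite scalerBl.
by rewrite mulmxA highest_vector_raise // mul0mx scale0r.
Qed.

End HighestVector.

Hypothesis Wproj : W *m wproj != 0.

Lemma highest_vector : exists v : 'rV[C]_dimE, [/\ v != 0, (v <= W)%MS & v *m wproj = v].
Proof.
have /existsP[i iW] : [exists i, row i (W *m wproj) != 0].
  apply: contraNT Wproj; rewrite negb_exists => /forallP h.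
  by apply/eqP/row_matrixP => i; rewrite row0; apply/eqP; move: (h i); rewrite negbK.
exists (row i (W *m wproj)); split=> //.
  have [_ Wst _] := Wirr.
  exact: submx_trans (row_sub _ _) (submodule_inA Wst (inA_wproj _ _ _)).
apply/rowP => j; rewrite -(enum_valK j) wproj_row; case: ifP => // hw.
by rewrite row_mul wproj_row hw.
Qed.

(** Schur's lemma: the eigenspace is a submodule, and it shares with [W] a highest weight vector. *)
Lemma casimir_scalar : W *m casimir_mx C N d = (casimir N lam)%:~R *: W.
Proof.
have [W0 Wst Wmin] := Wirr.
set c : C := (casimir N lam)%:~R; pose K := kermx (casimir_mx C N d - c%:M).
have casC X : tens d X *m casimir_mx C N d = casimir_mx C N d *m tens d X.
  rewrite casimir_mxE mulmxDr mulmxDl scalar_mxC; congr (_ + _).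
  rewrite -scalemxAr -scalemxAl mulmx_sumr mulmx_suml; congr (_ *: _).
  by apply: eq_bigr => s _; rewrite tens_permC.
have Kst : submodule K.
  move=> U uU; apply/sub_kermxP; rewrite -mulmxA.
  have -> : tens d U *m (casimir_mx C N d - c%:M) = (casimir_mx C N d - c%:M) *m tens d U.
    by rewrite mulmxBr mulmxBl casC scalar_mxC.
  by rewrite mulmxA mulmx_ker mul0mx.
have [||/eqP K0|WK] := Wmin (W :&: K)%MS.
- exact: submodule_cap.
- exact: capmxSl.
- have [v [v0 vW vE]] := highest_vector.
  have : (v <= W :&: K)%MS.
    rewrite sub_capmx vW; apply/sub_kermxP.
    by rewrite mulmxBr highest_vector_casimir // scalar_mxC mul_scalar_mx subrr.
  by rewrite (eqP K0) submx0 (negPf v0).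
have /sub_kermxP/eqP : (W <= K)%MS := submx_trans WK (capmxSr _ _).
by rewrite mulmxBr subr_eq0 scalar_mxC mul_scalar_mx => /eqP.
Qed.

Variables (r : nat) (R : 'M[C]_(r, dimE)).
Hypotheses (RW : (R :=: W)%MS) (Rfree : row_free R).

Lemma Rst : submodule R.
Proof. by case: Wirr => _ Wst _; exact: submodule_eqmx (eqmx_sym RW) Wst. Qed.

Lemma Rirr : irreducible_submodule R.
Proof.
have [W0 Wst Wmin] := Wirr; split; last 1 first.
- move=> V Vst; rewrite RW => /(Wmin V Vst) [->|WV]; [by left|right].
  by rewrite RW.
- by rewrite -mxrank_eq0 RW mxrank_eq0.
exact: Rst.
Qed.

Lemma torus_tens (x : 'rV[C]_N) I :
  (forall i, `|x 0 i| = 1) -> has_weight lam I ->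
  \prod_i x 0 i ^+ content I i = \prod_i x 0 i ^ (row_len lam i)%:Z.
Proof. by move=> _ /forallP hI; apply: eq_bigr => i _; rewrite (eqP (hI i)). Qed.

Lemma subrep_weight : weight (subrep R) (fun i => (row_len lam i)%:Z).
Proof.
have [v [v0 vW vE]] := highest_vector.
have /submxP[y yE] : (v <= R)%MS by rewrite RW.
exists y => [|x x1]; first by apply: contraNneq v0 => y0; rewrite yE y0 mul0mx.
apply: (row_free_inj Rfree); rewrite -mulmxA -(restrP Rst) ?mulmxA -?yE; last exact: inA_tens_all.
rewrite -scalemxAl -yE; apply/rowP => j; rewrite -(enum_valK j) tens_diag_row mxE mulrC.
have [->|vj] := eqVneq (v 0 (enum_rank (enum_val j))) 0; first by rewrite !mulr0.
by rewrite torus_tens //; exact: highest_vector_support vj.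
Qed.

(** A weight vector has a nonzero coordinate at some word [J]; its weight is then the content of
    [J], which [antisym_below] bounds. *)
Lemma subrep_weight_le mu : weight (subrep R) mu -> weight_le mu (fun i : 'I_N => (row_len lam i)%:Z).
Proof.
move=> [y y0 yP]; pose v := y *m R.
have v0 : v != 0.
  apply: contraNneq y0 => v0; apply/eqP/(row_free_inj Rfree).
  by rewrite mul0mx.
have vA : (v <= antisym C N lam)%MS.
  by apply: submx_trans WA; apply: submx_trans (submxMl _ _) _; rewrite RW.
have /existsP[j vj] : [exists j, v 0 j != 0].
  apply: contraNT v0; rewrite negb_exists => /forallP h.
  by apply/eqP/rowP => j; rewrite [RHS]mxE; apply/eqP; move: (h j); rewrite negbK.
move: vj; rewrite -(enum_valK j); move: (enum_val j) => J vJ {j}.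
have muE i : mu i = (content J i)%:Z.
  apply: (@circle_exponents_inj C) => z z1.
  pose x : 'rV[C]_N := \row_k (if k == i then z else 1).
  have x1 k : `|x 0 k| = 1 by rewrite mxE; case: ifP; rewrite ?normr1.
  have prodE (f : 'I_N -> int) : \prod_k x 0 k ^ f k = z ^ f i.
    rewrite (bigD1 i) //= mxE eqxx big1 ?mulr1 // => k /negPf ki.
    by rewrite mxE ki exp1rz.
  have := congr1 (fun u => (u *m R) 0 (enum_rank J)) (yP x x1).
  rewrite /= -mulmxA -(restrP Rst); last exact: inA_tens_all.
  rewrite mulmxA -/v tens_diag_row -scalemxAl -/v [(_ *: v) 0 _]mxE mulrC => /(mulIf vJ).
  by rewrite prodE => <-; rewrite (prodE (fun k => (content J k)%:Z)).
have sumE (P : pred 'I_N) (f : 'I_N -> nat) : \sum_(i | P i) (f i)%:Z = (\sum_(i | P i) f i)%N%:Z.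
  by rewrite (big_morph Posz PoszD (erefl 0)).
split=> [k|]; rewrite (eq_bigr _ (fun i _ => muE i)) !sumE.
  by rewrite lez_nat -belowE -(below_row_word lamP dN) (antisym_below lamP dN k vA vJ).
rewrite sum_content; congr (Posz _); rewrite -[LHS](sum_content row_word).
by apply: eq_bigr => i _; rewrite content_row_word.
Qed.

Lemma subrep_highest_weight : highest_weight (subrep R) (fun i : 'I_N => (row_len lam i)%:Z).
Proof. by split; [exact: subrep_weight | exact: subrep_weight_le]. Qed.

Lemma subrep_transp : 2 *: (R *m transp_mx C N d) = ((casimir N lam)%:~R - (d * N)%:R) *: R.
Proof.
have /submxP[D ->] : (R <= W)%MS by rewrite RW.
rewrite -mulmxA [LHS]scalemxAr [RHS]scalemxAr; congr (_ *m _).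
have := casimir_scalar; rewrite casimir_mxE mulmxDr scalar_mxC mul_scalar_mx -scalemxAr.
by rewrite scalerBl => <-; rewrite addrAC subrr add0r.
Qed.

End SchurModule.

Theorem schur_module_exists (C : numClosedFieldType) (N d : nat) (lam : d.-tuple 'I_d.+1) :
    lam \in young d -> (d <= N)%N ->
  exists r (R : 'M[C]_(r, #|{: {ffun 'I_d -> 'I_N}}|)),
    [/\ row_free R, submodule R, unitary_irreducible (subrep R),
      highest_weight (subrep R) (fun i : 'I_N => (row_len lam i)%:Z)
    & 2 *: (R *m transp_mx C N d) = ((casimir N lam)%:~R - (d * N)%:R) *: R].
Proof.
move=> lamP dN; have [W [Wirr WA Wproj]] := schur_submodule C lamP dN.
exists (\rank W), (row_base W).
have Rst := Rst Wirr (eq_row_base W).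
split=> //.
- exact: row_base_free.
- apply: subrep_irreducible => //; first exact: row_base_free.
  exact: Rirr (eq_row_base W).
- exact: subrep_highest_weight (eq_row_base W) (row_base_free W).
- exact: subrep_transp (eq_row_base W).
Qed.

(** * Uniqueness of irreducible characters *)

Section YoungSeq.
Implicit Types s u : seq nat.

Lemma geq_trans : transitive geq.
Proof. by move=> a b c ba cb; exact: leq_trans cb ba. Qed.

Lemma nth_filter_pos u i : sorted geq u -> nth 0%N [seq a <- u | (0 < a)%N] i = nth 0%N u i.
Proof.
elim: u i => [|a u IH] i //= su; have sortu := path_sorted su.
case: posnP => [a0|a0] /=; last by case: i => //= i; exact: IH.
have u0 : all (fun b => b == 0%N) u.
  apply/allP => b bu; have := order_path_min geq_trans su => /allP/(_ b bu) /=.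
  by rewrite a0 leqn0.
have -> : [seq a <- u | (0 < a)%N] = [::].
  apply/eqP; rewrite -[_ == _]negbK -has_filter -all_predC; apply/allP => b /(allP u0)/eqP->.
  by [].
rewrite nth_nil; case: i => [|i] //=.
have [iu|ui] := ltnP i (size u); last by rewrite nth_default.
by rewrite (eqP (allP u0 _ (mem_nth _ iu))).
Qed.

Lemma sorted_nth_pos u i : sorted geq u -> (0 < nth 0%N u i)%N -> (i < sumn u)%N.
Proof.
elim: u i => [|a u IH] i su; first by rewrite nth_nil.
have sortu := path_sorted su; have := order_path_min geq_trans su => /allP minu.
case: i => [|i] /= ui; first by rewrite addn_gt0 ui.
have iu : (i < size u)%N by apply: contraTT ui; rewrite -!leqNgt => h; rewrite nth_default.
have := IH i sortu ui; have := minu _ (mem_nth 0%N iu); move=> /= h1 h2.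
by lia.
Qed.

Lemma nth_le_sumn u i : (nth 0 u i <= sumn u)%N.
Proof.
elim: u i => [|a u IH] [|i] //=; first exact: leq_addr.
exact: leq_trans (IH i) (leq_addl _ _).
Qed.

Lemma nth_noninc u i j : sorted geq u -> (i <= j)%N -> (nth 0 u j <= nth 0 u i)%N.
Proof.
move=> su ij; have [ju|uj] := ltnP j (size u); last by rewrite nth_default.
have := sorted_leq_nth geq_trans leqnn 0%N su.
by apply; rewrite ?inE ?(leq_ltn_trans ij).
Qed.

Lemma sumn_nth u m : (forall i, (m <= i)%N -> nth 0%N u i = 0%N) ->
  sumn u = (\sum_(i < m) nth 0%N u i)%N.
Proof.
move=> u0; pose k := maxn m (size u).
transitivity (\sum_(0 <= i < k) nth 0%N u i)%N; last first.
  rewrite (big_cat_nat (n := m)) ?leq_maxl //= big_mkord.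
  have -> : (\sum_(m <= i < k) nth 0%N u i = 0)%N; last by rewrite addn0.
  by rewrite big_nat big1 // => i /andP[mi _]; exact: u0.
rewrite (big_cat_nat (n := size u)) ?leq_maxr //= sumnE (big_nth 0%N).
have -> : (\sum_(size u <= i < k) nth 0%N u i = 0)%N; last by rewrite addn0.
by rewrite big_nat big1 // => i /andP[ui _]; rewrite nth_default.
Qed.

Variable d : nat.

Lemma young_row_len (lam : d.-tuple 'I_d.+1) i : lam \in young d ->
  row_len lam i = nth 0%N [seq val x | x <- lam] i.
Proof. by rewrite inE => /andP[sl _]; rewrite /row_len /rows nth_filter_pos. Qed.

Lemma young_inj (lam mu : d.-tuple 'I_d.+1) :
  lam \in young d -> mu \in young d -> (forall i, row_len lam i = row_len mu i) -> lam = mu.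
Proof.
move=> lY mY lm; apply: val_inj; apply: (inj_map val_inj).
apply: (@eq_from_nth _ 0%N) => [|i _]; first by rewrite !size_map !size_tuple.
by rewrite -!young_row_len.
Qed.

(** A positive entry at position [i] forces [i < d], so keeping the first [d] entries loses only
    zeros. *)
Lemma young_of_seq s : sorted geq s -> sumn s = d ->
  exists2 lam : d.-tuple 'I_d.+1, lam \in young d & forall i, row_len lam i = nth 0%N s i.
Proof.
move=> ss sumd; pose lam : d.-tuple 'I_d.+1 := [tuple inord (nth 0%N s i) | i < d].
have lamE : [seq val x | x <- lam] = mkseq (nth 0%N s) d.
  rewrite /= -map_comp /mkseq -val_enum_ord -map_comp; apply: eq_map => i /=.
  by rewrite inordK // ltnS -[leqRHS]sumd nth_le_sumn.
have s0 i : (d <= i)%N -> nth 0%N s i = 0%N.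
  move=> di; apply/eqP; rewrite -leqn0 leqNgt; apply/negP => /(sorted_nth_pos ss).
  by rewrite sumd ltnNge di.
have mks : sumn (mkseq (nth 0%N s) d) = d.
  rewrite -[RHS]sumd (sumn_nth s0) sumnE big_map -{1}(subn0 d) -/(index_iota 0 d).
  by rewrite big_mkord.
have lamY : lam \in young d.
  rewrite inE lamE; apply/andP; split.
    rewrite sorted_map; apply: sub_sorted (iota_sorted 0 d) => i j ij.
    exact: nth_noninc.
  by rewrite -(big_map val xpredT id) lamE -sumnE mks.
exists lam => // i; rewrite young_row_len // lamE.
have [id|di] := ltnP i d; first by rewrite nth_mkseq.
by rewrite nth_default ?size_mkseq ?s0.
Qed.

End YoungSeq.

(** * Weights and their permutation symmetry *)

Section GenericWeights.
Variables (C : numClosedFieldType) (N n : nat).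
Variable rho : 'M[C]_N -> 'M[C]_n.

Definition polynomial_weights (d : nat) : Prop := forall mu, weight rho mu ->
  (forall i, 0 <= mu i) /\ \sum_i mu i = d%:Z.

Hypothesis rhoP : unitary_repr rho.

Lemma repr_hom : unitary_hom rho.
Proof. by case: rhoP. Qed.

Lemma torus_exponents (mu nu : 'I_N -> int) :
  (forall x : 'rV[C]_N, torus x -> \prod_i x 0 i ^ mu i = \prod_i x 0 i ^ nu i) -> mu =1 nu.
Proof.
move=> munu i; apply: (@circle_exponents_inj C) => z z1.
pose x : 'rV[C]_N := \row_k (if k == i then z else 1).
have x1 : torus x by move=> k; rewrite mxE; case: ifP; rewrite ?normr1.
have prodE (f : 'I_N -> int) : \prod_k x 0 k ^ f k = z ^ f i.
  rewrite (bigD1 i) //= mxE eqxx big1 ?mulr1 // => k /negPf ki.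
  by rewrite mxE ki exp1rz.
by rewrite -!prodE munu.
Qed.

Lemma perm_unitary (s : 'S_N) : (perm_mx s : 'M[C]_N) \is unitarymx.
Proof.
apply/unitarymxP; rewrite tr_perm_mx map_perm_mx -perm_mxM mulgV.
exact: perm_mx1.
Qed.

Lemma perm_diag (s : 'S_N) (x : 'rV[C]_N) :
  perm_mx s *m diag_mx x = diag_mx (\row_i x 0 (s i)) *m perm_mx s.
Proof.
apply/matrixP => i j; rewrite mul_diag_mx mul_mx_diag !mxE.
by case: eqP => [->|_]; rewrite ?mulr0 ?mul0r ?mulr1 ?mul1r.
Qed.

Lemma torus_perm (s : 'S_N) (x : 'rV[C]_N) : torus x -> torus (\row_i x 0 (s i)).
Proof. by move=> x1 i; rewrite mxE. Qed.

Lemma weight_perm (s : 'S_N) (mu : 'I_N -> int) :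
  weight rho mu -> weight rho (fun i => mu (s i)).
Proof.
move=> [v v0 vE]; have [_ rM] := repr_hom.
exists (v *m rho (perm_mx s^-1)) => [|x x1].
  apply: contraNneq v0 => /(congr1 (mulmx^~ (rho (perm_mx s)))) /=.
  rewrite -mulmxA -rM ?perm_unitary // -perm_mxM mulVg perm_mx1.
  by case: repr_hom => -> _; rewrite mulmx1 mul0mx => ->.
rewrite -mulmxA -rM ?perm_unitary ?diag_unitary // perm_diag.
rewrite rM ?perm_unitary ?diag_unitary //; last exact: torus_perm.
rewrite mulmxA vE; last exact: torus_perm.
rewrite -scalemxAl; congr (_ *: _).
rewrite [LHS](reindex_inj (@perm_inj _ s)); apply: eq_bigr => i _.
by rewrite mxE permK.
Qed.

Lemma trace_torus_perm (s : 'S_N) (x : 'rV[C]_N) : torus x ->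
  \tr (rho (diag_mx (\row_i x 0 (s i)))) = \tr (rho (diag_mx x)).
Proof.
move=> x1; have [r1 rM] := repr_hom.
have -> : diag_mx (\row_i x 0 (s i)) = perm_mx s *m diag_mx x *m perm_mx s^-1.
  by rewrite perm_diag -mulmxA -perm_mxM mulgV perm_mx1 mulmx1.
rewrite rM ?mul_unitarymx ?perm_unitary ?diag_unitary // mxtrace_mulC.
rewrite -rM ?mul_unitarymx ?perm_unitary ?diag_unitary //.
by rewrite mulmxA -perm_mxM mulVg perm_mx1 mul1mx.
Qed.

Lemma unitary_diagonalization (U : 'M[C]_N) : U \is unitarymx ->
  exists x, torus x /\ exists2 P, P \is unitarymx & U = invmx P *m diag_mx x *m P.
Proof.
move=> uU.
have /orthomx_spectralP UE : U \is normalmx.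
  apply/normalmxP; rewrite (unitarymxP uU) -invmx_unitary // mulVmx //.
  exact: unitarymx_unit.
move: (spectralmx U) (spectral_unitarymx U) (spectral_diag U) UE => P uP x UE.
exists x; split; last by exists P.
have : diag_mx x \is unitarymx.
  have -> : diag_mx x = P *m U *m invmx P.
    by rewrite UE !mulmxA mulmxV ?unitarymx_unit // mul1mx mulmxK ?unitarymx_unit.
  by rewrite invmx_unitary // !mul_unitarymx ?trmxC_unitary.
move=> /unitarymxP; rewrite tr_diag_mx map_diag_mx mulmx_diag => /matrixP h i.
have := h i i; rewrite !mxE eqxx !mulr1n -normCK => /eqP.
by rewrite sqrp_eq1 // => /eqP.
Qed.

Lemma trace_conj_unitary (P A : 'M[C]_N) : P \is unitarymx -> A \is unitarymx ->
  \tr (rho (invmx P *m A *m P)) = \tr (rho A).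
Proof.
move=> uP uA; have [_ rM] := repr_hom.
have uPi : invmx P \is unitarymx by rewrite invmx_unitary // trmxC_unitary.
rewrite rM ?mul_unitarymx // mxtrace_mulC -rM ?mul_unitarymx //.
by rewrite !mulmxA mulmxV ?unitarymx_unit // mul1mx.
Qed.

End GenericWeights.

Section Weights.
Variables (R : realType) (N n : nat).
Local Notation C := (complex R).
Variable rho : 'M[C]_N -> 'M[C]_n.
Hypothesis rhoP : unitary_repr rho.

Lemma weight_diagonalization : exists (P : 'M[C]_n) (mu : 'I_n -> 'I_N -> int),
  [/\ P \in unitmx, forall k, weight rho (mu k),
     (forall nu, weight rho nu -> exists k, mu k =1 nu)
   & forall x, torus x ->
     P *m rho (diag_mx x) = diag_mx (\row_k \prod_i x 0 i ^ mu k i) *m P].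
Proof.
have [P [mu [Pu PE]]] := torus_weights rhoP; exists P, mu; split=> // [k|nu [v v0 vE]].
  exists (row k P) => [|x x1].
    apply: contraTneq Pu => Pk0; rewrite unitmxE (expand_det_row _ k) big1 ?unitr0 // => j _.
    by have /rowP/(_ j) := Pk0; rewrite !mxE => ->; rewrite mul0r.
  by rewrite -row_mul PE // row_mul row_diag_mx -scalemxAl -rowE mxE.
pose w := v *m invmx P.
have /existsP[k wk] : [exists k, w 0 k != 0].
  apply: contraNT v0; rewrite negb_exists => /forallP h.
  rewrite -[v](mulmxKV Pu) -/w (_ : w = 0) ?mul0mx //.
  by apply/rowP => j; rewrite [RHS]mxE; apply/eqP; move: (h j); rewrite negbK.
exists k; apply: torus_exponents => x x1.
have := congr1 (fun u => (u *m invmx P) 0 k) (vE x x1).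
rewrite /= -{1}[v](mulmxKV Pu) -/w -[w *m P *m _]mulmxA PE // mulmxA mulmxK //.
rewrite -scalemxAl -/w => E; apply: (mulIf wk).
have wE (D : 'rV[C]_n) : (w *m diag_mx D) 0 k = D 0 k * w 0 k by rewrite mul_mx_diag mxE mulrC.
by move: E; rewrite wE [(_ *: w) 0 k]mxE mxE.
Qed.

End Weights.

Section Multiplicities.
Variables (R : realType) (N d n : nat).
Local Notation C := (complex R).
Local Notation comp := {ffun 'I_N -> 'I_d.+1}.
Implicit Types f : comp.
Variable rho : 'M[C]_N -> 'M[C]_n.
Hypothesis rhoP : unitary_repr rho.

Hypothesis rho_poly : polynomial_weights rho d.

Definition of_comp f (i : 'I_N) : int := (f i : nat)%:Z.

Lemma weight_comp mu : weight rho mu -> exists f, mu =1 of_comp f.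
Proof.
move=> /rho_poly[mu0 mud]; exists [ffun i => inord `|mu i|%N] => i.
rewrite /of_comp ffunE inordK ?gez0_abs // ltnS -lez_nat gez0_abs // -mud.
by rewrite (bigD1 i) //= lerDl sumr_ge0.
Qed.

Lemma character_multiplicities : exists m : comp -> nat,
  (forall f, (0 < m f)%N <-> weight rho (of_comp f)) /\
  forall x, torus x -> \tr (rho (diag_mx x)) = \sum_f (m f)%:R * \prod_i x 0 i ^+ f i.
Proof.
have [P [mu [Pu muW Wmu PE]]] := weight_diagonalization rhoP.
have /choice[g gE] := fun k => weight_comp (muW k).
exists (fun f => #|[set k | g k == f]|); split=> [f|x x1].
  split=> [/card_gt0P[k]|/Wmu[k kf]].
    rewrite inE => /eqP <-; have [v v0 vE] := muW k; exists v => // x x1.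
    by rewrite vE //; congr (_ *: _); apply: eq_bigr => i _; rewrite gE.
  apply/card_gt0P; exists k; rewrite inE; apply/eqP/ffunP => i; apply: val_inj.
  by have := kf i; rewrite gE /of_comp => -[].
have -> : rho (diag_mx x) = invmx P *m (P *m rho (diag_mx x)) by rewrite mulKmx.
rewrite PE // mxtrace_mulC mulmxK // mxtrace_diag (partition_big g xpredT) //=.
apply: eq_bigr => f _; rewrite -sum1dep_card natr_sum mulr_suml.
apply: eq_bigr => k /eqP <-.
by rewrite mxE mul1r; apply: eq_bigr => i _; rewrite gE.
Qed.

End Multiplicities.

(** * Triangularity with respect to dominance *)

Section Compositions.
Variables (N d : nat).
Hypothesis dN : (d <= N)%N.
Local Notation comp := {ffun 'I_N -> 'I_d.+1}.
Local Notation Y := (d.-tuple 'I_d.+1).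
Implicit Types (f g : comp) (lam mu : Y) (s : 'S_N).

Definition comp_perm f s : comp := [ffun i => f (s i)].
Definition hat lam : comp := [ffun i : 'I_N => inord (row_len lam i)].
Definition psum_row lam (k : nat) := (\sum_(i < N | (i < k)%N) row_len lam i)%N.

Lemma row_len_le lam i : lam \in young d -> (row_len lam i <= d)%N.
Proof. by move=> lY; rewrite -[leqRHS](sumn_rows lY); exact: nth_le_sumn. Qed.

Lemma hatE lam i : lam \in young d -> hat lam i = row_len lam i :> nat.
Proof. by move=> lY; rewrite ffunE inordK // ltnS row_len_le. Qed.

Lemma row_len_ge_d lam i : lam \in young d -> (d <= i)%N -> row_len lam i = 0%N.
Proof.
move=> lY di; apply/eqP; rewrite -leqn0 leqNgt; apply/negP.
by move/(sorted_nth_pos (sorted_rows lY)); rewrite (sumn_rows lY) ltnNge di.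
Qed.

Lemma sum_row_len lam : lam \in young d -> (\sum_(i < N) row_len lam i)%N = d.
Proof.
move=> lY; rewrite -[RHS](sumn_rows lY) (@sumn_nth _ N) // => i Ni.
exact: row_len_ge_d lY (leq_trans dN Ni).
Qed.

Lemma comp_sort f : (\sum_i f i)%N = d ->
  exists s lam, lam \in young d /\ comp_perm f s = hat lam.
Proof.
move=> fd; pose t : N.-tuple nat := [tuple (f i : nat) | i < N].
have : perm_eq (sort geq t) t by rewrite perm_sort.
move=> /tuple_permP[s sE].
have ss : sorted geq (sort geq t) by apply: sort_sorted => a b; exact: leq_total.
have [|lam lY lamE] := young_of_seq (d := d) ss.
  rewrite sumnE (perm_big _ (permEl (perm_sort _ _))) /= big_map -[RHS]fd.
  by rewrite big_enum.
exists s, lam; split=> //; apply/ffunP => i; apply: val_inj; rewrite [RHS]hatE // lamE sE.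
by rewrite (nth_map i) ?size_enum_ord // nth_ord_enum ffunE tnth_mktuple.
Qed.

Lemma psum_row_inj lam mu : lam \in young d -> mu \in young d ->
  (forall k, (k <= N)%N -> psum_row lam k = psum_row mu k) -> lam = mu.
Proof.
move=> lY mY h; apply: young_inj => // i.
have [iN|Ni] := ltnP i N; last by rewrite !row_len_ge_d // (leq_trans dN).
have psumS (nu : Y) : psum_row nu i.+1 = (psum_row nu i + row_len nu i)%N.
  rewrite /psum_row (bigD1 (Ordinal iN)) //= addnC; congr (_ + _)%N.
  by apply: eq_bigl => j; rewrite ltnS -val_eqE /= ltn_neqAle andbC.
by apply: (@addnI (psum_row lam i)); rewrite -psumS [in RHS]h ?(ltnW iN) // -psumS h.
Qed.

(** A numerical function strictly increasing for dominance, which makes triangular elimination an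
    induction on natural numbers. *)
Definition dominance_key lam := (\sum_(k < N.+1) psum_row lam k)%N.

Lemma dominance_key_le lam mu : (forall k, psum_row mu k <= psum_row lam k)%N ->
  (dominance_key mu <= dominance_key lam)%N.
Proof. by move=> h; apply: leq_sum. Qed.

Lemma dominance_key_eq lam mu : lam \in young d -> mu \in young d ->
    (forall k, psum_row mu k <= psum_row lam k)%N ->
  dominance_key mu = dominance_key lam -> mu = lam.
Proof.
move=> lY mY h kE; apply: psum_row_inj => // k kN.
have [_] := leqif_sum (P := xpredT) (fun (k : 'I_N.+1) _ => leqif_eq (h k)).
rewrite [LHS](_ : _ = true); last by rewrite -/(dominance_key mu) kE eqxx.
by move/esym/forallP/(_ (Ordinal (kN : (k < N.+1)%N)))/eqP.
Qed.

Section Triangular.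
Variables (C : numFieldType) (M_ : Y -> comp -> nat).
Hypothesis M_sym : forall lam f s, lam \in young d -> M_ lam (comp_perm f s) = M_ lam f.
Hypothesis M_diag : forall lam, lam \in young d -> (0 < M_ lam (hat lam))%N.
Hypothesis M_dom : forall lam mu, lam \in young d -> mu \in young d ->
  (0 < M_ lam (hat mu))%N -> forall k, (psum_row mu k <= psum_row lam k)%N.
Hypothesis M_sum : forall lam f, lam \in young d -> (0 < M_ lam f)%N -> (\sum_i f i)%N = d.

(** Eliminate diagrams by decreasing [dominance_key]. Since [M_ lam] reaches only diagrams dominated
    by [lam], those of key [K] disturb neither each other nor the larger keys. *)
Lemma triangular_span (M : comp -> C) :
    (forall f s, M (comp_perm f s) = M f) -> (forall f, M f != 0 -> (\sum_i f i)%N = d) ->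
  exists c : Y -> C, forall f, M f = \sum_(lam in young d) c lam * (M_ lam f)%:R.
Proof.
(* [B] exceeds every key, so the vanishing assumption is empty at the start. *)
move=> Msym Msum; pose B := (\sum_(lam in young d) dominance_key lam).+1.
have : forall mu, mu \in young d -> (B <= dominance_key mu)%N -> M (hat mu) = 0.
  move=> mu mY; rewrite /B (bigD1 mu) //= ltnNge => /negP[].
  exact: leq_addr.
move: {-1}B (leqnn B) => K _; elim: K M Msym Msum => [|K IH] M Msym Msum M0.
  exists (fun _ => 0) => f; rewrite big1 => [|lam _]; last by rewrite mul0r.
  apply/eqP; apply: contraT => Mf; have [s [lam [lY fE]]] := comp_sort (Msum f Mf).
  by rewrite -(Msym f s) fE M0 ?eqxx in Mf.
pose c lam := if dominance_key lam == K then M (hat lam) / (M_ lam (hat lam))%:R else 0.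
have [||mu mY Kmu|c' c'E] := IH (fun f => M f - \sum_(lam in young d) c lam * (M_ lam f)%:R).
- by move=> f s; rewrite Msym; congr (_ - _); apply: eq_bigr => lam lY; rewrite M_sym.
- move=> f; have [->|/Msum//] := eqVneq (M f) 0.
  rewrite sub0r oppr_eq0 => s0.
  have /existsP[lam /andP[lY Mlam]] : [exists lam, (lam \in young d) && (0 < M_ lam f)%N].
    apply: contraNT s0; rewrite negb_exists => /forallP h; rewrite big1 // => lam lY.
    by have := h lam; rewrite lY /= lt0n negbK => /eqP ->; rewrite mulr0.
  exact: M_sum lY Mlam.
- have others lam : lam \in young d -> lam != mu -> c lam * (M_ lam (hat mu))%:R = 0.
    move=> lY lmu; rewrite /c; case: eqP => [lK|_]; last by rewrite mul0r.
    have [->|Mlam] := posnP (M_ lam (hat mu)); first by rewrite mulr0.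
    have dom := M_dom lY mY Mlam; case/eqP: lmu; apply/esym/dominance_key_eq => //.
    by apply/eqP; rewrite eqn_leq dominance_key_le // lK.
  rewrite (bigD1 mu) //= big1 ?addr0 => [|lam /andP[lY lmu]]; last exact: others.
  rewrite /c; move: Kmu; rewrite leq_eqVlt => /predU1P[<-|Kmu].
    by rewrite eqxx divfK ?subrr // pnatr_eq0 -lt0n M_diag.
  by rewrite gtn_eqF // mul0r subr0 M0.
exists (fun lam => c lam + c' lam) => f; under eq_bigr do rewrite mulrDl.
by rewrite big_split /= -c'E addrC subrK.
Qed.

End Triangular.
End Compositions.

Section SymmetricMultiplicities.
Variables (R : realType) (N d n : nat).
Local Notation C := (complex R).
Local Notation comp := {ffun 'I_N -> 'I_d.+1}.
Implicit Types f : comp.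
Variable rho : 'M[C]_N -> 'M[C]_n.
Hypotheses (rhoP : unitary_repr rho) (rho_poly : polynomial_weights rho d).

Lemma weight_comp_perm f (s : 'S_N) :
  weight rho (of_comp f) <-> weight rho (of_comp (comp_perm f s)).
Proof.
have ext mu nu : mu =1 nu -> weight rho mu -> weight rho nu.
  move=> mn [v v0 vE]; exists v => // x x1; rewrite vE //; congr (_ *: _).
  by apply: eq_bigr => i _; rewrite mn.
split=> [/(weight_perm rhoP s)|/(weight_perm rhoP s^-1)]; apply: ext => i.
  by rewrite /of_comp ffunE.
by rewrite /of_comp ffunE permKV.
Qed.

(** Summing over all rearrangements makes the symmetry of [M] immediate, at the price of the factor
    [N!]; no independence of monomials on the torus is invoked. *)
Lemma symmetric_multiplicities : exists M : comp -> nat,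
  [/\ forall f s, M (comp_perm f s) = M f,
      forall f, (0 < M f)%N <-> weight rho (of_comp f)
    & forall x, torus x ->
      N`!%:R * \tr (rho (diag_mx x)) = \sum_f (M f)%:R * \prod_i x 0 i ^+ f i].
Proof.
have [m [mW mtr]] := character_multiplicities rhoP rho_poly.
exists (fun f => \sum_(s : 'S_N) m (comp_perm f s))%N; split.
- move=> f s; rewrite [RHS](reindex_inj (mulIg s)) /=; apply: eq_bigr => t _.
  by congr (m _); apply/ffunP => i; rewrite !ffunE permM.
- move=> f; split=> [|fW].
    rewrite lt0n sum_nat_eq0 negb_forall => /existsP[s]; rewrite -lt0n => /mW.
    exact: (weight_comp_perm f s).2.
  rewrite (bigD1 1%g) //= addn_gt0; apply/orP; left; apply/mW.
  exact: (weight_comp_perm f 1%g).1.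
move=> x x1; transitivity (\sum_(s : 'S_N) \tr (rho (diag_mx (\row_i x 0 (s i))))).
  rewrite (eq_bigr (fun _ => \tr (rho (diag_mx x)))) => [|s _]; last exact: trace_torus_perm.
  by rewrite sumr_const (card_Sn N) -[RHS]mulr_natl.
rewrite (eq_bigr (fun s : 'S_N => \sum_f (m f)%:R * \prod_i (\row_k x 0 (s k)) 0 i ^+ f i)) => [|s _]; last by apply: mtr; exact: torus_perm.
under [RHS]eq_bigr do rewrite natr_sum mulr_suml.
rewrite [RHS]exchange_big /=; apply: eq_bigr => s _.
pose h f := comp_perm f s.
rewrite (reindex h) /=; last first.
  by exists (fun f => comp_perm f s^-1) => f _; apply/ffunP => i; rewrite !ffunE ?permK ?permKV.
apply: eq_bigr => f _; congr (_ * _); rewrite [RHS](reindex_inj (@perm_inj _ s)).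
by apply: eq_bigr => i _; rewrite mxE ffunE.
Qed.

End SymmetricMultiplicities.

Section HighestWeightReps.
Variables (R : realType) (N d : nat).
Hypothesis dN : (d <= N)%N.
Local Notation C := (complex R).
Local Notation Y := (d.-tuple 'I_d.+1).
Implicit Types (lam mu : Y).

Definition wt lam : 'I_N -> int := fun i => (row_len lam i)%:Z.

Lemma sum_posz (P : pred 'I_N) (f : 'I_N -> nat) :
  \sum_(i | P i) (f i)%:Z = (\sum_(i | P i) f i)%N%:Z.
Proof. by rewrite (big_morph Posz PoszD (erefl 0)). Qed.

Lemma highest_weight_polynomial n (rho : 'M[C]_N -> 'M[C]_n) lam :
  lam \in young d -> unitary_repr rho -> highest_weight rho (wt lam) ->
  polynomial_weights rho d.
Proof.
move=> lY rhoP [_ hw] mu muW; have sum_mu nu : weight rho nu -> \sum_i nu i = d%:Z.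
  by move=> /hw[_ ->]; rewrite sum_posz sum_row_len.
split=> [i|]; last exact: sum_mu.
have N0 : (0 < N)%N by apply: leq_ltn_trans (ltn_ord i).
have lN : (N.-1 < N)%N by rewrite prednK.
(* Exchanging the coordinate [i] with the last one turns its nonnegativity into the dominance bound
   on the first [N - 1] coordinates, as the totals agree. *)
pose last := Ordinal lN; pose nu k := mu (tperm i last k).
have nuW : weight rho nu := weight_perm rhoP (tperm i last) muW.
have splitE (f : 'I_N -> int) : \sum_k f k = f last + \sum_(k < N | (k < N.-1)%N) f k.
  rewrite (bigD1 last) //=; congr (_ + _); apply: eq_bigl => k.
  by rewrite -val_eqE /= ltn_neqAle -ltnS prednK // ltn_ord andbT.
have [/(_ N.-1) le_part tot] := hw nu nuW.
have <- : nu last = mu i by rewrite /nu tpermR.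
move: tot; rewrite !splitE => tot; have last0 : 0 <= wt lam last by [].
rewrite -[nu last](addrK (\sum_(k < N | (k < N.-1)%N) nu k)) tot -addrA addr_ge0 //.
by rewrite subr_ge0.
Qed.

End HighestWeightReps.

(** * Finite Fourier projections onto weight spaces *)

Section Fourier.
Variables (C : numClosedFieldType) (N n m : nat) (z : C).
Hypothesis zP : m.-primitive_root z.
Hypothesis z1 : `|z| = 1.
Implicit Types f g : 'I_N -> nat.

Lemma fourier_delta f g : (forall i, (f i < m)%N) -> (forall i, (g i < m)%N) ->
  \sum_(J : {ffun 'I_N -> 'I_m}) \prod_i (z ^+ g i / z ^+ f i) ^+ J i =
  if [forall i, g i == f i] then m%:R ^+ N else 0.
Proof.
move=> fm gm; have z0 : z != 0 by rewrite -normr_eq0 z1 oner_eq0.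
rewrite -(bigA_distr_bigA (fun i (j : 'I_m) => (z ^+ g i / z ^+ f i) ^+ j)).
have [/forallP gf|] := boolP [forall i, g i == f i].
  rewrite -[N in RHS]card_ord -prodr_const; apply: eq_bigr => i _.
  rewrite (eqP (gf i)) mulfV ?expf_neq0 // (eq_bigr (fun _ => 1)) => [|j _]; last by rewrite expr1n.
  by rewrite sumr_const card_ord.
rewrite negb_forall => /existsP[i gfi]; rewrite (bigD1 i) //=.
set w := z ^+ g i / z ^+ f i.
have w1 : w != 1.
  apply: contra gfi => /eqP w1; have : z ^+ g i = z ^+ f i.
    by rewrite -[LHS](divfK (expf_neq0 (f i) z0)) -/w w1 mul1r.
  by move/eqP; rewrite (eq_prim_root_expr zP) !modn_small.
have : (w - 1) * \sum_(j < m) w ^+ j = 0.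
  rewrite -subrX1 /w exprMn exprVn -!exprM !(mulnC _ m) !exprM (prim_expr_order zP).
  by rewrite !expr1n invr1 mulr1 subrr.
by move/eqP; rewrite mulf_eq0 subr_eq0 (negPf w1) => /eqP ->; rewrite mul0r.
Qed.

(** Up to the factor [m ^ N], the projection onto the weight [f]: a sum over the [m]-torsion of the
    torus in place of an integral. *)
Definition fourier f : seq (C * 'M[C]_N) :=
  [seq (\prod_i (z ^+ f i)^-1 ^+ (J : {ffun 'I_N -> 'I_m}) i, diag_mx (\row_i z ^+ J i))
     | J <- enum {ffun 'I_N -> 'I_m}].

Lemma torus_zpow (J : {ffun 'I_N -> 'I_m}) : torus (\row_i z ^+ J i).
Proof. by move=> i; rewrite mxE normrX z1 expr1n. Qed.

Lemma galg_fourier f : galg (fourier f).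
Proof. by apply/allP => _ /mapP[J _ ->]; apply: diag_unitary; exact: torus_zpow. Qed.

Lemma ev_fourier (rho : 'M[C]_N -> 'M[C]_n) (P : 'M[C]_n) (g : 'I_n -> 'I_N -> nat) f :
    (forall x, torus x ->
      P *m rho (diag_mx x) = diag_mx (\row_k \prod_i x 0 i ^+ g k i) *m P) ->
    (forall i, (f i < m)%N) -> (forall k i, (g k i < m)%N) ->
  P *m ev rho (fourier f) =
    diag_mx (\row_k if [forall i, g k i == f i] then m%:R ^+ N else 0) *m P.
Proof.
move=> PE fm gm; rewrite /ev big_map big_enum /= mulmx_sumr.
under eq_bigr => J _ do rewrite -scalemxAr (PE _ (torus_zpow J)) scalemxAl.
rewrite -mulmx_suml; congr (_ *m P); apply/matrixP => k l; rewrite summxE [RHS]mxE.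
have [<-|kl] := eqVneq k l; last first.
  by rewrite mulr0n big1 // => J _; rewrite !mxE (negPf kl) mulr0n mulr0.
rewrite mulr1n mxE -(fourier_delta fm (gm k)); apply: eq_bigr => J _.
rewrite !mxE eqxx mulr1n -big_split; apply: eq_bigr => i _ /=.
by rewrite mxE exprMn mulrC -!exprM mulnC.
Qed.

End Fourier.

Section WeightSeparation.
Variables (R : realType) (N d : nat).
Hypothesis dN : (d <= N)%N.
Local Notation C := (complex R).
Local Notation Y := (d.-tuple 'I_d.+1).
Local Notation comp := {ffun 'I_N -> 'I_d.+1}.
Implicit Types (lam mu : Y).

Lemma separated_by_weight n m (rho : 'M[C]_N -> 'M[C]_n) (sigma : 'M[C]_N -> 'M[C]_m) (f : comp) :
    unitary_repr rho -> unitary_repr sigma -> unitary_irreducible rho ->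
    polynomial_weights rho d -> polynomial_weights sigma d ->
    weight rho (of_comp f) -> ~ weight sigma (of_comp f) ->
  separated rho sigma.
Proof.
move=> rhoP sigmaP rhoI rho_poly sigma_poly fr fs.
(* The entries of the weights are at most [d < 2 ^ d], so the torsion of order [2 ^ d] tells them
   apart. *)
pose z := zeta R d; pose f' i : nat := f i.
have zP := zeta_prim R d; have z1 := norm_zeta R d.
have ltm (g : comp) i : (g i < 2 ^ d)%N by apply: leq_ltn_trans (ltn_expl d (ltnSn 1)); rewrite -ltnS.
have diagE k (tau : 'M[C]_N -> 'M[C]_k) : unitary_repr tau -> polynomial_weights tau d ->
    exists (P : 'M[C]_k) (g : 'I_k -> comp), [/\ P \in unitmx,
      (weight tau (of_comp f) <-> exists l, g l = f)
      & P *m ev tau (fourier (2 ^ d) z f') =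
        diag_mx (\row_l if [forall i, (g l i : nat) == f' i] then (2 ^ d)%:R ^+ N else 0) *m P].
  move=> tauP tau_poly; have [P [mu [Pu muW Wmu PE]]] := weight_diagonalization tauP.
  have /choice[g gE] := fun l => weight_comp tau_poly (muW l).
  exists P, g; split=> //.
    split=> [/Wmu[l lf]|[l <-]].
      exists l; apply/ffunP => i; apply: val_inj.
      by have := lf i; rewrite gE /of_comp => -[].
    have [v v0 vE] := muW l; exists v => // x x1.
    by rewrite vE //; congr (_ *: _); apply: eq_bigr => i _; rewrite gE.
  apply: (ev_fourier zP z1 (g := fun l i => g l i)) => [x x1|i|l i]; try exact: ltm.
  rewrite PE //; congr (diag_mx _ *m _); apply/rowP => l; rewrite !mxE.
  by apply: eq_bigr => i _; rewrite gE.
have [P [g [Pu gW PE]]] := diagE _ rho rhoP rho_poly.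
have [Q [h [Qu hW QE]]] := diagE _ sigma sigmaP sigma_poly.
apply: (separatedP (repr_hom rhoP) (repr_hom sigmaP) rhoI (a := fourier (2 ^ d) z f')).
- exact: galg_fourier.
- have [l lf] := gW.1 fr; apply/eqP => e0; move: PE; rewrite e0 mulmx0.
  move=> /(congr1 (mulmx^~ (invmx P))) /=; rewrite mul0mx mulmxK // => /matrixP/(_ l l).
  rewrite !mxE eqxx mulr1n ifT; last by apply/forallP => i; rewrite lf.
  by move/esym/eqP; rewrite expf_eq0 pnatr_eq0 expn_eq0 andbF.
rewrite -[ev _ _](mulKmx Qu) QE (_ : \row_l _ = 0) ?linear0 ?mul0mx ?mulmx0 //.
apply/rowP => l; rewrite !mxE ifF //; apply/forallP => hl; apply: fs; apply/hW.
by exists l; apply/ffunP => i; apply: val_inj; exact: (eqP (hl i)).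
Qed.

End WeightSeparation.

Lemma eq_weight (C : numClosedFieldType) (N n : nat) (rho : 'M[C]_N -> 'M[C]_n) mu nu :
  mu =1 nu -> weight rho mu -> weight rho nu.
Proof.
move=> mn [v v0 vE]; exists v => // x x1; rewrite vE //; congr (_ *: _).
by apply: eq_bigr => i _; rewrite mn.
Qed.

Lemma trace_ev_eq (C : numClosedFieldType) (N n : nat) (I : Type) (s : seq I) (P : pred I) (k : I -> nat)
    (rho : 'M[C]_N -> 'M[C]_n) (sigma : forall i, 'M[C]_N -> 'M[C]_(k i)) (c : I -> C) a :
    {in unitarymx, forall U, \tr (rho U) = \sum_(i <- s | P i) c i * \tr (sigma i U)} ->
  galg a -> \tr (ev rho a) = \sum_(i <- s | P i) c i * \tr (ev (sigma i) a).
Proof.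
move=> tr_eq /allP ga; rewrite /ev raddf_sum /=.
rewrite [RHS](eq_bigr (fun i => \sum_(p <- a) p.1 * (c i * \tr (sigma i p.2)))) => [|i _].
  rewrite [RHS]exchange_big /= big_seq [RHS]big_seq; apply: eq_bigr => p pa.
  by rewrite mxtraceZ tr_eq ?ga // mulr_sumr.
rewrite raddf_sum mulr_sumr; apply: eq_bigr => p _.
by rewrite /= mxtraceZ mulrCA.
Qed.

(** * Characters determined by their highest weight *)

Section HighestWeightCharacters.
Variables (R : realType) (N d : nat).
Hypothesis dN : (d <= N)%N.
Local Notation C := (complex R).
Local Notation Y := (d.-tuple 'I_d.+1).
Local Notation comp := {ffun 'I_N -> 'I_d.+1}.
Implicit Types (lam mu : Y).

Variables (rk : Y -> nat) (rho : forall lam, 'M[C]_N -> 'M[C]_(rk lam)).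
Hypothesis rhoP : forall lam, lam \in young d -> unitary_repr (rho lam).
Hypothesis rhoI : forall lam, lam \in young d -> unitary_irreducible (rho lam).
Hypothesis rho_hw : forall lam, lam \in young d -> highest_weight (rho lam) (@wt N d lam).

Lemma of_comp_hat lam : lam \in young d -> of_comp (hat N lam) =1 wt lam.
Proof. by move=> lY i; rewrite /of_comp hatE. Qed.

Lemma weight_le_psum_row n (sigma : 'M[C]_N -> 'M[C]_n) lam mu : mu \in young d ->
    highest_weight sigma (wt lam) -> weight sigma (of_comp (hat N mu)) ->
  forall k, (psum_row N mu k <= psum_row N lam k)%N.
Proof.
move=> mY [_ hw] /(eq_weight (of_comp_hat mY))/hw[h _] k.
by have := h k; rewrite !sum_posz lez_nat.
Qed.

(** Unitary matrices are conjugate to elements of the torus, where triangular elimination applies to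
    the weight multiplicities. *)
Lemma character_span n (sigma : 'M[C]_N -> 'M[C]_n) :
    unitary_repr sigma -> polynomial_weights sigma d ->
  exists c : Y -> C, {in unitarymx, forall U,
    \tr (sigma U) = \sum_(lam in young d) c lam * \tr (rho lam U)}.
Proof.
move=> sigmaP sigma_poly.
have rho_poly lam (lY : lam \in young d) := highest_weight_polynomial dN lY (rhoP lY) (rho_hw lY).
have /choice[M ME] : forall lam, exists M : comp -> nat, lam \in young d ->
    [/\ forall f s, M (comp_perm f s) = M f,
      forall f, (0 < M f)%N <-> weight (rho lam) (of_comp f)
    & forall x, torus x ->
      N`!%:R * \tr (rho lam (diag_mx x)) = \sum_f (M f)%:R * \prod_i x 0 i ^+ f i].
  move=> lam; have [lY|lY] := boolP (lam \in young d); last by exists (fun=> 0%N).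
  by have [M MP] := symmetric_multiplicities (rhoP lY) (rho_poly lam lY); exists M.
have [S [Ssym SW Str]] := symmetric_multiplicities sigmaP sigma_poly.
have sum_comp k (tau : 'M[C]_N -> 'M[C]_k) (f : comp) : polynomial_weights tau d ->
    weight tau (of_comp f) -> (\sum_i f i)%N = d.
  move=> tau_poly /tau_poly[_]; rewrite /of_comp sum_posz.
  by move=> [].
have [||||f s|f Sf|c cE] := @triangular_span N d dN C M _ _ _ _ (fun f => (S f)%:R).
- by move=> lam f s /ME[h _ _]; exact: h.
- move=> lam lY; have [_ h _] := ME lam lY; apply/h.
  by apply: eq_weight (proj1 (rho_hw lY)) => i; rewrite of_comp_hat.
- move=> lam mu lY mY; have [_ h _] := ME lam lY.
  by move/h; apply: weight_le_psum_row => //; exact: rho_hw.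
- move=> lam f lY; have [_ h _] := ME lam lY.
  by move/h; exact: sum_comp (rho_poly lam lY).
- by rewrite Ssym.
- apply: (sum_comp _ sigma _ sigma_poly); apply/SW.
  by rewrite lt0n -(pnatr_eq0 C).
exists c => U uU; have [x [x1 [P uP ->]]] := unitary_diagonalization uU.
have uD := diag_unitary x1.
rewrite trace_conj_unitary // (eq_bigr (fun lam => c lam * \tr (rho lam (diag_mx x)))) => [|lam lY]; last first.
  by rewrite trace_conj_unitary //; exact: rhoP.
have N0 : (N`!%:R : C) != 0 by rewrite pnatr_eq0 -lt0n fact_gt0.
apply: (mulfI N0); rewrite Str // mulr_sumr.
rewrite [RHS](eq_bigr (fun lam => \sum_f c lam * (M lam f)%:R * \prod_i x 0 i ^+ f i)) => [|lam lY]; last first.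
  have [_ _ h] := ME lam lY; rewrite mulrCA h // mulr_sumr.
  by apply: eq_bigr => f _; rewrite mulrA.
rewrite exchange_big /=; apply: eq_bigr => f _; rewrite cE mulr_suml.
by [].
Qed.

(** If each representation had the highest weight of the other, dominance both ways would give
    [lam = mu]. So one has a weight that the other lacks, and separation is symmetric. *)
Lemma separated_family n (sigma : 'M[C]_N -> 'M[C]_n) lam mu :
    lam \in young d -> mu \in young d -> mu != lam ->
    unitary_repr sigma -> unitary_irreducible sigma -> highest_weight sigma (wt lam) ->
  separated sigma (rho mu).
Proof.
move=> lY mY ml sigmaP sigmaI sigma_hw.
have s_poly := highest_weight_polynomial dN lY sigmaP sigma_hw.
have m_poly := highest_weight_polynomial dN mY (rhoP mY) (rho_hw mY).
have lW : weight sigma (of_comp (hat N lam)).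
  by apply: eq_weight (proj1 sigma_hw) => i; rewrite of_comp_hat.
have mW : weight (rho mu) (of_comp (hat N mu)).
  by apply: eq_weight (proj1 (rho_hw mY)) => i; rewrite of_comp_hat.
have [lam_mu|] := pselect (weight (rho mu) (of_comp (hat N lam))); last first.
  by apply: separated_by_weight => //; exact: rhoP.
have [mu_lam|nmu] := pselect (weight sigma (of_comp (hat N mu))).
  case/eqP: ml; apply: (psum_row_inj dN) => // k _; apply/eqP; rewrite eqn_leq.
  rewrite (weight_le_psum_row mY sigma_hw mu_lam).
  by rewrite (weight_le_psum_row lY (rho_hw mY) lam_mu).
apply: separated_sym; [exact: repr_hom (rhoP mY) | exact: repr_hom sigmaP |].
by apply: separated_by_weight mW nmu => //; [exact: rhoP | exact: rhoI].
Qed.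

Lemma family_unit n (sigma : 'M[C]_N -> 'M[C]_n) lam : lam \in young d ->
    unitary_repr sigma -> unitary_irreducible sigma -> highest_weight sigma (wt lam) ->
  exists a, [/\ galg a, ev sigma a = 1%:M
    & forall mu, mu \in young d -> mu != lam -> ev (rho mu) a = 0].
Proof.
move=> lY sigmaP sigmaI sigma_hw.
have inE' mu : mu \in [seq mu <- enum (young d) | mu != lam] = (mu != lam) && (mu \in young d).
  by rewrite mem_filter mem_enum.
have [||a [ga sa ra]] := @separated_seq C N n sigma Y rk rho [seq mu <- enum (young d) | mu != lam] (repr_hom sigmaP).
- by move=> mu; rewrite inE' => /andP[_ mY]; exact: repr_hom (rhoP mY).
- by move=> mu; rewrite inE' => /andP[ml mY]; apply: (@separated_family _ _ lam).
by exists a; split=> // mu mY ml; apply: ra; rewrite inE' ml.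
Qed.

(* The character of [sigma] is a combination of the characters of the family;  *)
(* an element acting as 1 through [sigma] and as 0 through all other members   *)
(* shows that only that of [lam] occurs, and proportional irreducible          *)
(* characters are equal.                                                       *)
Theorem character_unique n (sigma : 'M[C]_N -> 'M[C]_n) lam : lam \in young d ->
    unitary_repr sigma -> unitary_irreducible sigma -> highest_weight sigma (wt lam) ->
  {in unitarymx, forall U, \tr (sigma U) = \tr (rho lam U)}.
Proof.
move=> lY sigmaP sigmaI sigma_hw.
have [c cE] := character_span sigmaP (highest_weight_polynomial dN lY sigmaP sigma_hw).
have [a [ga sa ra]] := family_unit lY sigmaP sigmaI sigma_hw.
(* The action of [a] is known through [sigma] and that of [b] through [rho lam]; evaluation at the
   product [U a b] links the two. *)
have [b [gb rb rb0]] := family_unit lY (rhoP lY) (rhoI lY) (rho_hw lY).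
have sH := repr_hom sigmaP; have rH mu (mY : mu \in young d) := repr_hom (rhoP mY).
have trE e : galg e -> \tr (ev sigma e) = \sum_(mu in young d) c mu * \tr (ev (rho mu) e).
  by move=> ge; apply: (trace_ev_eq (sigma := rho)).
apply: (proportional_characters (c := c lam) (rH lam lY) sH (rhoI lY) sigmaI) => U uU.
have gU := galg1 uU.
have only e : galg e -> (forall mu, mu \in young d -> mu != lam -> ev (rho mu) e = 0) ->
    \tr (ev sigma e) = c lam * \tr (ev (rho lam) e).
  move=> ge e0; rewrite trE // (bigD1 lam) //= big1 ?addr0 // => mu /andP[mY ml].
  by rewrite e0 // mxtrace0 mulr0.
have sUa : \tr (sigma U) = c lam * \tr (rho lam U *m ev (rho lam) a).
  rewrite -[sigma U]mulmx1 -sa -(ev1 sigma) -(ev1 (rho lam)).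
  rewrite -(ev_mul sH) // -(ev_mul (rH lam lY)) //; apply: only; first exact: galg_mul.
  by move=> mu mY ml; rewrite (ev_mul (rH mu mY)) // ra // mulmx0.
have sUb : \tr (sigma U *m ev sigma b) = c lam * \tr (rho lam U).
  rewrite -[rho lam U]mulmx1 -rb -(ev1 sigma) -(ev1 (rho lam)).
  rewrite -(ev_mul sH) // -(ev_mul (rH lam lY)) //; apply: only; first exact: galg_mul.
  by move=> mu mY ml; rewrite (ev_mul (rH mu mY)) // rb0 // mulmx0.
rewrite -sUb sUa -[rho lam U *m ev _ a]mulmx1 -rb -[ev sigma b]mul1mx -sa mulmxA.
rewrite -(ev1 sigma) -(ev1 (rho lam)) -!(ev_mul sH) ?galg_mul // -!(ev_mul (rH lam lY)) ?galg_mul //.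
apply/esym/only; first by rewrite !galg_mul.
by move=> mu mY ml; rewrite !(ev_mul (rH mu mY)) ?galg_mul // rb0 // mulmx0.
Qed.

(** [schur] selects an arbitrary irreducible character: the family shows that the selection
    succeeds, and uniqueness identifies the result. *)
Lemma schurE lam : lam \in young d -> {in unitarymx, forall U, schur lam U = \tr (rho lam U)}.
Proof.
move=> lY U uU; rewrite /schur.
have : irr_character (wt lam) (fun U : 'M[C]_N => \tr (rho lam U)).
  by exists (rk lam), (rho lam); split=> //; [exact: rhoP|exact: rhoI|exact: rho_hw].
case: xgetP => [chi -> [n [sigma [sP sI shw sE]]] _|/(_ (fun U => \tr (rho lam U)))//].
by rewrite sE // (character_unique lY).
Qed.

End HighestWeightCharacters.

(** * The trace identity *)

Section GenericTensor.
Variables (C : numClosedFieldType) (N d : nat).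
Local Notation dimE := #|{: {ffun 'I_d -> 'I_N}}|.
Local Notation inA := (@inA C N d).

Lemma tens_repr : unitary_repr (@tens C N d).
Proof.
have [t1 tM] := tens_hom C N d; split=> //.
apply: continuous_subspaceT => U.
have -> : @tens C N d = fun U => 1%:M *m tens d U *m 1%:M.
  by apply/funext => V; rewrite mul1mx mulmx1.
exact: tens_mul_continuous.
Qed.

Lemma tens_polynomial : polynomial_weights (@tens C N d) d.
Proof.
move=> mu [v v0 vP].
have /existsP[j vj] : [exists j, v 0 j != 0].
  apply: contraNT v0; rewrite negb_exists => /forallP h.
  by apply/eqP/rowP => j; rewrite [RHS]mxE; apply/eqP; move: (h j); rewrite negbK.
move: vj; rewrite -(enum_valK j); move: (enum_val j) => J vJ {j}.
have muE : mu =1 fun i => (content J i)%:Z.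
  apply: (@torus_exponents C) => x x1.
  have := congr1 (fun u : 'rV_dimE => u 0 (enum_rank J)) (vP x x1).
  by rewrite /= tens_diag_row [(_ *: v) 0 _]mxE mulrC => /(mulIf vJ).
split=> [i|]; first by rewrite muE.
by rewrite (eq_bigr _ (fun i _ => muE i)) sum_posz sum_content.
Qed.

(** The sum of the transpositions is an affine function of the Casimir element. *)
Lemma inA_transp : inA (transp_mx C N d).
Proof.
have -> : transp_mx C N d = 2^-1 *: (casimir_mx C N d + (- (d * N)%:R) *: 1%:M).
  by rewrite casimir_mxE scaleNr scalemx1 addrC addKr scalerA mulVf ?scale1r //.
by apply/inAZ/inAD; [exact: inA_casimir | apply: inAZ; exact: inA1].
Qed.

Lemma inAX Y k : inA Y -> inA (Y ^+ k).
Proof.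
move=> AY; elim: k => [|k IH]; first exact: inA1.
by rewrite exprS; apply: inAM.
Qed.

Lemma trace_adj_eq0 (Y : 'M[C]_dimE) : \tr (Y *m (Y^t*)%sesqui) = 0 -> Y = 0.
Proof.
have trE : \tr (Y *m (Y^t*)%sesqui) = \sum_i \sum_j `|Y i j| ^+ 2.
  apply: eq_bigr => i _; rewrite mxE; apply: eq_bigr => j _.
  by rewrite !mxE normCK.
rewrite trE => /eqP; rewrite psumr_eq0 => [/allP h|i _]; last first.
  by rewrite sumr_ge0 // => j _; rewrite exprn_ge0.
apply/matrixP => i j; rewrite mxE; have /eqP := h i (mem_index_enum _).
move=> /eqP; rewrite psumr_eq0 => [/allP/(_ j (mem_index_enum _))|k _]; last exact: exprn_ge0.
by rewrite /= expf_eq0 normr_eq0 => /eqP.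
Qed.

(** Both sides are the trace of [Y |-> x *m symmetrize Y *m y] on all matrices; each permutation
    contributes a product of two traces. *)
Lemma symmetrized_trace (x y : 'M[C]_dimE) :
  \sum_k \sum_l (x *m symmetrize (delta_mx k l) *m y) k l =
  d`!%:R^-1 * \sum_(s : 'S_d) \tr (x *m permw C N s^-1) * \tr (permw C N s *m y).
Proof.
have unit_entry (A B : 'M[C]_dimE) k l : (A *m delta_mx k l *m B) k l = A k k * B l l.
  rewrite mxE (bigD1 l) //= big1 ?addr0 => [|j jl].
    rewrite mxE (bigD1 k) //= big1 ?addr0 => [|j jk]; last by rewrite mxE (negPf jk) mulr0.
    by rewrite mxE !eqxx mulr1.
  by rewrite mxE big1 ?mul0r // => i _; rewrite mxE (negPf jl) andbF mulr0.
rewrite mulr_sumr.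
transitivity (\sum_k \sum_l \sum_(s : 'S_d)
    d`!%:R^-1 * ((x *m permw C N s^-1) k k * (permw C N s *m y) l l)).
  apply: eq_bigr => k _; apply: eq_bigr => l _.
  rewrite /symmetrize -scalemxAr -scalemxAl mxE mulmx_sumr mulmx_suml summxE mulr_sumr.
  by apply: eq_bigr => s _; rewrite !mulmxA -[_ *m _ *m y]mulmxA unit_entry.
under eq_bigr do rewrite exchange_big.
rewrite exchange_big /=; apply: eq_bigr => s _; rewrite /mxtrace mulr_suml mulr_sumr.
by apply: eq_bigr => k _; rewrite !mulr_sumr.
Qed.

Section Wedderburn.
Variables (I : finType) (D : pred I) (r : I -> nat) (R : forall i, 'M[C]_(r i, dimE)).
Hypothesis Rst : forall i, D i -> submodule (R i).
Hypothesis Rfree : forall i, D i -> row_free (R i).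
Variable B : forall i, 'I_(r i) -> 'I_(r i) -> 'M[C]_dimE.
Hypothesis BA : forall i (p q : 'I_(r i)), D i -> inA (B p q).
Hypothesis B_diag : forall i (p q : 'I_(r i)), D i -> restr (R i) (B p q) = delta_mx p q.
Hypothesis B_off : forall i j (p q : 'I_(r i)), D i -> D j -> j != i -> restr (R j) (B p q) = 0.
Hypothesis restr_inj : forall Y, inA Y -> (forall i, D i -> restr (R i) Y = 0) -> Y = 0.

(** The [B p q] are the matrix units of one block and vanish on the others, so both sides act alike
    on every module, and the modules are jointly faithful. *)
Lemma wedderburn_expansion Y : inA Y ->
  Y = \sum_(i | D i) \sum_(p < r i) \sum_(q < r i) restr (R i) Y p q *: B p q.
Proof.
move=> AY; apply/eqP; rewrite -subr_eq0; apply/eqP; apply: restr_inj.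
  rewrite -scaleN1r; apply: inAD => //; apply/inAZ/inA_sum => i Di.
  by do 2!(apply: inA_sum => ? _); apply: inAZ; exact: BA.
move=> j Dj.
have lin0 : {morph restr (R j) : A B / A + B}.
  by move=> A A'; rewrite -[A in LHS]scale1r restr_lin scale1r.
have linN A : restr (R j) (- A) = - restr (R j) A.
  by rewrite -scaleN1r -[_ *: A]addr0 restr_lin /restr mulmx0 mul0mx addr0 scaleN1r.
have lin00 : restr (R j) 0 = 0 by rewrite /restr mulmx0 mul0mx.
have linZ c A : restr (R j) (c *: A) = c *: restr (R j) A.
  by rewrite -[c *: A]addr0 restr_lin lin00 addr0.
rewrite lin0 linN; apply/eqP; rewrite subr_eq0; apply/eqP.
rewrite (big_morph _ lin0 lin00) (bigD1 j) //= [X in _ = _ + X]big1 => [|i /andP[Di ij]].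
  rewrite addr0 {1}[restr (R j) Y]matrix_sum_delta (big_morph _ lin0 lin00).
  apply: eq_bigr => p _; rewrite (big_morph _ lin0 lin00).
  by apply: eq_bigr => q _; rewrite linZ B_diag.
rewrite (big_morph _ lin0 lin00) big1 // => p _.
rewrite (big_morph _ lin0 lin00) big1 // => q _.
by rewrite linZ B_off ?scaler0 // eq_sym.
Qed.

(* Both sides are the trace of [Y |-> x Y y] on the commutant of the symmetric *)
(* group, which is the product of the matrix algebras of the modules [R i].    *)
Lemma commutant_trace x y : inA x -> inA y ->
  \sum_k \sum_l (x *m symmetrize (delta_mx k l) *m y) k l =
  \sum_(i | D i) \tr (restr (R i) x) * \tr (restr (R i) y).
Proof.
move=> Ax Ay.
pose S k l := symmetrize (delta_mx k l : 'M[C]_dimE).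
have SE k l : (x *m S k l *m y) k l =
    \sum_(i | D i) \sum_(p < r i) \sum_(q < r i) restr (R i) (S k l) p q * (x *m B p q *m y) k l.
  rewrite {1}[S k l](wedderburn_expansion (inA_symmetrize (delta_mx k l))).
  rewrite mulmx_sumr mulmx_suml summxE; apply: eq_bigr => i _.
  rewrite mulmx_sumr mulmx_suml summxE; apply: eq_bigr => p _.
  rewrite mulmx_sumr mulmx_suml summxE; apply: eq_bigr => q _.
  by rewrite -scalemxAr -scalemxAl mxE.
under eq_bigr do under eq_bigr do rewrite SE.
under eq_bigr do rewrite exchange_big /=.
rewrite exchange_big /=; apply: eq_bigr => i Di.
under eq_bigr do rewrite exchange_big /=.
rewrite exchange_big /= /mxtrace mulr_suml; apply: eq_bigr => p _.
under eq_bigr do rewrite exchange_big /=.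
rewrite exchange_big /= mulr_sumr; apply: eq_bigr => q _.
have AxBy : inA (x *m B p q *m y) by apply: inAM => //; apply: inAM => //; exact: BA.
(* The sum over matrix units applies a coefficient functional to the symmetrization of [x B y],
   which is [x B y] itself. *)
transitivity (restr (R i) (x *m B p q *m y) p q).
  have redE (M : 'M[C]_dimE) : restr (R i) (symmetrize M) p q =
      \sum_k \sum_l restr (R i) (S k l) p q * M k l.
    rewrite {1}[M]matrix_sum_delta pair_big symmetrize_sum restr_sum summxE.
    by rewrite pair_big /=; apply: eq_bigr => kl _; rewrite mxE mulrC.
  by rewrite -redE symmetrizeE.
rewrite (restrM (Rst Di) (inAM Ax (BA p q Di)) Ay) (restrM (Rst Di) Ax (BA p q Di)).
rewrite B_diag //; move: (restr (R i) x) (restr (R i) y) => a b.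
rewrite -mulmxA mxE (bigD1 p) //= big1 ?addr0 => [|k kp]; last first.
  by rewrite mxE big1 ?mulr0 // => l _; rewrite mxE (negPf kp) mul0r.
congr (_ * _); rewrite mxE (bigD1 q) //= big1 ?addr0 => [|k kq].
  by rewrite mxE !eqxx mul1r.
by rewrite mxE (negPf kq) andbF mul0r.
Qed.

End Wedderburn.
End GenericTensor.

Lemma restr_scalarX (C : numClosedFieldType) (N d r k : nat)
    (R : 'M[C]_(r, #|{: {ffun 'I_d -> 'I_N}}|)) X (c : C) : row_free R -> submodule R ->
    R *m transp_mx C N d = c *: R ->
  restr R (tens d X *m transp_mx C N d ^+ k) = c ^+ k *: restr R (tens d X).
Proof.
move=> Rfree Rst RT; have AT := inA_transp C N d.
have -> : restr R (tens d X *m transp_mx C N d ^+ k) =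
    restr R (tens d X) *m restr R (transp_mx C N d ^+ k).
  by apply: restrM => //; [exact: inA_tens_all | exact: inAX].
have -> : restr R (transp_mx C N d ^+ k) = (c ^+ k)%:M.
  have : R *m transp_mx C N d ^+ k = c ^+ k *: R.
    elim: k => [|k IH]; first by rewrite !expr0 scale1r mulmx1.
    by rewrite exprSr -[_ * _]/(_ *m _) mulmxA IH -scalemxAl RT scalerA exprSr.
  move=> RTk; rewrite /restr RTk -scalemxAl; have := restr1 Rfree Rst.
  by rewrite /restr mulmx1 => ->; rewrite scalemx1.
by rewrite scalar_mxC mul_scalar_mx.
Qed.

Theorem schur_trace_identity (R : realType) (N d k : nat) (U1 U2 : 'M[complex R]_N) :
    (d <= N)%N -> U1 \is unitarymx -> U2 \is unitarymx ->
  \sum_(lam in young d) schur lam U1 * schur lam U2 *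
     (((casimir N lam)%:~R - (d * N)%:R) / 2) ^+ k =
  d`!%:R^-1 * \sum_(s : 'S_d) \tr (tens d U1 *m permw _ N s^-1) *
     \tr (permw _ N s *m (tens d U2 *m transp_mx _ N d ^+ k)).
Proof.
move=> dN uU1 uU2; pose C := complex R.
pose n := #|{: {ffun 'I_d -> 'I_N}}|.
have /choice[RR RRP] : forall lam : d.-tuple 'I_d.+1, exists p : {r & 'M[C]_(r, n)}, lam \in young d ->
    [/\ row_free (projT2 p), submodule (projT2 p), unitary_irreducible (subrep (projT2 p)),
      highest_weight (subrep (projT2 p)) (@wt N d lam)
    & 2 *: (projT2 p *m transp_mx C N d) = ((casimir N lam)%:~R - (d * N)%:R) *: projT2 p].
  move=> lam; have [lY|lY] := boolP (lam \in young d); last first.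
    by exists (existT (fun r => 'M[C]_(r, n)) 0%N 0).
  have [r [M MP]] := schur_module_exists C lY dN.
  by exists (existT (fun r => 'M[C]_(r, n)) r M).
pose rk lam := projT1 (RR lam); pose M lam : 'M[C]_(rk lam, n) := projT2 (RR lam).
pose rho lam := subrep (M lam).
have Mfree lam (lY : lam \in young d) : row_free (M lam) by case: (RRP lam lY).
have Mst lam (lY : lam \in young d) : submodule (M lam) by case: (RRP lam lY).
have rhoP lam (lY : lam \in young d) : unitary_repr (rho lam).
  by apply: subrep_repr; [exact: Mfree | exact: Mst].
have rhoI lam (lY : lam \in young d) : unitary_irreducible (rho lam) by case: (RRP lam lY).
have rho_hw lam (lY : lam \in young d) : highest_weight (rho lam) (@wt N d lam) by case: (RRP lam lY).
have MT lam (lY : lam \in young d) : M lam *m transp_mx C N d =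
    (((casimir N lam)%:~R - (d * N)%:R) / 2) *: M lam.
  have [_ _ _ _ h] := RRP lam lY; rewrite -/(M lam) in h.
  have two : (2 : C) != 0 by rewrite pnatr_eq0.
  by apply: (scalerI two); rewrite h scalerA mulrCA mulfV ?mulr1.
(* The witness is a Burnside preimage of a matrix unit, times the element acting as 1 on the module
   of [lam] and as 0 on the others. *)
have /choice[B BP] : forall x : {lam : d.-tuple 'I_d.+1 & ('I_(rk lam) * 'I_(rk lam))%type},
    exists Y : 'M[C]_n, tag x \in young d ->
    [/\ inA Y, restr (M (tag x)) Y = delta_mx (tagged x).1 (tagged x).2
      & forall mu, mu \in young d -> mu != tag x -> restr (M mu) Y = 0].
  move=> [lam [p q]] /=; have [lY|lY] := boolP (lam \in young d); last by exists 0.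
  have [a ga ra] := burnside (repr_hom (rhoP _ lY)) (rhoI _ lY) (delta_mx p q).
  have [b [gb rb rb0]] := family_unit dN rhoP rhoI rho_hw lY (rhoP _ lY) (rhoI _ lY) (rho_hw _ lY).
  exists (ev (tens d) (gmul a b)) => _; split.
  - by exists (gmul a b) => //; exact: galg_mul.
  - rewrite -ev_subrep -/(rho lam) (ev_mul (repr_hom (rhoP _ lY))) //.
    by rewrite [X in _ *m X]rb mulmx1.
  - move=> mu mY ml; rewrite -ev_subrep -/(rho mu) (ev_mul (repr_hom (rhoP _ mY))) //.
    by rewrite [X in _ *m X]rb0 // mulmx0.
pose B' lam (p q : 'I_(rk lam)) := B (existT (fun lam => ('I_(rk lam) * 'I_(rk lam))%type) lam (p, q)).
(* The character of the tensor power is a combination of those of the family. If every module kills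
   [Y], the trace of [Y] times its adjoint vanishes, hence so does [Y]. *)
have inj Y : inA Y -> (forall lam, lam \in young d -> restr (M lam) Y = 0) -> Y = 0.
  move=> AY Y0; apply: trace_adj_eq0.
  have [c cE] := character_span dN rhoP rho_hw (tens_repr C N d) (@tens_polynomial C N d).
  have [a ga aE] : inA (Y *m (Y^t*)%sesqui) by apply: inAM => //; exact: inA_adj.
  rewrite -aE (trace_ev_eq (sigma := rho) cE ga) big1 // => lam lY.
  rewrite [ev _ _]ev_subrep aE restrM ?Y0 ?mul0mx ?mxtrace0 ?mulr0 //.
  - exact: Mst.
  - exact: inA_adj.
have AU1 := inA_tens_all d U1.
have AU2 : inA (tens d U2 *m transp_mx C N d ^+ k).
  by apply: inAM; [exact: inA_tens_all | apply: inAX; exact: inA_transp].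
rewrite -symmetrized_trace.
rewrite (@commutant_trace C N d _ (fun lam : d.-tuple 'I_d.+1 => lam \in young d) rk M Mst B' _ _ _ inj _ _ AU1 AU2).
- apply: eq_bigr => lam lY; rewrite (restr_scalarX _ _ (Mfree _ lY) (Mst _ lY) (MT _ lY)).
  rewrite !(schurE dN rhoP rhoI rho_hw lY) // mxtraceZ [_ ^+ k * _]mulrC mulrA.
  by [].
- by move=> lam p q lY; case: (BP (existT _ lam (p, q)) lY).
- by move=> lam p q lY; case: (BP (existT _ lam (p, q)) lY).
- move=> lam mu p q lY mY ml; have [_ _] := BP (existT _ lam (p, q)) lY.
  by apply.
Qed.

(** * Factorizations into transpositions *)

Section Walks.
Variable d : nat.
Local Notation T := (transpositions d).
Implicit Types (g h x y : 'S_d).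

(** The number of factorizations of [g] into [r] transpositions: as these are involutions,
    multiplying by one strips the last factor. *)
Fixpoint nwalk r g : nat :=
  if r is r'.+1 then (\sum_(tau in T) nwalk r' (g * tau)%g)%N else (g == 1%g).

Lemma transpositionV tau : tau \in T -> (tau^-1)%g = tau.
Proof. by rewrite inE => /existsP[i /existsP[j /andP[_ /eqP->]]]; rewrite tpermV. Qed.

Lemma nwalk_left r g : nwalk r.+1 g = (\sum_(tau in T) nwalk r (tau * g)%g)%N.
Proof.
elim: r g => [|r IH] g.
  apply: eq_bigr => tau _ /=; congr nat_of_bool.
  by apply/eqP/eqP => [/(canRL (mulgK _))|/(canRL (mulKg _))] ->; rewrite ?mul1g ?mulgV ?mulg1 ?mulVg.
rewrite [LHS]/=; under eq_bigr => tau _ do rewrite -/(nwalk r.+1 _) IH.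
rewrite exchange_big /=; apply: eq_bigr => s _; apply: eq_bigr => t _.
by rewrite mulgA.
Qed.

Lemma nwalkV r g : nwalk r g^-1 = nwalk r g.
Proof.
elim: r g => [|r IH] g; first by rewrite /= invg_eq1.
rewrite [RHS]nwalk_left /=; apply: eq_bigr => tau tT.
by rewrite -IH invMg invgK transpositionV.
Qed.

(** An arbitrary [phi] lets this serve both the regular representation and the action on tensors. *)
Lemma transp_pow_expansion (F : comNzRingType) n (phi : 'S_d -> 'M[F]_n) r :
    phi 1%g = 1%:M -> {morph phi : g h / (g * h)%g >-> g *m h} ->
  (\sum_(tau in T) phi tau) ^+ r = \sum_g (nwalk r g)%:R *: phi g.
Proof.
move=> phi1 phiM; elim: r => [|r IH].
  rewrite expr0 (bigD1 1%g) //= eqxx scale1r big1 ?addr0 ?phi1 // => g /negPf g1.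
  by rewrite g1 scale0r.
rewrite exprSr IH -[LHS]/(_ *m _) mulmx_suml.
under eq_bigr do rewrite mulmx_sumr; rewrite exchange_big /=.
under [RHS]eq_bigr do rewrite natr_sum scaler_suml; rewrite [RHS]exchange_big /=.
apply: eq_bigr => tau tT; rewrite [RHS](reindex_inj (mulIg tau)) /=.
have tt : (tau * tau = 1)%g by rewrite -{2}(transpositionV tT) mulgV.
by apply: eq_bigr => g _; rewrite -scalemxAl -phiM -mulgA tt mulg1.
Qed.

(** The first step of a walk is the leftmost factor of [x^-1 * y], hence the use of [nwalk_left]. *)
Lemma path_count r x y :
  #|[set t : r.-tuple 'S_d | path (@hurwitz_cayley d) x t & last x t == y]| = nwalk r (x^-1 * y)%g.
Proof.
elim: r x => [|r IH] x.
  rewrite /= -eq_invg_mul invgK; case: eqVneq => [->|xy].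
    rewrite (_ : [set t | _] = [set: 0.-tuple 'S_d]) ?cardsT ?card_tuple //.
    by apply/setP => t; rewrite !inE tuple0 /= eqxx.
  apply/eqP; rewrite cards_eq0; apply/eqP/setP => t.
  by rewrite !inE tuple0 /= (negPf xy).
have -> : nwalk r.+1 (x^-1 * y)%g = (\sum_(z | hurwitz_cayley x z) nwalk r (z^-1 * y)%g)%N.
  rewrite nwalk_left [RHS](reindex_inj (mulgI x)) /=; apply: eq_big => [tau|tau tT].
    by apply/idP/existsP => [tT|[s /andP[sT /eqP/mulgI->]] //]; exists tau; rewrite tT /=.
  by rewrite invMg (transpositionV tT) -mulgA.
rewrite -sum1_card big_mkcond /=.
rewrite (reindex (fun p : 'S_d * r.-tuple 'S_d => [tuple of p.1 :: p.2])) /=; last first.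
  exists (fun t => (thead t, [tuple of behead t])) => [[z t]|t] _ /=.
    by congr (_, _); apply: val_inj.
  by rewrite -tuple_eta.
rewrite -(pair_bigA _ (fun z (t : r.-tuple 'S_d) =>
  if [tuple of z :: t] \in [set t : r.+1.-tuple 'S_d | path (@hurwitz_cayley d) x t & last x t == y]
  then 1 else 0)%N) /=.
rewrite [RHS]big_mkcond; apply: eq_bigr => z _.
case: ifP => xz; last by rewrite big1 // => t _; rewrite inE /= xz.
rewrite -IH -sum1_card [RHS]big_mkcond; apply: eq_bigr => t _.
by rewrite !inE /= xz.
Qed.

End Walks.

(** * Double Hurwitz numbers *)

Section Hurwitz.
Variables (C : numClosedFieldType) (d : nat).
Local Notation Y := (d.-tuple 'I_d.+1).
Local Notation G := [set: 'S_d]%G.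
Implicit Types (alpha beta : Y) (s x y : 'S_d).

Lemma cycle_classV alpha x : (x^-1%g \in cycle_class alpha) = (x \in cycle_class alpha).
Proof. by rewrite !inE porbitsV. Qed.

Lemma coef_sum (I : Type) (r : seq I) (P : pred I) (c : I -> C) (A : I -> 'M[C]_(gcard G)) s :
  coef (\sum_(i <- r | P i) c i *: A i) s = \sum_(i <- r | P i) c i * coef (A i) s.
Proof. by rewrite /coef linear_sum summxE; apply: eq_bigr => i _; rewrite linearZ mxE. Qed.

Lemma coef_regular x s : coef (regular_repr C G x) s = (s == x)%:R.
Proof.
rewrite /coef /gring_row !mxE gring_indexK ?group1 // mul1g eqxx /=.
congr (nat_of_bool _)%:R; apply/eqP/eqP => [|->//].
by move/(congr1 enum_val); rewrite !gring_indexK ?inE.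
Qed.

Lemma regularM x y : regular_repr C G (x * y)%g = regular_repr C G x *m regular_repr C G y.
Proof. by rewrite repr_mxM ?inE. Qed.

Lemma transp_sumX r : transp_sum C d ^+ r = \sum_g (nwalk r g)%:R *: regular_repr C G g.
Proof. by rewrite -(transp_pow_expansion _ (repr_mx1 _)) // => x y; exact: regularM. Qed.

(** The common value of the coefficient, the matrix element and the number of walks. The argument
    [y * x^-1] solves [x * y^-1 * g = 1] for [g], classes being closed under inversion. *)
Definition hurwitz_number alpha beta r : nat :=
  (\sum_(x in cycle_class alpha) \sum_(y in cycle_class beta) nwalk r (y * x^-1)%g)%N.

Lemma hurwitzE alpha beta r : hurwitz C alpha beta r = (hurwitz_number alpha beta r)%:R.
Proof.
rewrite /hurwitz transp_sumX /class_sum /gset_mx !mulmx_suml.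
rewrite -[X in coef X]scale1r scaler_sumr coef_sum natr_sum; apply: eq_bigr => x _.
rewrite mul1r [X in X *m _]mulmx_sumr mulmx_suml.
rewrite -[X in coef X]scale1r scaler_sumr coef_sum natr_sum (reindex_inj invg_inj) /=.
apply: eq_big => [y|y _]; first by rewrite cycle_classV.
rewrite mul1r mulmx_sumr (eq_bigr (fun g => (nwalk r g)%:R *: regular_repr C G (x * y^-1 * g)%g)).
  rewrite coef_sum (bigD1 (y * x^-1)%g) //= big1 ?addr0 => [|g gxy].
    by rewrite coef_regular -mulgA mulKg mulgV eqxx mulr1.
  rewrite coef_regular; have -> : (1%g == x * y^-1 * g)%g = false; last by rewrite mulr0.
  apply: contraNF gxy => /eqP xyg; apply/eqP.
  by rewrite -[g](mulKg (x * y^-1)%g) -xyg mulg1 invMg invgK.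
by move=> g _; rewrite -scalemxAr -!regularM.
Qed.

Lemma hurwitz_matrix_element alpha beta r :
  hurwitz C alpha beta r =
  matrix_element (class_sum C alpha) (transp_sum C d ^+ r) (class_sum C beta).
Proof.
have coef_class s : coef (class_sum C alpha) s = (s \in cycle_class alpha)%:R.
  rewrite /class_sum /gset_mx -[X in coef X]scale1r scaler_sumr coef_sum.
  rewrite (eq_bigr (fun x => (s == x)%:R)) => [|x _]; last by rewrite mul1r coef_regular.
  have [sK|sK] := boolP (s \in cycle_class alpha).
    rewrite (bigD1 s) //= eqxx big1 ?addr0 // => x /andP[_ xs].
    by rewrite eq_sym (negPf xs).
  by rewrite big1 // => x xK; case: eqP => // sx; rewrite sx xK in sK.
rewrite hurwitzE /hurwitz_number /matrix_element natr_sum [LHS]big_mkcond /=.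
apply: eq_bigr => x _; rewrite coef_class; case: ifP => xK; last by rewrite conjC_nat mul0r.
rewrite conjC_nat mul1r transp_sumX /class_sum /gset_mx mulmx_sumr natr_sum.
rewrite -[X in coef X]scale1r scaler_sumr coef_sum; apply: eq_bigr => y _.
rewrite mul1r mulmx_suml (eq_bigr (fun g => (nwalk r g)%:R *: regular_repr C G (g * y)%g)).
  rewrite coef_sum (bigD1 (x * y^-1)%g) //= big1 ?addr0 => [|g gxy].
    by rewrite coef_regular mulgKV eqxx mulr1 -nwalkV invMg invgK.
  rewrite coef_regular; have -> : (x == g * y)%g = false; last by rewrite mulr0.
  by apply: contraNF gxy => /eqP ->; rewrite mulgK.
by move=> g _; rewrite -scalemxAl -regularM.
Qed.

Lemma card_walks alpha beta r : #|walks alpha beta r| = hurwitz_number alpha beta r.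
Proof.
transitivity (\sum_(x in cycle_class alpha) \sum_(y in cycle_class beta) nwalk r (x^-1 * y)%g)%N.
  rewrite -sum1_card /walks.
  rewrite (partition_big (fun w : 'S_d * r.-tuple 'S_d => w.1) (mem (cycle_class alpha))) /=; last first.
    by move=> w; rewrite inE => /and3P[].
  apply: eq_bigr => x xK.
  rewrite (partition_big (fun w : 'S_d * r.-tuple 'S_d => last w.1 w.2) (mem (cycle_class beta))) /=; last first.
    by move=> w; rewrite inE => /andP[/and3P[]].
  apply: eq_bigr => y yK; rewrite -path_count -sum1_card.
  rewrite (reindex_onto (fun t : r.-tuple 'S_d => (x, t)) snd) /=; last first.
    by move=> [x' t] /andP[/andP[_ /eqP /= ->]].
  apply: eq_bigl => t; rewrite [t \in _]inE [(x, t) \in _]inE /= xK !eqxx !andbT /=.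
  by case: (last x t =P y) => [->|]; rewrite ?yK ?andbF ?andbT.
rewrite (reindex_inj invg_inj) /=; apply: eq_big => [x|x xK]; first by rewrite cycle_classV.
rewrite (reindex_inj invg_inj) /=; apply: eq_big => [y|y yK]; first by rewrite cycle_classV.
by rewrite invgK -nwalkV invMg invgK.
Qed.

Lemma hurwitz_walks alpha beta r : hurwitz C alpha beta r = #|walks alpha beta r|%:R.
Proof. by rewrite hurwitzE card_walks. Qed.

End Hurwitz.

Lemma pos_seq_inj (s t : seq nat) : all (leq 1) s -> all (leq 1) t ->
  (forall i, nth 0%N s i = nth 0%N t i) -> s = t.
Proof.
elim: s t => [|a s IH] [|b t] //=.
- by move=> _ /andP[b0 _] /(_ 0%N) /= e; rewrite -e in b0.
- by move=> /andP[a0 _] _ /(_ 0%N) /= e; rewrite e in a0.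
move=> /andP[_ s1] /andP[_ t1] e; congr (_ :: _); first exact: (e 0%N).
by apply: IH => // i; exact: (e i.+1).
Qed.

(** * Cycle types as Young diagrams *)

Section CycleTypes.
Variable d : nat.
Local Notation Y := (d.-tuple 'I_d.+1).
Implicit Types (s : 'S_d) (alpha : Y).

Lemma sumn_cycle_sizes s : sumn [seq #|(c : {set 'I_d})| | c <- enum (porbits s)] = d.
Proof.
rewrite sumnE big_map big_enum /= -[RHS]card_ord -[RHS]cardsT.
rewrite -(@acts_sum_card_orbit _ _ _ (perm_action 'I_d) <[s]>%G [set: 'I_d]) //; last first.
  by apply/actsP => a _ x; rewrite !inE.
apply: eq_bigl => c; apply/imsetP/imsetP => -[x _ ->]; exists x; rewrite ?inE //; by rewrite porbit.unlock.
Qed.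

Lemma cycle_type_exists s : exists2 alpha, alpha \in young d & s \in cycle_class alpha.
Proof.
pose l := sort geq [seq #|(c : {set 'I_d})| | c <- enum (porbits s)].
have lE : perm_eq l [seq #|(c : {set 'I_d})| | c <- enum (porbits s)] by rewrite perm_sort.
have ls : sorted geq l by apply: sort_sorted => a b; exact: leq_total.
have lsum : sumn l = d by rewrite (perm_sumn lE) sumn_cycle_sizes.
have [alpha aY aE] := young_of_seq ls lsum; exists alpha => //.
suff rE : rows alpha = l by rewrite inE perm_sym rE.
apply: pos_seq_inj => //; first by rewrite /rows filter_all.
rewrite (perm_all _ lE); apply/allP => _ /mapP[c + ->].
rewrite mem_enum => /imsetP[x _ ->]; rewrite card_gt0; apply/set0Pn.
by exists x; exact: porbit_id.
Qed.

Lemma cycle_type_uniq s alpha beta : alpha \in young d -> beta \in young d ->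
  s \in cycle_class alpha -> s \in cycle_class beta -> alpha = beta.
Proof.
move=> aY bY; rewrite !inE => sa sb; apply: young_inj => // i.
rewrite /row_len; congr nth; apply: (sorted_eq (leT := geq)); rewrite ?sorted_rows //.
- by move=> a b c ba cb; exact: leq_trans cb ba.
- by move=> a b; rewrite andbC => /anti_leq.
by rewrite perm_sym in sa; exact: perm_trans sa sb.
Qed.

Lemma sum_cycle_types (V : nmodType) (F : 'S_d -> V) :
  \sum_(alpha in young d) \sum_(s in cycle_class alpha) F s = \sum_s F s.
Proof.
rewrite (exchange_big_dep predT) //=; apply: eq_bigr => s _.
have [alpha aY sa] := cycle_type_exists s.
rewrite (bigD1 alpha) ?aY //= big1 ?addr0 // => beta /andP[/andP[bY sb] ba].
by rewrite (cycle_type_uniq bY aY sb sa) eqxx in ba.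
Qed.

End CycleTypes.

Section TraceExpansion.
Variables (C : numClosedFieldType) (N d : nat).
Implicit Types (U : 'M[C]_N) (s x y : 'S_d).

Lemma trace_psum (i0 : 'I_N) U s (alpha : d.-tuple 'I_d.+1) :
  U \is unitarymx -> s \in cycle_class alpha -> \tr (tens d U *m permw C N s) = psum alpha U.
Proof.
move=> uU; rewrite inE => sa; rewrite (trace_tens_perm i0 _ uU) /psum -(perm_big _ sa) big_map.
by rewrite big_enum.
Qed.

(** Expanding the power of [transp_mx] replaces [s] by permutations [y], weighted by the number of
    factorizations of [y * s^-1]; then [s] and [y] are sorted by cycle type. *)
Lemma trace_transp_expansion (i0 : 'I_N) U1 U2 k : U1 \is unitarymx -> U2 \is unitarymx ->
  \sum_(s : 'S_d) \tr (tens d U1 *m permw C N s^-1)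
     * \tr (permw C N s *m (tens d U2 *m transp_mx C N d ^+ k))
  = \sum_(alpha in young d) \sum_(beta in young d)
      psum2 alpha beta U1 U2 * hurwitz C alpha beta k.
Proof.
move=> u1 u2.
have trV s : \tr (tens d U1 *m permw C N s^-1) = \tr (tens d U1 *m permw C N s).
  by rewrite !(trace_tens_perm i0) // porbitsV.
have trK s : \tr (permw C N s *m (tens d U2 *m transp_mx C N d ^+ k)) =
    \sum_y (nwalk k (y * s^-1)%g)%:R * \tr (tens d U2 *m permw C N y).
  rewrite (transp_pow_expansion _ (permw1 _ _ _) (@permwM _ _ _)) mxtrace_mulC -mulmxA.
  rewrite mulmx_suml mulmx_sumr raddf_sum (reindex_inj (mulIg s^-1%g)) /=.
  apply: eq_bigr => y _; rewrite -scalemxAl -scalemxAr linearZ /= -permwM.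
  by rewrite -mulgA mulVg mulg1.
rewrite -(sum_cycle_types (fun s => _)); apply: eq_bigr => alpha aY.
under eq_bigr => x xa do rewrite trV trK (trace_psum i0 u1 xa) mulr_sumr -(sum_cycle_types (fun y => _)).
rewrite exchange_big; apply: eq_bigr => beta bY; rewrite hurwitzE natr_sum mulr_sumr.
apply: eq_bigr => x xa; rewrite natr_sum mulr_sumr; apply: eq_bigr => y yb.
by rewrite (trace_psum i0 u2 yb) /psum2 mulrCA mulrC.
Qed.

End TraceExpansion.

(** * Convergence *)

Local Open Scope classical_set_scope.
Local Open Scope ring_scope.
Local Open Scope complex_scope.

Lemma normr_real_complex (R : rcfType) (x : R) : `|x%:C| = `|x|%:C.
Proof. by rewrite normc_def /= expr0n addr0 sqrtr_sqr. Qed.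

Lemma series_real_complex (R : realType) (u : R^nat) n :
  series (fun r => (u r)%:C : R[i]^o) n = (series u n)%:C.
Proof. by rewrite /series /= rmorph_sum. Qed.

Lemma cvg_real_complex (R : realType) (u : R^nat) (l : R) :
  u @ \oo --> l -> (fun n => (u n)%:C : R[i]^o) @ \oo --> (l%:C : R[i]^o).
Proof.
move=> ul; apply/cvgrPdist_lt => e e0.
have [e1 e1E] : exists e1 : R, e = e1%:C.
  by exists (complex.Re e); apply/esym/RRe_real/ger0_real/ltW.
rewrite e1E in e0 *; rewrite ltcR in e0.
move/cvgrPdist_lt/(_ _ e0) : ul; apply: filterS => n.
by rewrite -rmorphB /= normr_real_complex ltcR.
Qed.

Lemma cvg_bigsum (K : numFieldType) (V : normedModType K) (I : Type) (r : seq I) (P : pred I)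
    (f : I -> V^nat) (l : I -> V) :
  (forall i, P i -> f i @ \oo --> l i) ->
  (fun n => \sum_(i <- r | P i) f i n) @ \oo --> \sum_(i <- r | P i) l i.
Proof.
move=> fl; elim: r => [|i r IH].
  rewrite big_nil (_ : (fun=> _) = fun=> 0); first exact: cvg_cst.
  by apply/funext => n; rewrite big_nil.
rewrite big_cons; case: ifP => Pi.
  rewrite (_ : (fun=> _) = f i \+ (fun n => \sum_(i <- r | P i) f i n)); first exact: cvgD (fl _ Pi) IH.
  by apply/funext => n; rewrite big_cons Pi.
by under eq_fun do rewrite big_cons Pi.
Qed.

Lemma nwalk_le d r (g : 'S_d) : (nwalk r g <= #|transpositions d| ^ r)%N.
Proof.
elim: r g => [|r IH] g; first exact: leq_b1.
rewrite /= expnS -sum_nat_const; exact: leq_sum.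
Qed.

Lemma hurwitz_number_le d (alpha beta : d.-tuple 'I_d.+1) r :
  (hurwitz_number alpha beta r
    <= #|cycle_class alpha| * #|cycle_class beta| * #|transpositions d| ^ r)%N.
Proof.
rewrite -mulnA -sum_nat_const; apply: leq_sum => x _.
by rewrite -sum_nat_const; apply: leq_sum => y _; exact: nwalk_le.
Qed.

(** Each step has at most [#|transpositions d|] choices, so a multiple of an exponential series
    dominates. *)
Lemma cvg_hurwitz_series (R : realType) (d : nat) (alpha beta : d.-tuple 'I_d.+1) (x : R) :
  cvgn (series (fun r => `|exp_coeff x r * (hurwitz_number alpha beta r)%:R|)).
Proof.
pose c : R := (#|cycle_class alpha| * #|cycle_class beta|)%:R.
apply: (@series_le_cvg _ _ (c *: exp_coeff (`|x| * #|transpositions d|%:R))) => [n|n|n|].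
- exact: normr_ge0.
- by rewrite mulr_ge0 ?ler0n // exp_coeff_ge0 // mulr_ge0.
- rewrite -[leRHS]/(c * exp_coeff _ _) /exp_coeff /= exprMn normrM normf_div normrX !normr_nat.
  rewrite (_ : c * _ = `|x| ^+ n / n`!%:R * (c * #|transpositions d|%:R ^+ n)); last by ring.
  rewrite ler_wpM2l ?divr_ge0 ?exprn_ge0 // /c -natrX -natrM ler_nat.
  exact: hurwitz_number_le.
by apply: is_cvg_seriesZ; exact: is_cvg_series_exp_coeff.
Qed.

Lemma youngN_young d N : (d <= N)%N -> youngN d N = young d.
Proof.
move=> dN; apply/setP => lam; rewrite inE andb_idr // => _.
exact: leq_trans (size_rows_le lam) dN.
Qed.

Section Expansion.
Variables (R : realType) (d N : nat) (t : R).
Hypotheses (hd : (1 <= d)%N) (hdN : (d <= N)%N).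
Local Notation Y := (d.-tuple 'I_d.+1).
Implicit Types (lam alpha beta : Y).

Let x : R := - (t / N%:R).
Let kappa lam : R := ((casimir N lam)%:~R - (d * N)%:R) / 2.
Let q alpha beta (r : nat) : R := exp_coeff x r * (hurwitz_number alpha beta r)%:R.

Let N0 : N%:R != 0 :> R.
Proof. by rewrite pnatr_eq0 -lt0n (leq_trans hd). Qed.

Lemma expR_casimir lam :
  expR (- (t / (2 * N%:R)) * (casimir N lam)%:~R)
  = expR (- t / 2) ^+ d * expR (x * kappa lam).
Proof.
rewrite -expRM_natl -expRD /x /kappa natrM; congr expR.
by field.
Qed.

Lemma term_real alpha beta r :
  (- t%:C) ^+ r / (r`!%:R * N%:R ^+ r) * hurwitz R[i] alpha beta r = (q alpha beta r)%:C.
Proof.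
rewrite hurwitzE /q rmorphM rmorph_nat; congr (_ * _).
rewrite /exp_coeff /= (_ : x ^+ r / r`!%:R = (- t) ^+ r / (r`!%:R * N%:R ^+ r)).
  by rewrite [RHS]rmorphM rmorphXn rmorphN fmorphV rmorphM rmorph_nat rmorphXn rmorph_nat.
by rewrite /x -mulNr expr_div_n invfM -mulrA [_^-1 * _^-1]mulrC.
Qed.

(** Truncating both sides at the same order leaves finite sums, to which the trace identity applies
    power by power. *)
Lemma partial_sums U1 U2 n : U1 \is unitarymx -> U2 \is unitarymx ->
  \sum_(lam in young d) schur lam U1 * schur lam U2 * (series (exp_coeff (x * kappa lam)) n)%:C
  = d`!%:R^-1 * \sum_(alpha in young d) \sum_(beta in young d)
      @psum2 R[i] N d alpha beta U1 U2 * (series (q alpha beta) n)%:C.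
Proof.
move=> u1 u2; have i0 : 'I_N by case: N hdN hd => [|m _ _]; [case: d | exact: ord0].
transitivity (\sum_(0 <= r < n) (x ^+ r / r`!%:R)%:C *
   \sum_(lam in young d) schur lam U1 * schur lam U2
     * (((casimir N lam)%:~R - (d * N)%:R) / 2) ^+ r).
  under [RHS]eq_bigr do rewrite mulr_sumr.
  rewrite exchange_big; apply: eq_bigr => lam _; rewrite /series /= rmorph_sum mulr_sumr.
  apply: eq_bigr => r _; rewrite [RHS]mulrCA; congr (_ * _).
  rewrite /exp_coeff /= exprMn mulrAC rmorphM; congr (_ * _).
  by rewrite /kappa rmorphXn rmorphM fmorphV rmorphB rmorph_int !rmorph_nat.
rewrite mulr_sumr; under [RHS]eq_bigr do rewrite mulr_sumr.
transitivity (\sum_(0 <= r < n) \sum_(alpha in young d) \sum_(beta in young d)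
   d`!%:R^-1 * (psum2 alpha beta U1 U2 * (q alpha beta r)%:C)).
  apply: eq_bigr => r _; rewrite (schur_trace_identity _ hdN u1 u2) mulrCA.
  rewrite (trace_transp_expansion _ i0 _ u1 u2) !mulr_sumr; apply: eq_bigr => alpha _.
  rewrite !mulr_sumr; apply: eq_bigr => beta _; rewrite hurwitzE /q [in RHS]rmorphM rmorph_nat.
  by rewrite [X in _ * X = _]mulrCA.
rewrite exchange_big; apply: eq_bigr => alpha _.
rewrite exchange_big; apply: eq_bigr => beta _.
by rewrite /series /= rmorph_sum !mulr_sumr.
Qed.

Lemma cvg_term alpha beta :
  cvgn (series (fun r => `|(q alpha beta r)%:C| : R[i]^o))
  /\ cvgn (series (fun r => (q alpha beta r)%:C : R[i]^o)).
Proof.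
have qabs := @cvg_hurwitz_series R d alpha beta x.
split; apply/cvg_ex.
  exists (limn (series (fun r => `|q alpha beta r|)))%:C.
  rewrite (_ : series _ = fun n => (series (fun r => `|q alpha beta r|) n)%:C : R[i]^o).
    exact: cvg_real_complex.
  by apply/funext => n; rewrite -series_real_complex; apply: eq_bigr => r _; rewrite normr_real_complex.
exists (limn (series (q alpha beta)))%:C.
rewrite (_ : series _ = fun n => (series (q alpha beta) n)%:C : R[i]^o).
  by apply: cvg_real_complex; exact: normed_cvg.
by apply/funext => n; rewrite series_real_complex.
Qed.

Lemma Zcyl_expansion U1 U2 : U1 \is unitarymx -> U2 \is unitarymx ->
  @Zcyl R N d t U1 U2 = (expR (- t / 2) ^+ d)%:C / d`!%:R *
    \sum_(alpha in young d) \sum_(beta in young d)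
       psum2 alpha beta U1 U2 * limn (series (fun r => (q alpha beta r)%:C : R[i]^o)).
Proof.
move=> u1 u2; rewrite /Zcyl youngN_young //.
transitivity ((expR (- t / 2) ^+ d)%:C *
    \sum_(lam in young d) schur lam U1 * schur lam U2 * (expR (x * kappa lam))%:C).
  rewrite mulr_sumr; apply: eq_bigr => lam _.
  by rewrite expR_casimir rmorphM mulrCA.
rewrite -[RHS]mulrA; congr (_ * _).
(* The truncations converge to both sides, once in each of their two expressions, and the limit is
   unique. *)
pose S n : R[i]^o := \sum_(lam in young d) schur lam U1 * schur lam U2
   * (series (exp_coeff (x * kappa lam)) n)%:C.
have Sl : S @ \oo --> (\sum_(lam in young d)
    schur lam U1 * schur lam U2 * (expR (x * kappa lam))%:C : R[i]^o).
  apply: cvg_bigsum => lam _.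
  apply: (cvgZl_tmp (V := R[i]^o) (k := schur lam U1 * schur lam U2)
    (f := fun n => (series (exp_coeff (x * kappa lam)) n)%:C)).
  by apply: cvg_real_complex; exact: is_cvg_series_exp_coeff.
have Sr : S @ \oo --> (d`!%:R^-1 * \sum_(alpha in young d) \sum_(beta in young d)
    psum2 alpha beta U1 U2 * limn (series (fun r => (q alpha beta r)%:C : R[i]^o)) : R[i]^o).
  have -> : S = d`!%:R^-1 \*: (fun n => \sum_(alpha in young d) \sum_(beta in young d)
      psum2 alpha beta U1 U2 * (series (q alpha beta) n)%:C : R[i]^o).
    by apply/funext => n; exact: partial_sums.
  apply: cvgZl_tmp.
  apply: cvg_bigsum => alpha _; apply: cvg_bigsum => beta _.
  apply: (cvgZl_tmp (V := R[i]^o) (k := psum2 alpha beta U1 U2)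
    (f := fun n => (series (q alpha beta) n)%:C)).
  rewrite (_ : (fun=> _) = series (fun r => (q alpha beta r)%:C : R[i]^o)).
    by have [] := cvg_term alpha beta.
  by apply/funext => n; rewrite series_real_complex.
exact: (cvg_unique (@norm_hausdorff _ _) Sl Sr).
Qed.

End Expansion.

Theorem theorem4p1 (R : realType) (d N : nat) (t : R)
    (hd : (1 <= d)%N) (hdN : (d <= N)%N) (ht : 0 < t) :
  let z : R := expR (- t / 2) in
  let term (alpha beta : d.-tuple 'I_d.+1) (r : nat) : R[i]^o :=
    (- t%:C) ^+ r / (r`!%:R * N%:R ^+ r) * hurwitz R[i] alpha beta r in
  [/\ (* absolute convergence of the series *)
      forall alpha beta, alpha \in young d -> beta \in young d ->
        cvgn (series (fun r => `|term alpha beta r| : R[i]^o))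
        /\ cvgn (series (term alpha beta)),
      (* the expansion, as an equality of functions on U_N x U_N *)
      forall U1 U2 : 'M[R[i]]_N, U1 \is unitarymx -> U2 \is unitarymx ->
        Zcyl d t U1 U2 =
          (z ^+ d)%:C / d`!%:R *
          \sum_(alpha in young d) \sum_(beta in young d)
             psum2 alpha beta U1 U2 * limn (series (term alpha beta))
    & (* the coefficients are double Hurwitz numbers *)
      forall alpha beta, alpha \in young d -> beta \in young d ->
      forall r : nat,
        hurwitz R[i] alpha beta r
          = matrix_element (class_sum R[i] alpha) (transp_sum R[i] d ^+ r)
              (class_sum R[i] beta)
        /\ hurwitz R[i] alpha beta r = #|walks alpha beta r|%:R].
Proof.
move=> z term.
have termE alpha beta : term alpha beta = fun r =>
    (exp_coeff (- (t / N%:R)) r * (hurwitz_number alpha beta r)%:R)%:C.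
  by apply/funext => r; exact: term_real.
split.
- by move=> alpha beta _ _; rewrite termE; exact: cvg_term.
- move=> U1 U2 u1 u2; rewrite (Zcyl_expansion t hd hdN u1 u2).
  by congr (_ * _); apply: eq_bigr => alpha _; apply: eq_bigr => beta _; rewrite termE.
- move=> alpha beta _ _ r; split; last exact: hurwitz_walks.
  exact: hurwitz_matrix_element.
Qed.
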